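(* Under the setting and notation of the context, suppose Assumption $(\mathcal A)$ holds and put $\bar S=\bar A_1+\dots+\bar A_{\bar n}$. Then, as $x\to 0$, $$\mathbb P[X\le x]=\frac{C}{\bar S}\left(\log\tfrac1x\right)^{-\frac{1+\bar n}{2}}x^{\sum_{k=1}^{\bar n}\bar A_k\left(\log\frac{\bar S}{\bar A_k}+\bar\mu_k\right)}\exp\left\{-\tfrac12\bar S\log^2\tfrac1x\right\}\left(1+O\left(\left(\log\tfrac1x\right)^{-1}\right)\right),$$ where $$C=\frac{1}{\sqrt{2\pi}\sqrt{\det\bar{\mathfrak B}}}\frac{\sqrt{\bar S}}{\sqrt{\bar A_1\cdots\bar A_{\bar n}}}\exp\left\{-\tfrac12\sum_{i,j=1}^{\bar n}\bar a_{ij}\left(\log\tfrac{\bar S}{\bar A_i}+\bar\mu_i\right)\left(\log\tfrac{\bar S}{\bar A_j}+\bar\mu_j\right)\right\}.$$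
   Context: Let $Y=(Y_1,\dots,Y_n)$ be a Gaussian vector with mean $\mu\in\mathbb R^n$ and covariance matrix $\mathfrak B=(b_{ij})$ with $\det\mathfrak B>0$. Let $X=\sum_{i=1}^n e^{Y_i}$. Let $\Delta_n=\{w\in\mathbb R^n: w_i\ge0,\ \sum_i w_i=1\}$ and let $\bar w$ be the unique minimizer of $w^\top\mathfrak B w$ over $\Delta_n$. Let $\bar I=\{i:\bar w_i\ne0\}$ and $\bar n=|\bar I|$; since $X$ is symmetric in the components, the coordinates are labeled so that $\bar I=\{1,\dots,\bar n\}$. Set $\bar\mu=(\mu_1,\dots,\mu_{\bar n})$, $\bar{\mathfrak B}=(b_{ij})_{i,j=1}^{\bar n}$, let $\bar a_{ij}$ be the entries of $\bar{\mathfrak B}^{-1}$ and $\bar A_k=\sum_{j=1}^{\bar n}\bar a_{kj}$ (one has $\bar A_k>0$). Let $e^i$ denote the $i$-th standard basis vector of $\mathbb R^n$. Assumption $(\mathcal A)$: for every $i\in\{1,\dots,n\}\setminus\bar I$, $(e^i-\bar w)^\top\mathfrak B\bar w\neq0$. *)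

(* Defs.v *)
From HB Require Import structures.
From mathcomp Require Import all_boot all_order all_algebra.
From mathcomp Require Import all_classical all_reals all_analysis.
Unset Printing Implicit Defensive.
Import Order.TTheory GRing.Theory Num.Def Num.Theory.
Local Open Scope classical_set_scope.
Local Open Scope ring_scope.

Section Defs.
Context {R : realType} {n : nat}.

Definition qform (B : 'M[R]_n) (w : 'I_n -> R) : R :=
  \sum_(i < n) \sum_(j < n) w i * B i j * w j.

Definition simplex : set ('I_n -> R) :=
  [set w | (forall i, 0 <= w i) /\ \sum_(i < n) w i = 1].

Definition simplex_minimizer (B : 'M[R]_n) (w : 'I_n -> R) : Prop :=
  simplex w /\ (forall v, simplex v -> qform B w <= qform B v).

(* Y = (Y_1,...,Y_n) is a Gaussian vector with mean mu and covariance B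
   (B positive definite): every nontrivial linear combination t.Y is
   normally distributed with mean t.mu and variance t^T B t. *)
Definition gaussian_vector {d : measure_display} {T : measurableType d}
  (P : probability T R) (Y : 'I_n -> T -> R) (mu : 'I_n -> R) (B : 'M[R]_n) : Prop :=
  forall t : 'I_n -> R, (exists i, t i != 0) ->
  forall A : set R, measurable A ->
    P ((fun om => \sum_(i < n) t i * Y i om) @^-1` A)
    = normal_prob (\sum_(i < n) t i * mu i) (Num.sqrt (qform B t)) A.

Definition assumption_A (B : 'M[R]_n) (w : 'I_n -> R) : Prop :=
  forall i : 'I_n, w i = 0 ->
    (\sum_(j < n) B i j * w j) - qform B w != 0.

Definition Ibar (w : 'I_n -> R) : {set 'I_n} := [set i | w i != 0].
Definition nbar (w : 'I_n -> R) : nat := #|Ibar w|.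
Definition bidx (w : 'I_n -> R) (k : 'I_(nbar w)) : 'I_n := enum_val k.

Definition Bbar (B : 'M[R]_n) w : 'M[R]_(nbar w) :=
  \matrix_(i, j) B (bidx w i) (bidx w j).
Definition mubar (mu : 'I_n -> R) w (k : 'I_(nbar w)) : R := mu (bidx w k).
Definition abar (B : 'M[R]_n) w : 'M[R]_(nbar w) := invmx (Bbar B w).
Definition Abar (B : 'M[R]_n) w (k : 'I_(nbar w)) : R :=
  \sum_(j < nbar w) abar B w k j.
Definition Sbar (B : 'M[R]_n) w : R := \sum_(k < nbar w) Abar B w k.

Definition cbar (B : 'M[R]_n) (mu : 'I_n -> R) w (k : 'I_(nbar w)) : R :=
  ln (Sbar B w / Abar B w k) + mubar mu w k.

Definition Cconst (B : 'M[R]_n) (mu : 'I_n -> R) w : R :=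
  (Num.sqrt (pi *+ 2) * Num.sqrt (\det (Bbar B w)))^-1
  * (Num.sqrt (Sbar B w) / Num.sqrt (\prod_(k < nbar w) Abar B w k))
  * expR (- 2^-1 * \sum_(i < nbar w) \sum_(j < nbar w)
                     abar B w i j * cbar B mu w i * cbar B mu w j).

Definition main_term (B : 'M[R]_n) (mu : 'I_n -> R) w (x : R) : R :=
  Cconst B mu w / Sbar B w
  * powR (ln x^-1) (- ((1 + (nbar w)%:R) / 2))
  * powR x (\sum_(k < nbar w) Abar B w k * cbar B mu w k)
  * expR (- 2^-1 * Sbar B w * (ln x^-1) ^+ 2).

End Defs.

(* Main.v *)
(** Write [L = log (1/x)].  By the Cramer-Wold argument (uniqueness of characteristic functions, one
    coordinate at a time) the minimizing coordinates [Y_i], [i] in [Ibar], have the Gaussian density.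
    Shifting every coordinate by [L] turns the probability that the sum of the [e^{Y_i}], [i] in [Ibar],
    is at most [x] into an explicit exponential times the integral of
    [1{sum e^v <= 1} e^{L A.v} g(v)] with [g] a fixed Gaussian.  For [g = 1] this is a Dirichlet
    integral, a quotient of Gamma functions, evaluated by Stirling's formula; the corresponding
    measure concentrates at [e^{v_k} = A_k / S], where its exponential moments are again quotients of
    Gamma functions, and a first-order expansion of [g] there costs a relative error [O(1/L)].
    The remaining coordinates do not matter: by the strict Kuhn-Tucker inequality (assumption A),
    [sum_{Ibar} e^{Y_i} <= x] together with [e^{Y_i}] of order [x / L^2] for some [i] outside [Ibar]
    forces a linear combination [(w - s e^i).Y] into an exponentially less likely tail. *)
Require Import Defs.
From HB Require Import structures.
From mathcomp Require Import all_boot all_order all_algebra.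
From mathcomp Require Import all_classical all_reals all_analysis.
From mathcomp Require Import ring lra measurable_realfun.
Set Implicit Arguments.
Unset Strict Implicit.
Unset Printing Implicit Defensive.
Import Order.TTheory GRing.Theory Num.Def Num.Theory.
Import numFieldNormedType.Exports.
Local Open Scope classical_set_scope.
Local Open Scope ring_scope.

(** The hypothesis on [Y] only prescribes the laws of its nontrivial linear combinations, so the
    density has to be built: subtracting from one coordinate its regression on the others leaves a
    residual that is independent of them, and induction on the dimension does the rest. In the
    Laplace step nothing is localised. The Gaussian is expanded in e^{v_k} rather than v_k, because
    those terms have exact Dirichlet moments, and the remainder is dominated on the whole space by
    e^h + e^{-h} - 2, whose moments are exact as well. The scale x / L^2 is a compromise. Passing
    from [L] to [L + L^-1 ^+ 2] lowers the exponent - S L^2 / 2 by about S / L only, hence costs a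
    relative O(1/L), and it frees room of order x / L^2 for the coordinates outside [Ibar]. A
    coordinate that overflows this room still exceeds - L - O(log L), so the strict Kuhn-Tucker gap
    gains a multiple of L^2 in the exponent, which beats every power of L. *)

Definition image_measure d1 d2 (T1 : measurableType d1) (T2 : measurableType d2)
    (R : realType) (m : {measure set T1 -> \bar R}) (f : T1 -> T2)
    (mf : measurable_fun setT f) : {measure set T2 -> \bar R} :=
  measure_function_pushforward__canonical__measure_function_Measure m mf.

(** * Affine changes of variable in Lebesgue integrals *)

Section affine.
Context {R : realType}.
Notation leb := (@lebesgue_measure R).

Lemma measurable_affine (c d : R) : measurable_fun setT (fun x : R => c * x + d).
Proof. by apply: measurable_funD => //; apply: measurable_funM. Qed.

(** Lebesgue measure equals c^-1-scaled inverse transport, that is, c times its image under the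
    affine map: the two measures agree on the intervals []a, b]]. *)
Lemma ge0_integral_affine (c d : R) (f : R -> \bar R) : 0 < c ->
  measurable_fun setT f -> (forall x, (0 <= f x)%E) ->
  (\int[leb]_x f (c * x + d)%R = (c^-1)%:E * \int[leb]_x f x)%E.
Proof.
move=> c0 mf f0.
pose phi := (fun x : R => c * x + d) : R -> measurableTypeR R.
have mphi : measurable_fun setT phi by exact: measurable_affine.
pose m2 : {measure set (measurableTypeR R) -> \bar R} :=
  mscale (NngNum (ltW c0)) (image_measure leb mphi).
have E A : measurable A -> leb A = m2 A.
  apply: lebesgue_measure_unique => X [[a b] /= _ <-].
  rewrite /m2/= /mscale/= /image_measure /pushforward/=.
  have -> : phi @^-1` `]a, b]%classic = `]((a - d) / c), ((b - d) / c)]%classic.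
    apply/seteqP; split => x /=; rewrite /phi !in_itv/= => /andP[h1 h2];
    apply/andP; split.
    - by rewrite ltr_pdivrMr// mulrC ltrBlDr.
    - by rewrite ler_pdivlMr// mulrC lerBrDr.
    - by rewrite -ltrBlDr mulrC -ltr_pdivrMr.
    - by rewrite -lerBrDr mulrC -ler_pdivlMr.
  rewrite !lebesgue_measure_itv/= !lte_fin ltr_pM2r ?invr_gt0// ltrD2r.
  case: ifP => ab; last by rewrite mule0.
  rewrite -!EFinB -EFinM; congr EFin.
  by rewrite -mulrBl mulrCA mulfV ?gt_eqF// mulr1; ring.
rewrite [in RHS](eq_measure_integral m2); last by move=> A mA _; exact: E.
rewrite ge0_integral_mscale//= /image_measure/= ge0_integral_pushforward//=.
by rewrite muleA -EFinM mulVf ?mul1e// gt_eqF.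
Qed.

Lemma ge0_integral_oppr (f : R -> \bar R) :
  measurable_fun setT f -> (forall x, (0 <= f x)%E) ->
  (\int[leb]_x f (- x)%R = \int[leb]_x f x)%E.
Proof.
move=> mf f0.
have mN : measurable_fun setT (-%R : R -> measurableTypeR R).
  exact: oppr_measurable.
rewrite [in RHS](eq_measure_integral (image_measure leb mN)).
  by rewrite /image_measure/= ge0_integral_pushforward.
by move=> A mA _; apply/esym; exact: lebesgue_measureN.
Qed.

Lemma ge0_integral_shift (d : R) (f : R -> \bar R) :
  measurable_fun setT f -> (forall x, (0 <= f x)%E) ->
  (\int[leb]_x f (x + d)%R = \int[leb]_x f x)%E.
Proof.
move=> mf f0; have := ge0_integral_affine d ltr01 mf f0.
by rewrite invr1 mul1e; under eq_integral do rewrite mul1r.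
Qed.

End affine.

(** * The fundamental theorem of calculus on the whole line *)

Section integral_derivative.
Context {R : realType}.
Notation leb := (@lebesgue_measure R).

Lemma cvg_integral_symitv (f : R -> R) : leb.-integrable setT (EFin \o f) ->
  (fun n : nat => \int[leb]_(x in `[(- n%:R)%R, n%:R]) (f x)%:E : \bar R)%E @ \oo -->
  (\int[leb]_x (f x)%:E : \bar R)%E.
Proof.
move=> fi.
have mf : measurable_fun setT (EFin \o f) by exact: measurable_int fi.
pose f_ (n : nat) := (EFin \o f) \_ (`[(- n%:R)%R, n%:R] : set R).
rewrite (_ : (fun n => _) = (fun n => \int[leb]_x f_ n x)%E); last first.
  by apply/funext => n; rewrite /f_ integral_mkcond.
apply: (@dominated_cvg _ _ _ leb setT _ f_ (EFin \o f) (fun x => `|f x|%:E)) => //.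
- by move=> n; apply/(measurable_restrictT _ _).1 => //; exact: measurable_funTS.
- move=> x _; apply: cvg_near_cst; near=> n.
  rewrite /f_ patchE mem_set//= in_itv/= -ler_norml.
  by near: n; exact: nbhs_infty_ger.
- exact: integrable_norm fi.
- move=> n x _; rewrite /f_ patchE; case: ifP => _ //=.
  by rewrite normr0 lee_fin.
Unshelve. all: end_near. Qed.

(** Integrate over [-n, n] and let n grow. Limits of [F] are asked along the integers only, which
    keeps the later decay checks down to a comparison with [harmonic]. *)
Lemma integral_derive_line (F f : R -> R) (l r : R) :
  (forall x : R, is_derive x 1 F (f x)) -> continuous f ->
  leb.-integrable setT (EFin \o f) ->
  F (- n%:R) @[n --> \oo] --> l -> F n%:R @[n --> \oo] --> r ->
  (\int[leb]_x (f x)%:E = (r - l)%:E)%E.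
Proof.
move=> dF cf fi Fl Fr.
have cF : continuous F.
  by move=> x; apply: differentiable_continuous; apply/derivable1_diffP/ex_derive.
have H := cvg_integral_symitv fi.
apply: (cvg_unique (@ereal_hausdorff R) H).
apply: (@cvg_trans _ ((EFin \o (fun n : nat => F n%:R - F (- n%:R))) @ \oo)).
  apply: near_eq_cvg; near=> n => /=.
  have n0 : 0 < n%:R :> R by rewrite ltr0n; near: n; exact: nbhs_infty_gt.
  rewrite (@continuous_FTC2 _ f F) ?EFinB//.
  - by rewrite gtrN.
  - exact: continuous_subspaceT.
  - split.
    + by move=> x _; exact: ex_derive.
    + by apply: cvg_at_right_filter; exact: cF.
    + by apply: cvg_at_left_filter; exact: cF.
  - by move=> x _; rewrite derive1E derive_val.
apply: cvg_EFin; first exact: nearW.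
exact: (@cvgB _ R^o).
Unshelve. all: end_near. Qed.

End integral_derivative.

(** * The characteristic function of the standard normal law *)

Section normal_char.
Context {R : realType}.
Notation leb := (@lebesgue_measure R).
Notation phi := (normal_pdf (0 : R) 1).
Implicit Types x y t : R.

Lemma std_normalE x : phi x = (Num.sqrt (pi *+ 2))^-1 * expR (- x ^+ 2 / 2).
Proof.
rewrite normal_pdfE ?oner_neq0// /normal_peak /normal_fun expr1n mul1r subr0.
by rewrite -mulNr.
Qed.

Lemma is_derive_std_normal (x : R) : is_derive x 1 phi (- x * phi x).
Proof.
rewrite (_ : phi = fun x => (Num.sqrt (pi *+ 2))^-1 * expR (- x ^+ 2 / 2)); last first.
  by apply/funext => z; exact: std_normalE.
have d2 : is_derive x 1 (fun x => - x ^+ 2 / 2) (- x).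
  have -> : (fun x : R => - x ^+ 2 / 2) = (fun x => (- 2^-1) * x ^+ 2).
    by apply/funext => z; field.
  by apply: is_derive_eq; rewrite /GRing.scale/=; field.
have de := @is_derive1_comp _ expR (fun x : R => - x ^+ 2 / 2) x _ _ (is_derive_expR _) d2.
apply: (is_derive_eq (@is_deriveZ R R^o R^o _ (Num.sqrt (pi *+ 2))^-1 x 1 _ de)).
rewrite /GRing.scale/=; field.
by rewrite lt0r_neq0// sqrtr_gt0 mulrn_wgt0// pi_gt0.
Qed.

(** Half of the exponent x^2 / 2 absorbs the factor |x|, through |x| <= 1 + x^2 / 4 <= exp (x^2 /
    4); the other half is the kernel of the normal law of variance 2, which supplies an integrable
    majorant. *)
Lemma normal_pdf_moment_bound x : `|x * phi x| <= normal_pdf 0 (Num.sqrt 2) x * Num.sqrt 2.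
Proof.
rewrite normrM (ger0_norm (normal_pdf_ge0 _ _ _)) std_normalE.
have s2 : Num.sqrt 2 != 0 :> R by rewrite lt0r_neq0// sqrtr_gt0.
rewrite normal_pdfE// /normal_peak /normal_fun subr0 sqr_sqrtr//.
have -> : Num.sqrt (2 * pi *+ 2) = Num.sqrt (pi *+ 2) * Num.sqrt 2 :> R.
  by rewrite -mulrnAr mulrC sqrtrM// mulrn_wge0// pi_ge0.
have -> : (2 *+ 2 : R) = 4 by ring.
rewrite invfM mulrAC -(mulrA _ _ (Num.sqrt 2)) mulVf// mulr1 mulrCA.
apply: ler_wpM2l; first by rewrite invr_ge0 sqrtr_ge0.
have -> : - x ^+ 2 / 2 = - x ^+ 2 / 4 + - x ^+ 2 / 4 by field.
rewrite expRD mulrA ler_piMl ?expR_ge0// mulNr expRN -ler_pdivlMr ?invr_gt0 ?expR_gt0//.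
rewrite invrK mul1r; apply: le_trans (expR_ge1Dx _).
rewrite -real_normK ?num_real//; move: (normr_ge0 x) => h.
by have := sqr_ge0 (`|x| / 2 - 1); lra.
Qed.

Lemma integrable_normal_dom (f : R -> R) : measurable_fun setT f ->
  (forall x, `|f x| <= `|x * phi x|) -> leb.-integrable setT (EFin \o f).
Proof.
move=> mf fb.
have gi : leb.-integrable setT
    (fun x => (Num.sqrt 2)%:E * (normal_pdf 0 (Num.sqrt 2) x)%:E)%E.
  by apply: integrableZl => //; exact: integrable_normal_pdf.
apply: (le_integrable _ _ _ gi) => //; first exact/measurable_EFinP.
move=> x _; rewrite /= lee_fin; apply: le_trans (fb x) _.
apply: le_trans (normal_pdf_moment_bound x) _.
by rewrite mulrC ler_norm.
Qed.

Lemma integrable_normal_bounded (f : R -> R) : measurable_fun setT f ->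
  (forall x, `|f x| <= 1) -> leb.-integrable setT (EFin \o (fun x => f x * phi x)).
Proof.
move=> mf fb.
apply: le_integrable (integrable_normal_pdf 0 1) => //.
  apply/measurable_EFinP; apply: measurable_funM => //; exact: measurable_normal_pdf.
by move=> x _; rewrite /= lee_fin normrM ler_piMl.
Qed.

Lemma measurable_scale_comp (g : R -> R) y : measurable_fun setT g ->
  measurable_fun setT (fun x => g (y * x)).
Proof. by move=> mg; apply: measurableT_comp => //; exact: measurable_funM. Qed.

(** The characteristic function of the standard normal law, whose imaginary part vanishes by
    symmetry. *)
Definition ecos y : R := (\int[leb]_x (cos (y * x) * phi x))%R.

Lemma measurable_cos : measurable_fun setT (@cos R).
Proof. by apply: continuous_measurable_fun; exact: continuous_cos. Qed.

Lemma measurable_sin : measurable_fun setT (@sin R).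
Proof. by apply: continuous_measurable_fun; exact: continuous_sin. Qed.

Lemma integrable_ecos y : leb.-integrable setT (EFin \o (fun x => cos (y * x) * phi x)).
Proof.
apply: integrable_normal_bounded => [|x]; last exact: cos_max.
apply: measurable_scale_comp; exact: measurable_cos.
Qed.

Lemma integrable_xsinN y : leb.-integrable setT (EFin \o (fun x => - (x * sin (y * x) * phi x))).
Proof.
apply: integrable_normal_dom => [|x].
  apply: measurable_funN; apply: measurable_funM; last exact: measurable_normal_pdf.
  by apply: measurable_funM => //; apply: measurable_scale_comp; exact: measurable_sin.
by rewrite normrN mulrAC normrM ler_piMr// sin_max.
Qed.

Lemma is_derive_ecos y :
  is_derive y 1 ecos (\int[leb]_x (- (x * sin (y * x) * phi x)))%R.
Proof.
pose f y x : R := cos (y * x) * phi x.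
have df (u x : R) : is_derive u 1 (f ^~ x) (- (x * sin (u * x) * phi x)).
  have d1 : is_derive u 1 (fun u : R => u * x) x.
    apply: (is_derive_eq (is_deriveM (is_derive_id u 1) (is_derive_cst x u 1))).
    by rewrite /GRing.scale/= mulr0 add0r mulr1.
  have d2 := @is_derive1_comp _ cos (fun u : R => u * x) u _ _ (is_derive_cos _) d1.
  apply: (is_derive_eq (is_deriveM d2 (is_derive_cst (phi x) u 1))).
  by rewrite /GRing.scale/=; ring.
have E u x : partial1of2 f u x = - (x * sin (u * x) * phi x).
  by rewrite partial1of2E; have := df u x => ?; rewrite derive_val.
have yI : y \in `](y - 1), (y + 1)[%classic.
  by rewrite inE/= in_itv/=; lra.
have Dy := @derivable_under_integral R _ _ leb f setT measurableT y (y - 1) (y + 1) (set_mem yI).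
have Fy := @differentiation_under_integral R _ _ leb f setT measurableT y (y - 1) (y + 1) (set_mem yI).
have int1 : forall x, `](y - 1), (y + 1)[%classic x -> leb.-integrable setT (EFin \o f x).
  by move=> x _; exact: integrable_ecos.
have der1 : forall x z, `](y - 1), (y + 1)[%classic x -> setT z -> derivable (f ^~ z) x 1.
  by move=> x z _ _; have := df x z => ?; exact: ex_derive.
(* An integrable majorant of the derivative in [y] that does not depend on [y]. *)
pose G x := `|x * phi x|.
have G0 x : 0 <= G x by exact: normr_ge0.
have iG : leb.-integrable setT (EFin \o G).
  apply: integrable_normal_dom => [|x]; last by rewrite /G normr_id.
  apply: measurableT_comp => //; apply: measurable_funM => //.
  exact: measurable_normal_pdf.
have Gub : forall x z, `](y - 1), (y + 1)[%classic x -> setT z -> `|partial1of2 f x z| <= G z.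
  by move=> x z _ _; rewrite E normrN /G mulrAC normrM ler_piMr// sin_max.
have := Dy int1 der1 G G0 iG Gub; have := Fy int1 der1 G G0 iG Gub.
move=> e d; apply: DeriveDef => //.
rewrite -derive1E e; apply: eq_Rintegral => x _; exact: E.
Qed.

Lemma std_normal_le_harmonic (n : nat) :
  phi n%:R <= 2 * (Num.sqrt (pi *+ 2))^-1 * harmonic n.
Proof.
rewrite std_normalE (mulrC 2) -mulrA ler_wpM2l ?invr_ge0 ?sqrtr_ge0//.
rewrite /harmonic mulNr expRN -[leRHS]invrK lef_pV2 ?posrE ?expR_gt0 ?invr_gt0 ?divr_gt0//.
rewrite invf_div (le_trans _ (expR_ge1Dx _))//.
by rewrite -natr1; have := sqr_ge0 (n%:R - 2^-1 : R); lra.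
Qed.

Lemma cvg_std_normal (s : nat -> R) : (forall n, `|s n| <= 1) ->
  s n * phi n%:R @[n --> \oo] --> 0.
Proof.
move=> s1; apply: norm_cvg0.
apply: (@squeeze_cvgr _ _ _ _ (cst 0) (fun n => 2 * (Num.sqrt (pi *+ 2))^-1 * harmonic n)).
- apply: nearW => n; rewrite normr_ge0/= normrM.
  apply: le_trans (std_normal_le_harmonic n).
  by rewrite [X in _ * X]ger0_norm ?normal_pdf_ge0// ler_piMl ?normal_pdf_ge0.
- exact: cvg_cst.
- rewrite -[0](mulr0 (2 * (Num.sqrt (pi *+ 2))^-1 : R)).
  by apply: cvgM; [exact: cvg_cst|exact: cvg_harmonic].
Qed.

Lemma std_normalN x : phi (- x) = phi x.
Proof. by rewrite !std_normalE sqrrN. Qed.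

(** Integration by parts: since phi' = - x phi, the derivative of sin (y x) phi x is y cos (y x) phi
    x - x sin (y x) phi x, and it integrates to 0. So [ecos] satisfies f' = - y f. *)
Lemma derive_ecos_eq y :
  (\int[leb]_x (- (x * sin (y * x) * phi x)))%R = - (y * ecos y).
Proof.
pose F x := sin (y * x) * phi x.
pose f x := y * (cos (y * x) * phi x) + - (x * sin (y * x) * phi x).
have if1 : leb.-integrable setT (fun x => y%:E * (cos (y * x) * phi x)%:E)%E.
  by apply: integrableZl => //; exact: integrable_ecos.
have if2 := integrable_xsinN y.
have ifE : EFin \o f = ((fun x => y%:E * (cos (y * x) * phi x)%:E)
    \+ (EFin \o (fun x => (- (x * sin (y * x) * phi x))%R)))%E.
  by apply/funext => x; rewrite /f/= EFinD EFinM.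
have df (x : R) : is_derive x 1 F (f x).
  have d1 : is_derive x 1 (fun x : R => y * x) y.
    apply: (is_derive_eq (is_deriveM (is_derive_cst y x 1) (is_derive_id x 1))).
    by rewrite /GRing.scale/= mulr0 addr0 mulr1.
  have d2 := @is_derive1_comp _ sin (fun x : R => y * x) x _ _ (is_derive_sin _) d1.
  apply: (is_derive_eq (is_deriveM d2 (is_derive_std_normal x))).
  by rewrite /GRing.scale/= /f; ring.
have cphi : continuous phi by apply: continuous_normal_pdf; exact: oner_neq0.
have cl : continuous (fun x : R => y * x) by exact: mulrl_continuous.
have cf : continuous f.
  have c1 : continuous (fun x : R => cos (y * x)).
    by move=> x; apply: continuous_comp; [exact: cl|exact: continuous_cos].
  have c2 : continuous (fun x : R => sin (y * x)).
    by move=> x; apply: continuous_comp; [exact: cl|exact: continuous_sin].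
  move=> x; apply: (@cvgD _ R^o).
    by apply: cvgM; [exact: cvg_cst|apply: cvgM; [exact: c1|exact: cphi]].
  by apply: (@cvgN _ R^o); apply: cvgM; [apply: cvgM; [exact: cvg_id|exact: c2]|exact: cphi].
have fi : leb.-integrable setT (EFin \o f) by rewrite ifE; exact: integrableD.
have := integral_derive_line (l := 0) (r := 0) df cf fi.
rewrite /F; under eq_fun do rewrite std_normalN.
move=> /(_ (cvg_std_normal (fun n => sin_max _)) (cvg_std_normal (fun n => sin_max _))).
rewrite subr0.
under eq_integral do rewrite -[(f _)%:E]/((EFin \o f) _) ifE.
rewrite integralD//= integralZl//=; last exact: integrable_ecos.
move=> e.
rewrite /ecos /Rintegral; move: e.
have /fineK <- := integrable_fin_num measurableT (integrable_ecos y).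
have /fineK <- := integrable_fin_num measurableT if2.
by rewrite /= -EFinM -EFinD => -[] /eqP; rewrite addrC addr_eq0 => /eqP.
Qed.

(** The differential equation makes ecos y * exp (y^2 / 2) constant, and its value at 0 is the total
    mass 1. *)
Lemma ecosE y : ecos y = expR (- y ^+ 2 / 2).
Proof.
pose g y := ecos y * expR (y ^+ 2 / 2).
have dg (z : R) : is_derive z 1 g 0.
  have d2 : is_derive z 1 (fun x => x ^+ 2 / 2) z.
    have -> : (fun x : R => x ^+ 2 / 2) = (fun x => 2^-1 * x ^+ 2).
      by apply/funext => t; rewrite mulrC.
    by apply: is_derive_eq; rewrite /GRing.scale/=; field.
  have d3 := @is_derive1_comp _ expR (fun x : R => x ^+ 2 / 2) z _ _ (is_derive_expR _) d2.
  apply: (is_derive_eq (is_deriveM (is_derive_ecos z) d3)).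
  by rewrite derive_ecos_eq /GRing.scale/=; ring.
have := @is_derive_0_is_cst _ g y 0 dg.
have -> : g 0 = 1.
  rewrite /g expr0n/= mul0r expR0 mulr1 /ecos /Rintegral.
  under eq_integral do rewrite mul0r cos0 mul1r.
  by rewrite integral_normal_pdf.
rewrite /g => /(congr1 (fun u => u * expR (- (y ^+ 2 / 2)))).
by rewrite -mulrA -expRD subrr expR0 mulr1 mul1r mulNr.
Qed.

Lemma integral_1Decos c y : `|c| <= 1 ->
  (\int[leb]_x ((1 + c * cos (y * x)) * phi x)%:E = (1 + c * expR (- y ^+ 2 / 2))%:E)%E.
Proof.
move=> c1.
under eq_integral do rewrite mulrDl mul1r -mulrA EFinD EFinM.
rewrite integralD//=; [|exact: integrable_normal_pdf|]; last first.
  by apply: integrableZl => //; exact: integrable_ecos.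
rewrite integral_normal_pdf integralZl//; last exact: integrable_ecos.
rewrite -ecosE /ecos /Rintegral EFinD EFinM fineK//.
exact: integrable_fin_num (integrable_ecos y).
Qed.

(** Adding the integral to its reflection under x -> - x replaces cos (y x + t) by its even part cos
    t * cos (y x), so no sine integral occurs. *)
Lemma integral_1Dcos_std y t :
  (\int[leb]_x ((1 + cos (y * x + t)) * phi x)%:E = (1 + cos t * expR (- y ^+ 2 / 2))%:E)%E.
Proof.
rewrite -integral_1Decos ?cos_max//.
pose f x := ((1 + cos (y * x + t)) * phi x)%:E.
have f0 x : (0 <= f x)%E.
  by rewrite lee_fin mulr_ge0 ?normal_pdf_ge0// -lerBlDl sub0r cos_geN1.
have mf : measurable_fun setT f.
  apply/measurable_EFinP; apply: measurable_funM; last exact: measurable_normal_pdf.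
  apply: measurable_funD => //; apply: measurableT_comp; first exact: measurable_cos.
  exact: measurable_affine.
have E : (\int[leb]_x f x + \int[leb]_x f x =
    2%:E * \int[leb]_x ((1 + cos t * cos (y * x)) * phi x)%:E)%E.
  rewrite -[X in (_ + X)%E](ge0_integral_oppr mf f0) -ge0_integralD//; last first.
    by apply: measurableT_comp.
  rewrite -ge0_integralZl//.
  - apply: eq_integral => x _; rewrite /f -EFinD -EFinM; congr EFin.
    by rewrite std_normalN mulrN !cosD cosN sinN; ring.
  - apply/measurable_EFinP; apply: measurable_funM; last exact: measurable_normal_pdf.
    apply: measurable_funD => //; apply: measurable_funM => //.
    by apply: measurable_scale_comp; exact: measurable_cos.
  - move=> x _; rewrite lee_fin; apply: mulr_ge0; last exact: normal_pdf_ge0.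
    have : `|cos t * cos (y * x)| <= 1 by rewrite normrM mulr_ile1// cos_max.
    by rewrite ler_norml => /andP[h _]; rewrite addrC -lerBlDr sub0r.
move: E; rewrite integral_1Decos ?cos_max//.
rewrite -/(f _); case: (\int[leb]_x f x)%E => [r| |]//=.
by rewrite -EFinD -EFinM => -[] e; congr EFin; lra.
Qed.

End normal_char.

(** * Integration against a measure given by a density *)

Section density.
Local Open Scope ereal_scope.
Context d (T : measurableType d) (R : realType) (mu : {measure set T -> \bar R}).
Variable g : T -> R.
Hypothesis g0 : forall x, (0 <= g x)%R.
Hypothesis mg : measurable_fun setT g.

Import HBNNSimple.

(** The hypothesis is the case of indicators; it extends to simple functions by linearity and to [f]
    by monotone convergence along [nnsfun_approx]. *)
Lemma ge0_integral_density (nu : {measure set T -> \bar R}) (f : T -> \bar R) :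
  (forall A, measurable A -> nu A = \int[mu]_(x in A) (g x)%:E) ->
  (forall x, 0 <= f x) -> measurable_fun setT f ->
  \int[nu]_x f x = \int[mu]_x (f x * (g x)%:E).
Proof.
move=> nuE f0 mf.
have mgE : measurable_fun setT (EFin \o g) by exact/measurable_EFinP.
pose h := nnsfun_approx measurableT mf.
have -> : \int[nu]_x f x = lim (\int[nu]_x (EFin \o h n) x @[n --> \oo]).
  have fE x : f x = lim ((EFin \o h n) x @[n --> \oo]).
    by apply/esym/cvg_lim => //; exact: cvg_nnsfun_approx.
  under eq_integral => x _ do rewrite fE.
  apply: monotone_convergence => //.
  - by move=> n; apply/measurable_EFinP.
  - by move=> n x Ex //=; rewrite lee_fin.
  - by move=> x Ex a b ab; rewrite lee_fin; exact/lefP/nd_nnsfun_approx.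
have -> : \int[mu]_x (f x * (g x)%:E) =
    lim (\int[mu]_x ((EFin \o h n) \* (EFin \o g)) x @[n --> \oo]).
  have fg x : f x * (g x)%:E = lim (((EFin \o h n) \* (EFin \o g)) x @[n --> \oo]).
    by apply/esym/cvg_lim => //; apply: cvgeZr => //; exact: cvg_nnsfun_approx.
  under eq_integral => x _ do rewrite fg.
  apply: monotone_convergence => [//| | |].
  - by move=> n; apply/emeasurable_funM => //; exact/measurable_EFinP.
  - by move=> n x Ex /=; rewrite lee_fin mulr_ge0.
  - move=> x Ex a b ab/=; rewrite lee_wpmul2r ?lee_fin ?f_ge0//.
    exact/lefP/nd_nnsfun_approx.
suff suf n : \int[mu]_x ((EFin \o h n) x * (g x)%:E) = \int[nu]_x (EFin \o h n) x.
  by under [in RHS]eq_fun do rewrite suf.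
transitivity (\int[nu]_x
   (\sum_(y \in range (h n)) (y * \1_(h n @^-1` [set y]) x)%:E)); last first.
  by apply: eq_integral => t tE; rewrite /= fimfunE -fsumEFin.
have indich m r : measurable_fun setT (fun x => (r * \1_(h m @^-1` [set r]) x)%:E).
  by apply/measurable_EFinP; exact: measurable_funM.
rewrite ge0_integral_fsum//; last by move=> m y Ey; exact: nnfun_muleindic_ge0.
transitivity (\int[mu]_x (\sum_(y \in range (h n))
    (y * \1_(h n @^-1` [set y]) x)%:E * (g x)%:E)).
  under [RHS]eq_integral => x xE.
    rewrite -ge0_mule_fsuml => [|y]; last exact: nnfun_muleindic_ge0.
    rewrite fsumEFin // -(fimfunE _ x); over.
  by [].
rewrite ge0_integral_fsum//; last 2 first.
  - by move=> y; apply: emeasurable_funM.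
  - by move=> m y Ey; apply: mule_ge0; [exact: nnfun_muleindic_ge0|rewrite lee_fin].
apply: eq_fsbigr => r rhn.
under [RHS]eq_integral do rewrite EFinM.
rewrite integralZl_indic_nnsfun => //.
under eq_integral do rewrite EFinM -muleA.
have r0 : (0 <= r)%R by move: rhn; rewrite inE => -[x _ <-].
rewrite ge0_integralZl//.
- under eq_integral do rewrite muleC.
  rewrite (eq_integral ((EFin \o g) \_ (h n @^-1` [set r]))); last first.
    by move=> x xE; rewrite epatch_indic.
  by rewrite -integral_mkcond integral_indic// setIT nuE.
- by apply: emeasurable_funM => //; exact/measurable_EFinP.
- by move=> x _; rewrite mule_ge0 ?lee_fin.
Qed.

Definition density_measure_fun (A : set T) := \int[mu]_(x in A) (g x)%:E.

Let density0 : density_measure_fun set0 = 0.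
Proof. by rewrite /density_measure_fun integral_set0. Qed.

Let density_ge0 A : 0 <= density_measure_fun A.
Proof. by apply: integral_ge0 => x _; rewrite lee_fin. Qed.

Let density_sigma_additive : semi_sigma_additive density_measure_fun.
Proof.
move=> /= A mA tA mUA.
rewrite /density_measure_fun ge0_integral_bigcup//=.
- apply: is_cvg_ereal_nneg_natsum_cond => n _ _.
  by apply: integral_ge0 => x _; rewrite lee_fin.
- by apply/measurable_EFinP; exact: measurable_funTS.
- by move=> x _; rewrite lee_fin.
Qed.

HB.instance Definition _ := isMeasure.Build _ _ _
  density_measure_fun density0 density_ge0 density_sigma_additive.

Definition density_measure : {measure set T -> \bar R} := density_measure_fun.

Lemma ge0_integral_density_measure (f : T -> \bar R) :
  (forall x, 0 <= f x) -> measurable_fun setT f ->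
  \int[density_measure]_x f x = \int[mu]_x (f x * (g x)%:E).
Proof. exact: ge0_integral_density. Qed.

End density.

Section normal_integral.
Context {R : realType}.
Notation leb := (@lebesgue_measure R).
Implicit Types m s x y t : R.

Lemma ge0_integral_normal_prob m s (f : R -> \bar R) : (forall x, (0 <= f x)%E) ->
  measurable_fun setT f ->
  (\int[normal_prob m s]_x f x = \int[leb]_x (f x * (normal_pdf m s x)%:E))%E.
Proof.
move=> f0 mf; apply: ge0_integral_density => //.
- exact: normal_pdf_ge0.
- exact: measurable_normal_pdf.
Qed.

Lemma normal_pdf_std m s x : 0 < s ->
  normal_pdf m s x = s^-1 * normal_pdf 0 1 ((x - m) / s).
Proof.
move=> s0; rewrite std_normalE normal_pdfE ?gt_eqF// /normal_peak /normal_fun.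
rewrite mulrA; congr (_ * expR _).
  rewrite -mulrnAr sqrtrM ?sqr_ge0// sqrtr_sqr ger0_norm ?ltW//.
  by rewrite invfM mulrC.
by field; rewrite gt_eqF.
Qed.

Lemma ge0_integral_normal_pdf m s (f : R -> \bar R) : 0 < s ->
  (forall x, (0 <= f x)%E) -> measurable_fun setT f ->
  (\int[leb]_x (f x * (normal_pdf m s x)%:E) =
   \int[leb]_x (f (m + s * x)%R * (normal_pdf 0 1 x)%:E))%E.
Proof.
move=> s0 f0 mf.
pose h x := (f x * (normal_pdf m s x)%:E)%E.
have mh : measurable_fun setT h.
  by apply: emeasurable_funM => //; apply/measurable_EFinP; exact: measurable_normal_pdf.
have h0 x : (0 <= h x)%E by rewrite mule_ge0// lee_fin normal_pdf_ge0.
have -> : (\int[leb]_x h x = s%:E * \int[leb]_x h (s * x + m)%R)%E.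
  by rewrite ge0_integral_affine// muleA -EFinM mulfV ?gt_eqF// mul1e.
rewrite -ge0_integralZl//; last 2 first.
- by apply: (@measurableT_comp _ _ _ _ _ _ h) => //; exact: measurable_affine.
- by rewrite lee_fin ltW.
apply: eq_integral => x _; rewrite /h muleCA (addrC _ m) normal_pdf_std//.
have -> : (m + s * x - m) / s = x by field; rewrite gt_eqF.
by rewrite -EFinM mulrA mulfV ?gt_eqF// mul1r.
Qed.

Lemma integral_1Dcos_normal m s y t : 0 < s ->
  (\int[leb]_x ((1 + cos (y * x + t))%:E * (normal_pdf m s x)%:E) =
   (1 + cos (y * m + t) * expR (- (y * s) ^+ 2 / 2))%:E)%E.
Proof.
move=> s0; rewrite (@ge0_integral_normal_pdf m s (fun x => (1 + cos (y * x + t))%:E))//.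
- rewrite -integral_1Dcos_std; apply: eq_integral => x _.
  by rewrite -EFinM; congr (((1 + cos _) * _)%:E); ring.
- apply/measurable_EFinP; apply: measurable_funD => //.
  apply: measurableT_comp; first exact: measurable_cos.
  exact: measurable_affine.
Qed.

End normal_integral.

(** * Uniqueness of a finite measure with given characteristic function *)

Section char_unique.
Context {R : realType}.
Notation leb := (@lebesgue_measure R).
Notation phi := (normal_pdf (0 : R) 1).
Implicit Types x y t w : R.

(** The smoothing scale 1 / (j+1)^2 is small against the offset 1 / (j+1) of the threshold in
    [step]. Without that offset the smoothed value at x = b would stay at 1/2 instead of tending to
    0. *)
Let k (j : nat) : R := j.+1%:R ^+ 2.
Let k0 j : 0 < k j. Proof. by rewrite exprn_gt0. Qed.

(* The indicator of [x < b], smoothed at scale [1 / (j+1)^2]: a Gaussian average of trigonometric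
   functions, hence determined by the characteristic function, and convergent to the indicator pointwise. *)
Let step (b : R) (j : nat) x : \bar R :=
  (\int[leb]_w ((\1_(`]-oo, (b - j.+1%:R^-1)%R[%classic : set R) (x + w / k j))%:E * (phi w)%:E))%E.

Lemma measurable_phiE : measurable_fun setT (EFin \o phi).
Proof. by apply/measurable_EFinP; exact: measurable_normal_pdf. Qed.

Lemma measurable_fun_addmul d (T : measurableType d) (c e : R) (f : T -> R) :
  measurable_fun setT f -> measurable_fun setT (fun z => c * f z + e).
Proof.
by move=> mf; apply: (@measurableT_comp _ _ _ _ _ _ (fun x => c * x + e)) => //;
  exact: measurable_affine.
Qed.

Let mstep (b : R) j x :
  measurable_fun setT (fun w => (\1_(`]-oo, b[%classic : set R) (x + w / k j) : R)%:E).
Proof.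
apply/measurable_EFinP.
apply: (measurableT_comp (measurable_indic _)); first exact: measurable_itv.
by apply: measurable_funD => //; apply: measurable_funM.
Qed.

(** After the substitution a = x + w / k the point [x] occurs in the Gaussian kernel only, so
    exchanging integrals will leave Gaussian averages of the measure. *)
Let step_affine (b : R) (j : nat) x : step b j x =
  (\int[leb]_a ((\1_(`]-oo, (b - j.+1%:R^-1)%R[%classic : set R) a)%:E *
                 (k j * phi (k j * a + - (k j * x)))%:E))%E.
Proof.
set A := `]-oo, _[%classic.
pose f w := ((\1_A (x + w / k j))%:E * (phi w)%:E)%E.
have mf : measurable_fun setT f.
  apply: emeasurable_funM; last exact: measurable_phiE.
  exact: mstep.
have f0 w : (0 <= f w)%E by rewrite /f -EFinM lee_fin mulr_ge0// normal_pdf_ge0.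
have E := ge0_integral_affine (- (k j * x)) (k0 j) mf f0.
have {E} : (\int[leb]_w f w = (k j)%:E * \int[leb]_a f (k j * a - k j * x)%R)%E.
  by rewrite E muleA -EFinM mulfV ?mul1e// gt_eqF.
rewrite /step -/A => ->; rewrite -ge0_integralZl//; last 2 first.
- by apply: (@measurableT_comp _ _ _ _ _ _ f) => //; exact: measurable_affine.
- by rewrite lee_fin ltW.
apply: eq_integral => a _; rewrite /f muleCA -!EFinM; congr ((\1_A _ * _)%:E).
by field; rewrite gt_eqF.
Qed.

Let step_ge0 b j x : (0 <= step b j x)%E.
Proof. by apply: integral_ge0 => w _; rewrite -EFinM lee_fin mulr_ge0// normal_pdf_ge0. Qed.

Let step_le1 b j x : (step b j x <= 1)%E.
Proof.
rewrite -(integral_normal_pdf 0 1) /step; apply: ge0_le_integral => //.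
- by move=> w _; rewrite -EFinM lee_fin mulr_ge0// normal_pdf_ge0.
- apply: emeasurable_funM; last exact: measurable_phiE.
  exact: mstep.
- exact: measurable_phiE.
- by move=> w _; rewrite -EFinM lee_fin ler_piMl ?normal_pdf_ge0// indicE.
Qed.

Let measurable_step b j : measurable_fun setT (step b j).
Proof.
rewrite (_ : step b j = fubini_F leb (fun xa : R * R =>
   ((\1_(`]-oo, (b - j.+1%:R^-1)%R[%classic : set R) xa.2)%:E *
                 (k j * phi (k j * xa.2 + - (k j * xa.1)))%:E)%E)); last first.
  by apply/funext => x; rewrite step_affine.
apply: measurable_fun_fubini_tonelli_F.
- apply: emeasurable_funM.
    apply/measurable_EFinP.
    by apply: (measurableT_comp (measurable_indic _)); first exact: measurable_itv.
  apply/measurable_EFinP; apply: measurable_funM => //.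
  apply: measurableT_comp; first exact: measurable_normal_pdf.
  by apply: measurable_funB; apply: measurable_funM.
- move=> [x a]/=; rewrite -EFinM lee_fin mulr_ge0// mulr_ge0 ?normal_pdf_ge0//.
  by rewrite ltW.
Qed.

(** Once - w < N, the perturbation w / N^2 cannot make up for the offset 1 / N, so a point at or
    above [b] is never counted. *)
Let shrink_out (b x w N : R) : 0 < N -> - w < N -> b <= x ->
  b - N^-1 <= x + w / N ^+ 2.
Proof.
move=> N0 wN bx.
have : - w / N ^+ 2 <= N^-1.
  by rewrite ler_pdivrMr ?exprn_gt0// expr2 mulrA mulVf ?gt_eqF// mul1r ltW.
by rewrite mulNr; lra.
Qed.

Let shrink_in (b x w N : R) : 1 <= N -> `|w| + 1 < N * (b - x) ->
  x + w / N ^+ 2 < b - N^-1.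
Proof.
move=> N1 wN; have N0 : 0 < N by exact: lt_le_trans N1.
suff : (w + N) / N ^+ 2 < b - x.
  have -> : (w + N) / N ^+ 2 = w / N ^+ 2 + N^-1 by field; rewrite gt_eqF.
  lra.
rewrite ltr_pdivrMr ?exprn_gt0//; have := ler_norm w; have := normr_ge0 w.
set z := `|w| in wN *; nra.
Qed.

Let step_cvg b x : step b j x @[j --> \oo] --> (\1_(`]-oo, b[%classic : set R) x)%:E.
Proof.
have E : (\int[leb]_w ((\1_(`]-oo, b[%classic : set R) x)%:E * (phi w)%:E) =
   (\1_(`]-oo, b[%classic : set R) x)%:E)%E.
  rewrite ge0_integralZl//; first by rewrite integral_normal_pdf mule1.
  - exact: measurable_phiE.
  - by move=> w _; rewrite lee_fin normal_pdf_ge0.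
rewrite -E.
apply: (@dominated_cvg _ _ _ leb setT _ (fun j w =>
   ((\1_(`]-oo, (b - j.+1%:R^-1)%R[%classic : set R) (x + w / k j))%:E * (phi w)%:E)%E)
   _ (EFin \o phi)) => //.
- move=> j; apply: emeasurable_funM; last exact: measurable_phiE.
  exact: mstep.
- move=> w _; apply: cvg_near_cst; near=> j; congr ((_%:R)%:E * _)%E.
  congr nat_of_bool; apply/idP/idP; rewrite !inE/= !in_itv/=.
  + apply: contraTT; rewrite -!leNgt; apply: shrink_out; first exact: ltr0Sn.
    apply: (@lt_le_trans _ _ j%:R); last by rewrite ler_nat.
    by near: j; exact: nbhs_infty_gtr.
  + move=> xb; apply: shrink_in; first by rewrite ler1n.
    rewrite -ltr_pdivrMr ?subr_gt0//.
    apply: (@lt_le_trans _ _ j%:R); last by rewrite ler_nat.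
    by near: j; exact: nbhs_infty_gtr.
- exact: integrable_normal_pdf.
- move=> j w _; rewrite -EFinM /= lee_fin normrM indicE.
  rewrite [X in _ * X]ger0_norm ?normal_pdf_ge0// ler_piMl ?normal_pdf_ge0//.
  by case: (_ \in _); rewrite ?normr1 ?normr0.
Unshelve. all: end_near. Qed.

Section unique.
Variables m1 m2 : {finite_measure set (measurableTypeR R) -> \bar R}.
Hypothesis m12 : forall y t,
  (\int[m1]_x (1 + cos (y * x + t))%:E = \int[m2]_x (1 + cos (y * x + t))%:E)%E.

Let total : m1 setT = m2 setT.
Proof.
(* At y = 0 and t = pi / 2 the test function is the constant 1. *)
have := m12 0 (pi / 2).
under eq_integral do rewrite mul0r add0r cos_pihalf addr0.
under [RHS]eq_integral do rewrite mul0r add0r cos_pihalf addr0.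
by rewrite !integral_cst// !mul1e.
Qed.

(** The Gaussian is its own characteristic function: averaging 1 + cos (z (c a - c x)) over a
    standard normal z gives 1 + exp (- (c a - c x)^2 / 2). Tonelli leaves inside only the integrals
    of [m] that [m12] compares. *)
Let tonelli (m : {finite_measure set (measurableTypeR R) -> \bar R}) c a :
  (\int[m]_x (1 + expR (- (c * a - c * x) ^+ 2 / 2))%:E =
   \int[leb]_z ((\int[m]_x (1 + cos ((- z * c) * x + z * (c * a)))%:E) * (phi z)%:E))%E.
Proof.
pose f (xz : measurableTypeR R * measurableTypeR R) : \bar R :=
  ((1 + cos ((- xz.2 * c) * xz.1 + xz.2 * (c * a))) * phi xz.2)%:E.
have mf : measurable_fun setT f.
  apply/measurable_EFinP; apply: measurable_funM.
    apply: measurable_funD => //; apply: measurableT_comp; first exact: measurable_cos.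
    apply: measurable_funD; apply: measurable_funM => //.
    by apply: measurable_funM => //; apply: measurable_funN.
  by apply: measurableT_comp; [exact: measurable_normal_pdf|].
have f0 xz : (0 <= f xz)%E.
  by rewrite lee_fin mulr_ge0 ?normal_pdf_ge0// -lerBlDl sub0r cos_geN1.
transitivity (\int[m]_x \int[leb]_z f (x, z))%E.
  apply: eq_integral => x _; rewrite /f/=.
  have := integral_1Dcos_std (c * a - c * x) 0; rewrite cos0 mul1r => <-.
  by apply: eq_integral => z _; congr (((1 + cos _) * _)%:E); ring.
rewrite (fubini_tonelli f mf f0); apply: eq_integral => z _.
rewrite /f/=; under eq_integral do rewrite EFinM.
rewrite ge0_integralZr//.
- apply/measurable_EFinP; apply: measurable_funD => //.
  apply: measurableT_comp; first exact: measurable_cos.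
  exact: measurable_affine.
- by rewrite lee_fin normal_pdf_ge0.
Qed.

Let gauss_eq c a : (\int[m1]_x (phi (c * a - c * x))%:E = \int[m2]_x (phi (c * a - c * x))%:E)%E.
Proof.
have E : (\int[m1]_x (1 + expR (- (c * a - c * x) ^+ 2 / 2))%:E =
   \int[m2]_x (1 + expR (- (c * a - c * x) ^+ 2 / 2))%:E)%E.
  by rewrite !tonelli; apply: eq_integral => z _; rewrite m12.
have me : measurable_fun setT (fun x => (expR (- (c * a - c * x) ^+ 2 / 2))%:E).
  apply/measurable_EFinP; apply: measurableT_comp => //.
  apply: measurable_funM => //; apply: measurable_funN; apply: measurable_funX.
  by apply: measurable_funB => //; apply: measurable_funM.
have D (m : {finite_measure set (measurableTypeR R) -> \bar R}) :
  (\int[m]_x (1 + expR (- (c * a - c * x) ^+ 2 / 2))%:E =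
  m setT + \int[m]_x (expR (- (c * a - c * x) ^+ 2 / 2))%:E)%E.
  under eq_integral do rewrite EFinD.
  by rewrite ge0_integralD// integral_cst// mul1e.
have : (\int[m1]_x (expR (- (c * a - c * x) ^+ 2 / 2))%:E =
  \int[m2]_x (expR (- (c * a - c * x) ^+ 2 / 2))%:E)%E.
  move: E; rewrite !D total.
  have : m2 setT \is a fin_num by exact: fin_num_measure.
  by move=> h /(congr1 (fun u => u - m2 setT)%E); rewrite !(addeC (m2 setT)) !addeK.
move=> e.
have Z (m : {finite_measure set (measurableTypeR R) -> \bar R}) :
  (\int[m]_x (phi (c * a - c * x))%:E = ((Num.sqrt (pi *+ 2))^-1)%:E *
     \int[m]_x (expR (- (c * a - c * x) ^+ 2 / 2))%:E)%E.
  rewrite -ge0_integralZl//.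
  by apply: eq_integral => x _; rewrite std_normalE EFinM.
by rewrite !Z e.
Qed.

Let step_tonelli (m : {finite_measure set (measurableTypeR R) -> \bar R}) b j :
  (\int[m]_x step b j x =
   \int[leb]_a ((\1_(`]-oo, (b - j.+1%:R^-1)%R[%classic : set R) a)%:E *
     ((k j)%:E * \int[m]_x (phi (k j * a - k j * x))%:E)))%E.
Proof.
pose f (xa : measurableTypeR R * measurableTypeR R) : \bar R :=
   ((\1_(`]-oo, (b - j.+1%:R^-1)%R[%classic : set R) xa.2)%:E *
                 (k j * phi (k j * xa.2 + - (k j * xa.1)))%:E)%E.
have mf : measurable_fun setT f.
  apply: emeasurable_funM.
    apply/measurable_EFinP.
    by apply: (measurableT_comp (measurable_indic _)); first exact: measurable_itv.
  apply/measurable_EFinP; apply: measurable_funM => //.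
  apply: measurableT_comp; first exact: measurable_normal_pdf.
  by apply: measurable_funB; apply: measurable_funM.
have f0 xz : (0 <= f xz)%E.
  rewrite /f -EFinM lee_fin mulr_ge0// mulr_ge0 ?normal_pdf_ge0//.
  by rewrite ltW.
transitivity (\int[m]_x \int[leb]_z f (x, z))%E.
  by apply: eq_integral => x _; rewrite step_affine.
rewrite (fubini_tonelli f mf f0); apply: eq_integral => z _; rewrite /f/=.
have mp : measurable_fun setT (fun x : measurableTypeR R => (phi (k j * z - k j * x))%:E).
  apply/measurable_EFinP; apply: measurableT_comp; first exact: measurable_normal_pdf.
  by apply: measurable_funB => //; apply: measurable_funM.
rewrite ge0_integralZl//.
- under eq_integral do rewrite EFinM.
  rewrite ge0_integralZl// => [x _|]; first by rewrite lee_fin normal_pdf_ge0.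
  by rewrite lee_fin ltW.
- by under eq_fun do rewrite EFinM; exact: emeasurable_funM.
- by move=> x _; rewrite lee_fin mulr_ge0 ?normal_pdf_ge0// ltW.
Qed.

Let cdf_lim (m : {finite_measure set (measurableTypeR R) -> \bar R}) b :
  (fun j => \int[m]_x step b j x)%E @ \oo --> m `]-oo, b[%classic.
Proof.
have <- : (\int[m]_x (\1_(`]-oo, b[%classic : set R) x)%:E = m `]-oo, b[%classic)%E.
  by rewrite integral_indic// setIT.
apply: (@dominated_cvg _ _ _ m setT _ (step b) _ (cst 1%E)) => //.
- by move=> j; exact: measurable_step.
- exact: finite_measure_integrable_cst.
- by move=> j x _; rewrite gee0_abs.
Qed.

(** The half-lines []-oo, b[] are stable under intersection, generate the Borel sets and exhaust the
    line. On a half-line both measures are limits of integrals of [step], which agree by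
    [gauss_eq]. *)
Lemma char_unique A : measurable A -> m1 A = m2 A.
Proof.
move=> mA.
have GI : setI_closed (@RGenInftyO.G R).
  move=> _ _ [a ->] [b ->]; exists (Num.min a b).
  by apply/seteqP; split => x /=; rewrite !in_itv/= lt_min => /andP.
have Gg i : @RGenInftyO.G R `]-oo, i%:R[%classic by exists i%:R.
have gT : \bigcup_i `]-oo, i%:R[%classic = [set: R].
  apply/seteqP; split => // x _.
  have [n _ nx] := @nbhs_infty_gtr R x.
  by exists n => //=; rewrite in_itv/=; exact: (nx n (leqnn _)).
have G12 X : @RGenInftyO.G R X -> m1 X = m2 X.
  move=> [b ->]; apply: (cvg_unique (@ereal_hausdorff R) (cdf_lim (m := m1) (b := b))).
  rewrite (_ : (fun j => _) = (fun j => \int[m2]_x step b j x)%E); first exact: cdf_lim.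
  apply/funext => j; rewrite !step_tonelli.
  by apply: eq_integral => a _; rewrite gauss_eq.
have fin1 i : (m1 `]-oo, i%:R[%classic < +oo)%E.
  by rewrite ltey_eq fin_num_measure.
exact: (@measure_unique _ R (measurableTypeR R) _ _ (RGenInftyO.measurableE R)
  GI Gg gT m1 m2 G12 fin1 A mA).
Qed.

End unique.
End char_unique.

(** * Integrals over tuples as iterated integrals *)

Section iterated_integral.
Context {R : realType}.
Notation leb := (@lebesgue_measure R).
Local Open Scope ereal_scope.

(** Integration over R^m one coordinate at a time: every exchange or translation reduces to
    dimension one, and the recursion matches the induction on the dimension of a Gaussian vector. *)
Fixpoint lint (m : nat) : (m.-tuple R -> \bar R) -> \bar R :=
  match m return (m.-tuple R -> \bar R) -> \bar R with
  | 0%N => fun f => f [tuple]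
  | m'.+1 => fun f => \int[leb]_x lint (fun t => f (cons_tuple x t))
  end.

Lemma lintS m (f : m.+1.-tuple R -> \bar R) :
  lint f = \int[leb]_x lint (fun t => f (cons_tuple x t)).
Proof. by []. Qed.

Lemma lint_ge0 m (f : m.-tuple R -> \bar R) : (forall t, 0 <= f t) -> 0 <= lint f.
Proof.
elim: m f => [|m IH] f f0 //=.
by apply: integral_ge0 => x _; exact: IH.
Qed.

Lemma eq_lint m (f g : m.-tuple R -> \bar R) : f =1 g -> lint f = lint g.
Proof. by move=> fg; congr lint; apply/funext. Qed.

Lemma measurable_fun_cons m d (T : measurableType d) (f : T -> R) (g : T -> m.-tuple R) :
  measurable_fun setT f -> measurable_fun setT g ->
  measurable_fun setT (fun z => cons_tuple (f z) (g z)).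
Proof. exact: measurable_cons. Qed.

(** The parameter space [T] is arbitrary so that the induction can move the outermost variable into
    it. *)
Lemma measurable_lint m d (T : measurableType d) (f : T * m.-tuple R -> \bar R) :
  measurable_fun setT f -> (forall z, 0 <= f z) ->
  measurable_fun setT (fun z => lint (fun t => f (z, t))).
Proof.
elim: m d T f => [|m IH] d T f mf f0 /=.
  by apply: (measurableT_comp mf); apply: measurable_fun_pair.
pose F (zx : T * R) := lint (fun t => f (zx.1, cons_tuple zx.2 t)).
have mF : measurable_fun setT F.
  apply: (IH _ (T * R)%type (fun zxt => f (zxt.1.1, cons_tuple zxt.1.2 zxt.2))) => //.
  apply: (measurableT_comp mf); apply: measurable_fun_pair => /=.
    by apply: measurableT_comp.
  by apply: measurable_fun_cons => //; apply: measurableT_comp.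
have F0 zx : 0 <= F zx by apply: lint_ge0.
rewrite -[X in measurable_fun _ X]/(fubini_F leb F).
exact: measurable_fun_fubini_tonelli_F.
Qed.

Lemma measurable_lint_cons m (f : m.+1.-tuple R -> \bar R) :
  measurable_fun setT f -> (forall t, 0 <= f t) ->
  measurable_fun setT (fun x => lint (fun t => f (cons_tuple x t))).
Proof.
move=> mf f0.
apply: (@measurable_lint _ _ R (fun xt => f (cons_tuple xt.1 xt.2))) => //.
by apply: (measurableT_comp mf); exact: measurable_fun_cons.
Qed.

Lemma measurable_cons_l m (f : m.+1.-tuple R -> \bar R) x :
  measurable_fun setT f -> measurable_fun setT (fun t => f (cons_tuple x t)).
Proof. by move=> mf; apply: (measurableT_comp mf); exact: measurable_fun_cons. Qed.

Lemma lint_exchange m d (T : measurableType d) (mu : {sigma_finite_measure set T -> \bar R})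
  (f : T * m.-tuple R -> \bar R) :
  measurable_fun setT f -> (forall z, 0 <= f z) ->
  \int[mu]_z lint (fun t => f (z, t)) = lint (fun t => \int[mu]_z f (z, t)).
Proof.
elim: m f => [//|m IH] f mf f0 /=.
pose F (zx : T * R) := lint (fun t => f (zx.1, cons_tuple zx.2 t)).
have mF : measurable_fun setT F.
  apply: (@measurable_lint _ _ (T * R)%type (fun zxt => f (zxt.1.1, cons_tuple zxt.1.2 zxt.2))) => //.
  apply: (measurableT_comp mf); apply: measurable_fun_pair => /=.
    by apply: measurableT_comp.
  by apply: measurable_fun_cons => //; apply: measurableT_comp.
have F0 zx : 0 <= F zx by apply: lint_ge0.
transitivity (\int[mu]_z \int[leb]_x F (z, x)); first by [].
rewrite (@fubini_tonelli _ _ _ _ _ mu leb F mF F0).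
apply: eq_integral => x _; rewrite /F /=.
apply: (IH (fun zt => f (zt.1, cons_tuple x zt.2))) => //.
apply: (measurableT_comp mf); apply: measurable_fun_pair => //=.
exact: measurable_fun_cons.
Qed.

Lemma ge0_lintD m (f g : m.-tuple R -> \bar R) :
  measurable_fun setT f -> measurable_fun setT g ->
  (forall t, 0 <= f t) -> (forall t, 0 <= g t) ->
  lint (fun t => f t + g t) = lint f + lint g.
Proof.
elim: m f g => [//|m IH] f g mf mg f0 g0 /=.
rewrite -ge0_integralD//.
- by apply: eq_integral => x _; apply: IH => //; exact: measurable_cons_l.
- by move=> x _; exact: lint_ge0.
- exact: measurable_lint_cons.
- by move=> x _; exact: lint_ge0.
- exact: measurable_lint_cons.
Qed.

Lemma ge0_lintZl m (f : m.-tuple R -> \bar R) (k : R) :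
  measurable_fun setT f -> (forall t, 0 <= f t) -> (0 <= k)%R ->
  lint (fun t => k%:E * f t) = k%:E * lint f.
Proof.
elim: m f => [//|m IH] f mf f0 k0 /=.
rewrite -ge0_integralZl//.
- by apply: eq_integral => x _; apply: IH => //; exact: measurable_cons_l.
- exact: measurable_lint_cons.
- by move=> x _; exact: lint_ge0.
Qed.

Lemma ge0_le_lint m (f g : m.-tuple R -> \bar R) :
  measurable_fun setT f -> measurable_fun setT g ->
  (forall t, 0 <= f t) -> (forall t, f t <= g t) -> lint f <= lint g.
Proof.
elim: m f g => [|m IH] f g mf mg f0 fg; first exact: fg.
rewrite !lintS.
have g0 t : 0 <= g t by exact: le_trans (fg t).
apply: (@ge0_le_integral _ _ _ leb setT measurableT
  (fun x => lint (fun t => f (cons_tuple x t)))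
  (fun x => lint (fun t => g (cons_tuple x t)))).
- by move=> x _; exact: lint_ge0.
- exact: measurable_lint_cons.
- exact: measurable_lint_cons.
- by move=> x _; apply: IH => //; exact: measurable_cons_l.
Qed.

Lemma lint_shift m (c : R) (f : m.-tuple R -> \bar R) :
  measurable_fun setT f -> (forall t, 0 <= f t) ->
  lint (fun t => f [tuple of map (fun x => (x + c)%R) t]) = lint f.
Proof.
elim: m f => [|m IH] f mf f0; first by congr f; exact: tuple0.
rewrite !lintS -(ge0_integral_shift c (f := fun x => lint (fun t => f (cons_tuple x t)))); last 2 first.
- exact: measurable_lint_cons.
- by move=> x; exact: lint_ge0.
apply: eq_integral => x _; have mfx := measurable_cons_l (x + c)%R mf.
rewrite -(IH _ mfx)//.
by apply: eq_lint => t; congr f; apply/val_inj.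
Qed.

Lemma lint_prod m (h : 'I_m -> R -> R) (c : 'I_m -> R) :
  (forall i, measurable_fun setT (h i)) -> (forall i x, 0 <= h i x)%R ->
  (forall i, \int[leb]_x (h i x)%:E = (c i)%:E) ->
  lint (fun t => (\prod_(i < m) h i (tnth t i))%:E) = (\prod_(i < m) c i)%:E.
Proof.
elim: m h c => [|m IH] h c mh h0 hc.
  by rewrite /= !big_ord0.
rewrite lintS.
under eq_integral => x _.
  rewrite (_ : lint _ = (h ord0 x)%:E * (\prod_(i < m) c (lift ord0 i))%:E); last first.
    rewrite -(IH (fun i => h (lift ord0 i)))// -ge0_lintZl//.
    - apply: eq_lint => t; rewrite big_ord_recl -EFinM; congr (_ * _)%:E.
      by apply: eq_bigr => i _; rewrite tnthS.
    - apply/measurable_EFinP; apply: measurable_prod => i _.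
      by apply: measurableT_comp => //; exact: measurable_tnth.
    - by move=> t; rewrite lee_fin prodr_ge0.
  over.
rewrite ge0_integralZr//.
- by rewrite hc big_ord_recl EFinM.
- by apply/measurable_EFinP; exact: mh.
- by move=> x _; rewrite lee_fin.
- rewrite lee_fin prodr_ge0// => i _.
  by rewrite -lee_fin -hc; apply: integral_ge0 => x _; rewrite lee_fin.
Qed.

End iterated_integral.

(** * Positive definite matrices and Schur complements *)

Section quadratic_forms.
Context {R : realType}.

Definition qmx m (B : 'M[R]_m) (t : 'rV[R]_m) : R := (t *m B *m t^T) 0 0.

Definition dotv m (t y : 'rV[R]_m) : R := (t *m y^T) 0 0.

Definition posdefmx m (B : 'M[R]_m) : Prop :=
  B^T = B /\ forall t : 'rV[R]_m, t != 0 -> 0 < qmx B t.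

Lemma dotvE m (t y : 'rV[R]_m) : dotv t y = \sum_i t 0 i * y 0 i.
Proof. by rewrite /dotv mxE; apply: eq_bigr => i _; rewrite mxE. Qed.

Lemma dotvDl m (t s y : 'rV[R]_m) : dotv (t + s) y = dotv t y + dotv s y.
Proof. by rewrite /dotv mulmxDl mxE. Qed.

Lemma dotvNl m (t y : 'rV[R]_m) : dotv (- t) y = - dotv t y.
Proof. by rewrite /dotv mulNmx mxE. Qed.

Lemma dotvZl m a (t y : 'rV[R]_m) : dotv (a *: t) y = a * dotv t y.
Proof. by rewrite /dotv -scalemxAl mxE. Qed.

Lemma dotv0l m (v : 'rV[R]_m) : dotv 0 v = 0.
Proof. by rewrite /dotv mul0mx mxE. Qed.

Lemma qmx0 m (A : 'M[R]_m) : qmx A 0 = 0.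
Proof. by rewrite /qmx !mul0mx mxE. Qed.

Lemma qmxN m (B : 'M[R]_m) t : qmx B (- t) = qmx B t.
Proof. by rewrite /qmx mulNmx linearN/= mulNmx mulmxN opprK. Qed.

Lemma mul_mx11 (a b : 'M[R]_1) : (a *m b) 0 0 = a 0 0 * b 0 0.
Proof. by rewrite mxE big_ord1. Qed.

Lemma posdef_unit m (B : 'M[R]_m) : posdefmx B -> B \in unitmx.
Proof.
move=> [_ pB]; rewrite -row_free_unit -kermx_eq0.
apply/eqP/row_matrixP => i; rewrite row0; apply/eqP; apply: contraT => h.
have := pB _ h; rewrite /qmx.
have -> : row i (kermx B) *m B = 0 by rewrite -row_mul mulmx_ker row0.
by rewrite mul0mx mxE ltxx.
Qed.

Section schur.
Variables (m : nat) (b : 'M[R]_1) (r : 'rV[R]_m) (B' : 'M[R]_m).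
Hypothesis pB : posdefmx (block_mx b r r^T B' : 'M[R]_(1 + m)).

Lemma schur_sub : posdefmx B'.
Proof.
have [sB pos] := pB; split.
  by move: sB; rewrite tr_block_mx => /eq_block_mx[_ _ _ ->].
move=> t t0; have : row_mx 0 t != 0 :> 'rV[R]_(1 + m).
  by apply: contra t0 => /eqP; rewrite -row_mx0 => /eq_row_mx[_ ->].
move/pos; rewrite /qmx mul_row_block tr_row_mx mul_row_col.
by rewrite linear0 mulmx0 add0r mul0mx add0r.
Qed.

Let uB' : B' \in unitmx. Proof. exact/posdef_unit/schur_sub. Qed.
Let sB' : B'^T = B'. Proof. by case: schur_sub. Qed.

(** For a vector with covariance [block_mx b r r^T B'], these are the regression coefficients of the
    first coordinate on the others; [schur] below is the variance of the residual. *)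
Definition regr : 'rV[R]_m := r *m invmx B'.
Definition schur : 'M[R]_1 := b - regr *m r^T.

Lemma regrK : regr *m B' = r.
Proof. by rewrite /regr mulmxKV. Qed.

Lemma regrTK : B' *m regr^T = r^T.
Proof. by rewrite -[in LHS]sB' -trmx_mul regrK. Qed.

Lemma regr_sym : regr *m r^T = r *m regr^T.
Proof. by rewrite -{2}regrK -mulmxA regrTK. Qed.

Lemma schur_block :
  block_mx b r r^T B' = block_mx 1%:M regr 0 1%:M *m block_mx schur 0 r^T B'.
Proof.
rewrite mulmx_block !mul1mx !mul0mx !add0r regrK.
by rewrite /schur subrK.
Qed.

(** The row on the left is the linear form s * residual + t.rest. The missing cross term says that
    the residual is uncorrelated with the other coordinates. *)
Lemma qmx_row (s : R) (t : 'rV[R]_m) :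
  qmx (block_mx b r r^T B') (row_mx s%:M (t - s *: regr) : 'rV[R]_(1 + m)) =
  qmx B' t + s ^+ 2 * schur 0 0.
Proof.
rewrite /qmx mul_row_block tr_row_mx mul_row_col.
have -> : s%:M *m r + (t - s *: regr) *m B' = t *m B'.
  by rewrite mulmxBl -scalemxAl regrK mul_scalar_mx addrCA subrr addr0.
have -> : s%:M *m b + (t - s *: regr) *m r^T = s *: schur + t *m r^T.
  by rewrite mul_scalar_mx mulmxBl -scalemxAl /schur scalerBr addrCA addrC.
rewrite [(t - _)^T]linearB/= [(s *: _)^T]linearZ/= mulmxBr -scalemxAr -(mulmxA t B' regr^T) regrTK.
rewrite tr_scalar_mx mul_mx_scalar scalerDr scalerA -expr2.
move: (t *m r^T) (t *m _) => p q.
by rewrite !mxE; ring.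
Qed.

Lemma schur_gt0 : 0 < schur 0 0.
Proof.
have h : row_mx 1%:M (0 - 1 *: regr) != 0 :> 'rV[R]_(1 + m).
  apply/eqP; rewrite -row_mx0 => /eq_row_mx[/matrixP/(_ 0 0)].
  by rewrite !mxE eqxx => /eqP; rewrite oner_eq0.
have := pB.2 _ h; rewrite qmx_row expr1n mul1r.
by rewrite /qmx !mul0mx [X in X + _]mxE add0r.
Qed.

Lemma det_schur : \det (block_mx b r r^T B' : 'M[R]_(1 + m)) = schur 0 0 * \det B'.
Proof. by rewrite schur_block det_mulmx det_ublock det_lblock !det1 !mul1r det_mx11. Qed.

(** Completing the square. The block inverse is never computed: the row [v *m invmx B] is named
    [row_mx w0 w'], and the equation v = (w0, w') B is read block by block. *)
Lemma qmx_inv_row (x : R) (y : 'rV[R]_m) :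
  qmx (invmx (block_mx b r r^T B')) (row_mx x%:M y : 'rV[R]_(1 + m)) =
  (x - dotv regr y) ^+ 2 / schur 0 0 + qmx (invmx B') y.
Proof.
set B := block_mx b r r^T B'; set v := row_mx _ _.
have uB : B \in unitmx by exact: posdef_unit.
have [w0 [w' E]] : exists w0 : 'M[R]_1, exists w' : 'rV[R]_m, v *m invmx B = row_mx w0 w' :> 'rV[R]_(1 + m).
  by exists (lsubmx (v *m invmx B)), (rsubmx (v *m invmx B)); rewrite hsubmxK.
have : v = row_mx w0 w' *m B by rewrite -E mulmxKV.
rewrite /v mul_row_block => /eq_row_mx[ex ey].
have e1 : x%:M - y *m regr^T = w0 *m schur.
  rewrite ex ey mulmxDl -(mulmxA w' B') regrTK opprD addrACA subrr addr0.
  by rewrite /schur mulmxBr -mulmxA regr_sym.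
have e2 : y *m invmx B' = w0 *m regr + w'.
  by rewrite ey mulmxDl mulmxK// -mulmxA.
have e3 : x - dotv regr y = w0 0 0 * schur 0 0.
  rewrite -mul_mx11 -e1 !mxE eqxx mulr1n /dotv; congr (_ - _).
  by rewrite !mxE; apply: eq_bigr => i _; rewrite !mxE mulrC.
rewrite e3 {1}/qmx E tr_row_mx mul_row_col.
rewrite /qmx e2.
have -> : (w0 0 0 * schur 0 0) ^+ 2 / schur 0 0 = (w0 *m schur *m w0^T) 0 0.
  by rewrite !mul_mx11 [w0^T 0 0]mxE; field; rewrite gt_eqF// schur_gt0.
have -> : (w0 *m schur *m w0^T) 0 0 + ((w0 *m regr + w') *m y^T) 0 0 =
  ((w0 *m schur *m w0^T) + ((w0 *m regr + w') *m y^T)) 0 0 by rewrite [RHS]mxE.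
suff -> : w0 *m (x%:M)^T + w' *m y^T = w0 *m schur *m w0^T + (w0 *m regr + w') *m y^T.
  by [].
rewrite mulmxDl addrA; congr (_ + _).
rewrite ex ey ![(_ + _)^T]linearD/= !trmx_mul trmxK sB' !mulmxDr.
have sb : b^T = b.
  by case: pB => + _; rewrite tr_block_mx => /eq_block_mx[].
have -> : w0 *m regr *m (B' *m w'^T) = w0 *m (r *m w'^T).
  by rewrite -(mulmxA w0) (mulmxA regr) regrK.
rewrite sb addrA; congr (_ + _).
by rewrite mulmxDl mulmxN mulNmx !mulmxA subrK.
Qed.

End schur.

Lemma sym_blockE m (B : 'M[R]_(1 + m)) : B^T = B ->
  B = block_mx (ulsubmx B) (ursubmx B) (ursubmx B)^T (drsubmx B).
Proof. by move=> sB; rewrite trmx_ursub sB submxK. Qed.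

Lemma posdef_det_gt0 m (B : 'M[R]_m) : posdefmx B -> 0 < \det B.
Proof.
elim: m B => [|m IH] B pB; first by rewrite det_mx00.
have e := @sym_blockE m B pB.1; rewrite e in pB *.
by rewrite det_schur// mulr_gt0// ?schur_gt0//; exact/IH/(schur_sub pB).
Qed.

End quadratic_forms.

(** * The Gaussian density and its splitting along one coordinate *)

Section gaussian_density.
Context {R : realType}.
Notation leb := (@lebesgue_measure R).

Definition rowt m (t : m.-tuple R) : 'rV[R]_m := \row_i tnth t i.

Lemma rowt_cons m (x : R) (t : m.-tuple R) :
  rowt (cons_tuple x t) = row_mx x%:M (rowt t) :> 'rV[R]_(1 + m).
Proof.
apply/rowP => i; rewrite !mxE; case: splitP => j ij; rewrite !mxE.
  rewrite (ord1 j) in ij *; rewrite eqxx mulr1n.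
  by rewrite (_ : i = ord0)//; apply/val_inj.
by rewrite (_ : i = lift ord0 j) ?tnthS//; apply/val_inj.
Qed.

Definition gdens m (mu : 'rV[R]_m) (B : 'M[R]_m) (y : 'rV[R]_m) : R :=
  (Num.sqrt (pi *+ 2) ^+ m * Num.sqrt (\det B))^-1 *
  expR (- (qmx (invmx B) (y - mu) / 2)).

Lemma gdens_ge0 m (mu : 'rV[R]_m) B y : 0 <= gdens mu B y.
Proof. by rewrite mulr_ge0 ?expR_ge0// invr_ge0 mulr_ge0 ?exprn_ge0 ?sqrtr_ge0. Qed.

Lemma measurable_rowt_entry d (T : measurableType d) m (f : T -> m.-tuple R) i j :
  measurable_fun setT f -> measurable_fun setT (fun z => rowt (f z) i j).
Proof.
move=> mf; under eq_fun do rewrite mxE.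
by apply: (measurableT_comp (measurable_tnth j)).
Qed.

Lemma measurable_dotv m (a : 'rV[R]_m) :
  measurable_fun setT (fun t : m.-tuple R => dotv a (rowt t)).
Proof.
under eq_fun do rewrite dotvE; apply: measurable_sum => i.
by apply: measurable_funM => //; exact: measurable_rowt_entry.
Qed.

Lemma measurable_qmx m (A : 'M[R]_m) (mu : 'rV[R]_m) :
  measurable_fun setT (fun t : m.-tuple R => qmx A (rowt t - mu)).
Proof.
rewrite (_ : (fun t => _) = (fun t => \sum_j \sum_i
    (rowt t 0 i - mu 0 i) * A i j * (rowt t 0 j - mu 0 j))); last first.
  apply/funext => t; rewrite /qmx mxE; apply: eq_bigr => j _.
  rewrite !mxE big_distrl/=; apply: eq_bigr => i _.
  by rewrite !mxE.
apply: measurable_sum => j; apply: measurable_sum => i.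
apply: measurable_funM; [apply: measurable_funM => //|];
  by apply: measurable_funB => //; exact: measurable_rowt_entry.
Qed.

Lemma measurable_gdens m (mu : 'rV[R]_m) B :
  measurable_fun setT (fun t : m.-tuple R => gdens mu B (rowt t)).
Proof.
apply: measurable_funM => //; apply: measurableT_comp => //.
apply: measurable_funN; apply: measurable_funM => //; exact: measurable_qmx.
Qed.

(** The regression in terms of densities: by [qmx_inv_row] the exponent splits, and by [det_schur]
    so does the normalisation, into the residual's part and that of the other coordinates. *)
Lemma gdens_cons m (b : 'M[R]_1) (r : 'rV[R]_m) B' (mu0 x : R) (mu' y : 'rV[R]_m) :
  posdefmx (block_mx b r r^T B' : 'M[R]_(1 + m)) ->
  gdens (row_mx mu0%:M mu') (block_mx b r r^T B') (row_mx x%:M y : 'rV[R]_(1 + m)) =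
  normal_pdf (mu0 - dotv (regr r B') mu') (Num.sqrt (schur b r B' 0 0))
    (x - dotv (regr r B') y) * gdens mu' B' y.
Proof.
move=> pB; have s0 := schur_gt0 pB.
have ss0 : 0 < Num.sqrt (schur b r B' 0 0) by rewrite sqrtr_gt0.
have d0 := posdef_det_gt0 (schur_sub pB).
rewrite /gdens det_schur// opp_row_mx add_row_mx.
have -> : x%:M + - mu0%:M = (x - mu0)%:M :> 'M[R]_1 by rewrite raddfB.
rewrite qmx_inv_row// normal_pdfE ?gt_eqF// /normal_peak /normal_fun.
rewrite sqr_sqrtr ?ltW//.
have -> : x - mu0 - dotv (regr r B') (y - mu') =
    x - dotv (regr r B') y - (mu0 - dotv (regr r B') mu').
  have -> : dotv (regr r B') (y - mu') = dotv (regr r B') y - dotv (regr r B') mu'.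
    by rewrite /dotv linearB/= mulmxBr !mxE.
  ring.
set u := _ - (mu0 - _).
rewrite mulrDl opprD expRD.
have -> : - (u ^+ 2 / schur b r B' 0 0 / 2) = - u ^+ 2 / (schur b r B' 0 0 *+ 2).
  by field; rewrite gt_eqF.
rewrite mulrACA; congr (_ * (_ * _)).
rewrite -mulrnAr !sqrtrM ?ltW// exprS -invfM; congr (_^-1).
by rewrite mulrACA [RHS]mulrACA mulrC [in RHS]mulrC; ring.
Qed.

End gaussian_density.

Section finite_measure_of.
Context d (T : measurableType d) (R : realType).
Variables (m : {measure set T -> \bar R}) (mT : (m setT < +oo)%E).

(** The finiteness proof is an argument of the definition so that the instance of finite measure can
    recover it from the term. *)
Definition finite_measure_of & (m setT < +oo)%E : set T -> \bar R := m.

HB.instance Definition _ := Measure.copy (finite_measure_of mT) m.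
HB.instance Definition _ :=
  Measure_isFinite.Build _ _ _ (finite_measure_of mT) (lty_fin_num_fun mT).

End finite_measure_of.

Section finite_char_unique.
Context {R : realType}.

Lemma finite_char_unique (m1 m2 : {measure set (measurableTypeR R) -> \bar R}) :
  (m1 setT < +oo)%E -> (m2 setT < +oo)%E ->
  (forall y t, (\int[m1]_x (1 + cos (y * x + t))%:E = \int[m2]_x (1 + cos (y * x + t))%:E)%E) ->
  forall A, measurable A -> m1 A = m2 A.
Proof.
move=> f1 f2 E A mA.
exact: (@char_unique R (finite_measure_of f1) (finite_measure_of f2)).
Qed.

End finite_char_unique.

(** * From characteristic functions to Gaussian laws *)

Section gauss_law.
Context {R : realType}.
Notation leb := (@lebesgue_measure R).

Let c1 (x : R) : 0 <= 1 + cos x.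
Proof. by rewrite -lerBlDl sub0r cos_geN1. Qed.

(** The product-to-sum formula with positive coefficients on both sides, so that it can be
    integrated term by term as an identity between nonnegative functions. *)
Lemma prod_1Dcos (x y : R) : (1 + cos x) * (1 + cos y) + 2 =
  (1 + cos x) + (1 + cos y) + 2^-1 * (1 + cos (x + y)) + 2^-1 * (1 + cos (x - y)).
Proof. by rewrite !cosD cosN sinN; field. Qed.

(* Characteristic functions are tested against [1 + cos] rather than [cos]: the integrand is then
   nonnegative and no integrability has to be carried around. *)
Definition gauss_char d (T : measurableType d) (Q : {measure set T -> \bar R}) m
    (Y : T -> 'rV[R]_m) (M : R) (mu : 'rV[R]_m) (B : 'M[R]_m) : Prop :=
  forall (t : 'rV[R]_m) (s : R),
    (\int[Q]_z (1 + cos (dotv t (Y z) + s))%:E =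
     (M * (1 + expR (- (qmx B t / 2)) * cos (dotv t mu + s)))%:E)%E.

Section regression.
Context d (T : measurableType d) (Q : {measure set T -> \bar R}).
Variables (m : nat) (Y' : T -> 'rV[R]_m) (U : T -> R).
Variables (M c s : R) (mu' : 'rV[R]_m) (B' : 'M[R]_m).
Hypothesis mY' : forall i, measurable_fun setT (fun z => Y' z 0 i).
Hypothesis mU : measurable_fun setT U.
Hypothesis s0 : 0 < s.
Hypothesis M0 : 0 <= M.
Hypothesis H : forall (t : 'rV[R]_m) (y a : R),
    (\int[Q]_z (1 + cos (dotv t (Y' z) + y * U z + a))%:E =
     (M * (1 + expR (- (qmx B' t / 2) - (y * s) ^+ 2 / 2) *
       cos (dotv t mu' + y * c + a)))%:E)%E.

Let mdot t : measurable_fun setT (fun z => dotv t (Y' z)).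
Proof.
under eq_fun do rewrite dotvE; apply: measurable_sum => i.
exact: measurable_funM.
Qed.

Let mcos (f : T -> R) : measurable_fun setT f -> measurable_fun setT (fun z => 1 + cos (f z)).
Proof.
move=> mf; apply: measurable_funD => //.
by apply: measurableT_comp; first exact: measurable_cos.
Qed.

Let QT : Q setT = M%:E.
Proof.
have := H 0 0 (pi / 2).
under eq_integral do rewrite dotv0l mul0r !add0r cos_pihalf addr0.
by rewrite integral_cst// mul1e dotv0l !mul0r !add0r cos_pihalf mulr0 addr0 mulr1.
Qed.

Let char0 t b :
  (\int[Q]_z (1 + cos (dotv t (Y' z) + b))%:E =
  (M * (1 + expR (- (qmx B' t / 2)) * cos (dotv t mu' + b)))%:E)%E.
Proof.
have := H t 0 b; rewrite !mul0r expr0n/= mul0r subr0 addr0 => <-.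
by apply: eq_integral => z _; rewrite mul0r addr0.
Qed.

Let prod_char t y a b :
  (\int[Q]_z ((1 + cos (y * U z + a)) * (1 + cos (dotv t (Y' z) + b)))%:E =
  (M * ((1 + expR (- (y * s) ^+ 2 / 2) * cos (y * c + a)) *
        (1 + expR (- (qmx B' t / 2)) * cos (dotv t mu' + b))))%:E)%E.
Proof.
pose f1 z := 1 + cos (y * U z + a).
pose f2 z := 1 + cos (dotv t (Y' z) + b).
pose f3 z := 1 + cos (dotv t (Y' z) + y * U z + (a + b)).
pose f4 z := 1 + cos (dotv (- t) (Y' z) + y * U z + (a - b)).
have mf1 : measurable_fun setT f1 by apply: mcos; exact: measurable_fun_addmul.
have mf2 : measurable_fun setT f2 by apply: mcos; exact: measurable_funD.
have mf3 : measurable_fun setT f3.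
  apply: mcos; apply: measurable_funD => //; apply: measurable_funD => //.
  exact: measurable_funM.
have mf4 : measurable_fun setT f4.
  apply: mcos; apply: measurable_funD => //; apply: measurable_funD => //.
  exact: measurable_funM.
have E : (\int[Q]_z (f1 z * f2 z)%:E + (2 * M)%:E =
  \int[Q]_z (f1 z)%:E + \int[Q]_z (f2 z)%:E + (2^-1)%:E * \int[Q]_z (f3 z)%:E
   + (2^-1)%:E * \int[Q]_z (f4 z)%:E)%E.
  have me (f : T -> R) : measurable_fun setT f -> measurable_fun setT (EFin \o f).
    by move=> mf; apply/measurable_EFinP.
  have iD (f g : T -> R) : measurable_fun setT f -> measurable_fun setT g ->
      (forall z, 0 <= f z) -> (forall z, 0 <= g z) ->
      (\int[Q]_z (f z)%:E + \int[Q]_z (g z)%:E = \int[Q]_z (f z + g z)%:E)%E.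
    move=> mf mg f0 g0; rewrite -ge0_integralD//.
    - by move=> z _; rewrite lee_fin.
    - exact: me.
    - by move=> z _; rewrite lee_fin.
    - exact: me.
  have iZ (f : T -> R) : measurable_fun setT f -> (forall z, 0 <= f z) ->
      ((2^-1)%:E * \int[Q]_z (f z)%:E = \int[Q]_z (2^-1 * f z)%:E)%E.
    move=> mf f0; rewrite -ge0_integralZl//; first exact: me.
    by move=> z _; rewrite lee_fin.
  have -> : (2 * M)%:E = (\int[Q]_z 2%:E)%E by rewrite integral_cst// QT EFinM.
  have F1 z : 0 <= f1 z by exact: c1.
  have F2 z : 0 <= f2 z by exact: c1.
  have F3 z : 0 <= 2^-1 * f3 z by rewrite mulr_ge0// c1.
  have F4 z : 0 <= 2^-1 * f4 z by rewrite mulr_ge0// c1.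
  have mf3' : measurable_fun setT (fun z => 2^-1 * f3 z) by exact: measurable_funM.
  have mf4' : measurable_fun setT (fun z => 2^-1 * f4 z) by exact: measurable_funM.
  have F12 z : 0 <= f1 z + f2 z by exact: addr_ge0.
  have M12 : measurable_fun setT (fun z => f1 z + f2 z) by exact: measurable_funD.
  have F123 z : 0 <= f1 z + f2 z + 2^-1 * f3 z by exact: addr_ge0.
  have M123 : measurable_fun setT (fun z => f1 z + f2 z + 2^-1 * f3 z).
    exact: measurable_funD.
  have F3' z : 0 <= f3 z by exact: c1.
  have F4' z : 0 <= f4 z by exact: c1.
  have FF z : 0 <= f1 z * f2 z by exact: mulr_ge0.
  have MM : measurable_fun setT (fun z => f1 z * f2 z) by exact: measurable_funM.
  have m2 : measurable_fun setT (fun z : T => 2 : R) by exact: measurable_cst.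
  rewrite (iZ f3)// (iZ f4)// (iD f1 f2)//.
  rewrite (iD (fun z => f1 z + f2 z) (fun z => 2^-1 * f3 z))//.
  rewrite (iD (fun z => f1 z + f2 z + 2^-1 * f3 z) (fun z => 2^-1 * f4 z))//.
  rewrite (iD (fun z => f1 z * f2 z) (fun z => 2))//.
  apply: eq_integral => z _; congr EFin; rewrite prod_1Dcos /f3 /f4 dotvNl.
  by congr (_ + _ + _ * (1 + cos _) + _ * (1 + cos _)); ring.
have I1 : (\int[Q]_z (f1 z)%:E = (M * (1 + expR (- (y * s) ^+ 2 / 2) * cos (y * c + a)))%:E)%E.
  have := H 0 y a; rewrite dotv0l qmx0 mul0r oppr0 !add0r mulNr => <-.
  by apply: eq_integral => z _; rewrite /f1 dotv0l add0r.
have I2 : (\int[Q]_z (f2 z)%:E = (M * (1 + expR (- (qmx B' t / 2)) * cos (dotv t mu' + b)))%:E)%E.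
  exact: char0.
rewrite {}I1 {}I2 !H qmxN dotvNl in E.
rewrite -[LHS]/(\int[Q]_z (f1 z * f2 z)%:E)%E.
move: E; case: (\int[Q]_z (f1 z * f2 z)%:E)%E => [w| |]//=.
rewrite -!EFinM -!EFinD => -[] E; congr EFin.
apply: (addIr (2 * M)); rewrite E expRD mulNr.
have -> : dotv t mu' + y * c + (a + b) = (y * c + a) + (dotv t mu' + b) by ring.
have -> : - dotv t mu' + y * c + (a - b) = (y * c + a) - (dotv t mu' + b) by ring.
move: (y * c + a) (dotv t mu' + b) => u v.
by rewrite !cosD cosN sinN; field.
Qed.


(** Independence of [U] and [Y']. Weight [Q] by 1 + cos (t.Y' + b) and push forward along [U]: by
    [prod_char] the result has the characteristic function of a multiple of the normal law, and
    [finite_char_unique] extends the equality to every Borel set. *)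
Lemma regression_cond (A : set R) t b : measurable A ->
  (\int[Q]_z (\1_A (U z) * (1 + cos (dotv t (Y' z) + b)))%:E =
   (M * (1 + expR (- (qmx B' t / 2)) * cos (dotv t mu' + b)))%:E * normal_prob c s A)%E.
Proof.
move=> mA.
pose g z := 1 + cos (dotv t (Y' z) + b).
have g0 z : 0 <= g z by exact: c1.
have mg : measurable_fun setT g by apply: mcos; exact: measurable_funD.
pose K := 1 + expR (- (qmx B' t / 2)) * cos (dotv t mu' + b).
have K0 : 0 <= M * K.
  by rewrite -lee_fin -char0; apply: integral_ge0 => z _; rewrite lee_fin.
pose m1 : {measure set (measurableTypeR R) -> \bar R} :=
  image_measure (density_measure Q g0 mg) (mU : measurable_fun setT (U : T -> measurableTypeR R)).
pose m2 : {measure set (measurableTypeR R) -> \bar R} :=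
  mscale (NngNum K0) (normal_prob c s).
have E f : (forall x : R, (0 <= f x)%E) -> measurable_fun setT f ->
    (\int[m1]_x f x = \int[Q]_z (f (U z) * (g z)%:E))%E.
  move=> f0 mf; rewrite /m1 /image_measure/= ge0_integral_pushforward//=.
  rewrite ge0_integral_density_measure//.
  exact: measurableT_comp.
have m1E X : measurable X -> m1 X = (\int[Q]_z (\1_X (U z) * g z)%:E)%E.
  move=> mX; have := E (fun x => (\1_X x)%:E).
  rewrite integral_indic// setIT => ->//.
  by apply/measurable_EFinP; exact: measurable_indic.
rewrite -m1E//.
have -> : ((M * K)%:E * normal_prob c s A)%E = m2 A by [].
apply: finite_char_unique => //.
- rewrite m1E//; under eq_integral do rewrite indicT mul1r.
  by rewrite /g char0 ltry.
- rewrite /m2/= /mscale/= probability_setT mule1 ltry//.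
- move=> y a; rewrite E//; last first.
    apply/measurable_EFinP; apply: measurable_funD => //.
    apply: measurableT_comp; first exact: measurable_cos.
    exact: measurable_affine.
  under eq_integral do rewrite -EFinM.
  rewrite prod_char ge0_integral_mscale//=; last first.
    apply/measurable_EFinP; apply: measurable_funD => //.
    apply: measurableT_comp; first exact: measurable_cos.
    exact: measurable_affine.
  rewrite ge0_integral_normal_prob//; last first.
    apply/measurable_EFinP; apply: measurable_funD => //.
    apply: measurableT_comp; first exact: measurable_cos.
    exact: measurable_affine.
  rewrite integral_1Dcos_normal// -EFinM; congr EFin.
  by rewrite /K; ring.
Qed.

End regression.
End gauss_law.

Section gauss_law_ind.
Context {R : realType}.
Notation leb := (@lebesgue_measure R).

(** The quantification over all measures and all masses [M] is what makes the induction work: it is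
    applied to [Q] restricted to an event on the residual, whose mass is a fraction of [M]. *)
Definition gauss_integral m (mu : 'rV[R]_m) (B : 'M[R]_m) : Prop :=
  forall d (T : measurableType d) (Q : {measure set T -> \bar R}) (V : T -> m.-tuple R) (M : R),
  measurable_fun setT V -> 0 <= M -> gauss_char Q (fun z => rowt (V z)) M mu B ->
  forall f : m.-tuple R -> \bar R, measurable_fun setT f -> (forall t, (0 <= f t)%E) ->
  (\int[Q]_z f (V z) = M%:E * lint (fun y => f y * (gdens mu B (rowt y))%:E))%E.

(** On rectangles [C] times [A] the induction hypothesis is used for [Q] weighted by the indicator
    of U in A, which is again Gaussian for [V] by [regression_cond]. Rectangles determine the joint
    law, hence it is a product. *)
Lemma regression_law m (mu : 'rV[R]_m) (B : 'M[R]_m) d (T : measurableType d)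
    (Q : {measure set T -> \bar R}) (V : T -> m.-tuple R) (U : T -> R) (M c s : R)
    (F : m.-tuple R * R -> \bar R) :
  gauss_integral mu B -> measurable_fun setT V -> measurable_fun setT U ->
  0 < s -> 0 <= M ->
  (forall (t : 'rV[R]_m) (y a : R),
    (\int[Q]_z (1 + cos (dotv t (rowt (V z)) + y * U z + a))%:E =
     (M * (1 + expR (- (qmx B t / 2) - (y * s) ^+ 2 / 2) *
       cos (dotv t mu + y * c + a)))%:E)%E) ->
  measurable_fun setT F -> (forall yu, (0 <= F yu)%E) ->
  (\int[Q]_z F (V z, U z) =
   M%:E * lint (fun y => (\int[leb]_u (F (y, u) * (normal_pdf c s u)%:E)) *
                         (gdens mu B (rowt y))%:E))%E.
Proof.
move=> IH mV mU s0 M0 H mF F0.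
have mVi i : measurable_fun setT (fun z => rowt (V z) 0 i) by exact: measurable_rowt_entry.
pose N : {measure set (measurableTypeR R) -> \bar R} := normal_prob c s.
have char0 t b : (\int[Q]_z (1 + cos (dotv t (rowt (V z)) + b))%:E =
    (M * (1 + expR (- (qmx B t / 2)) * cos (dotv t mu + b)))%:E)%E.
  have := H t 0 b; rewrite !mul0r expr0n/= mul0r subr0 addr0 => <-.
  by apply: eq_integral => z _; rewrite mul0r addr0.
have cond (A : set R) C : measurable A -> measurable C ->
    (\int[Q]_z (\1_C (V z) * \1_A (U z))%:E =
     M%:E * N A * lint (fun y => (\1_C y)%:E * (gdens mu B (rowt y))%:E))%E.
  move=> mA mC.
  pose g z : R := \1_A (U z).
  have g0 z : 0 <= g z by [].
  have mg : measurable_fun setT g.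
    by apply: (measurableT_comp (measurable_indic mA)).
  have Nf : N A = (fine (N A))%:E by rewrite fineK// fin_num_measure.
  have MN0 : 0 <= M * fine (N A) by rewrite mulr_ge0// fine_ge0.
  have HA : gauss_char (density_measure Q g0 mg) (fun z => rowt (V z)) (M * fine (N A)) mu B.
    move=> t b; rewrite ge0_integral_density_measure//; first last.
    - apply/measurable_EFinP; apply: measurable_funD => //.
      apply: measurableT_comp; first exact: measurable_cos.
      by apply: measurable_funD => //; exact: (measurableT_comp (measurable_dotv t)).
    under eq_integral do rewrite -EFinM mulrC.
    rewrite (regression_cond mVi mU s0 H)//.
    have -> : normal_prob c s A = (fine (N A))%:E by exact: Nf.
    by rewrite -EFinM; congr EFin; ring.
  rewrite [in X in (X * _)%E]Nf -EFinM -(IH _ _ _ _ _ mV MN0 HA)//.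
  - rewrite ge0_integral_density_measure//.
    by apply/measurable_EFinP; apply: (measurableT_comp (measurable_indic mC)).
  - by apply/measurable_EFinP; exact: measurable_indic.
have fin : (image_measure Q mV setT < +oo)%E.
  rewrite /image_measure/= /pushforward preimage_setT.
  have := char0 0 (pi / 2).
  under eq_integral do rewrite dotv0l add0r cos_pihalf addr0.
  by rewrite integral_cst// mul1e => ->; rewrite ltry.
pose mVf : {sigma_finite_measure set _ -> \bar R} := finite_measure_of fin.
pose N' : {sigma_finite_measure set (measurableTypeR R) -> \bar R} := normal_prob c s.
pose VU z : m.-tuple R * measurableTypeR R := (V z, U z).
have mVU : measurable_fun setT VU.
  by apply: measurable_fun_pair => //; exact: mU.
have mF' : measurable_fun setT (F : m.-tuple R * measurableTypeR R -> \bar R) by exact: mF.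
pose J : {measure set _ -> \bar R} := image_measure Q mVU.
have rect (C : set (m.-tuple R)) (A : set (measurableTypeR R)) : measurable C -> measurable A ->
    J (C `*` A) = (mVf C * N' A)%E.
  move=> mC mA.
  have JE : J (C `*` A) = (\int[Q]_z (\1_C (V z) * \1_A (U z))%:E)%E.
    rewrite /J /image_measure/= /pushforward.
    rewrite -[in LHS](setIT (_ @^-1` _)) -integral_indic//; last first.
      by have := mVU measurableT _ (measurableX mC mA); rewrite setTI.
    apply: eq_integral => z _; congr EFin; rewrite !indicE -natrM mulnb; congr (_%:R).
    by congr nat_of_bool; rewrite -(in_setX (V z, U z)) /=; apply/idP/idP; rewrite !inE.
  have VE : mVf C = (M%:E * lint (fun y => (\1_C y)%:E * (gdens mu B (rowt y))%:E))%E.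
    have := cond setT C measurableT mC.
    have -> : N setT = 1%E by exact: probability_setT.
    rewrite mule1 => <-.
    rewrite /mVf /finite_measure_of /image_measure/= /pushforward.
    rewrite -[in LHS](setIT (_ @^-1` _)) -integral_indic//; last first.
      by have := mV measurableT _ mC; rewrite setTI.
    by apply: eq_integral => z _; rewrite indicT mulr1.
  by rewrite JE cond// VE -/N muleAC.
have indep := @product_measure_unique _ _ _ _ _ mVf N' J rect.
transitivity (\int[J]_yu F yu)%E.
  by rewrite /J /image_measure/= [RHS]ge0_integral_pushforward.
rewrite (eq_measure_integral (mVf \x N')%E); last first.
  by move=> A mA _; apply/esym; exact: indep.
rewrite fubini_tonelli1//.
pose G y := (\int[N]_u F (y, u))%E.
have mG : measurable_fun setT G by exact: measurable_fun_fubini_tonelli_F.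
have G0 y : (0 <= G y)%E by exact: integral_ge0.
have -> : (\int[mVf]_y fubini_F N F y = \int[Q]_z G (V z))%E.
  by rewrite /mVf /finite_measure_of /image_measure/= ge0_integral_pushforward.
rewrite (IH _ _ _ _ _ mV M0 char0)//; congr (_ * _)%E.
apply: eq_lint => y; congr (_ * _)%E.
rewrite /G /N ge0_integral_normal_prob//.
by apply: (measurableT_comp mF); exact: pair1_measurable.
Qed.

End gauss_law_ind.

Section gauss_integral.
Context {R : realType}.
Notation leb := (@lebesgue_measure R).

Lemma dotv_row m (x y : R) (t v : 'rV[R]_m) :
  dotv (row_mx x%:M t : 'rV[R]_(1 + m)) (row_mx y%:M v) = x * y + dotv t v.
Proof.
rewrite /dotv tr_row_mx mul_row_col mxE; congr (_ + _).
by rewrite mul_mx11 !mxE eqxx !mulr1n.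
Qed.

Lemma gauss_integral0 (mu : 'rV[R]_0) B : gauss_integral mu B.
Proof.
move=> d T Q V M mV M0 H f mf f0.
have -> : (\int[Q]_z f (V z) = \int[Q]_z f [tuple])%E.
  by apply: eq_integral => z _; rewrite (tuple0 (V z)).
rewrite integral_cst// muleC.
have -> : Q setT = M%:E.
  have := H 0 (pi / 2); under eq_integral do rewrite dotv0l add0r cos_pihalf addr0.
  by rewrite integral_cst// mul1e => ->; rewrite dotv0l add0r cos_pihalf mulr0 addr0 mulr1.
congr (_ * _)%E; rewrite /= /gdens det_mx00 sqrtr1 expr0 mulr1 invr1 mul1r.
by rewrite /qmx mxE big_ord0 mul0r oppr0 expR0 mule1; congr f; exact: tuple0.
Qed.

(** The first coordinate is the residual plus its regression on the rest. [regression_law]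
    integrates the residual first; a translation by [dotv l (rowt y)] and [gdens_cons] then restore
    the joint density. *)
Lemma gauss_integralS m (b : 'M[R]_1) (r : 'rV[R]_m) B' (mu0 : R) (mu' : 'rV[R]_m) :
  posdefmx (block_mx b r r^T B' : 'M[R]_(1 + m)) -> gauss_integral mu' B' ->
  @gauss_integral R m.+1 (row_mx mu0%:M mu' : 'rV[R]_(1 + m)) (block_mx b r r^T B').
Proof.
move=> pB IH d T Q V M mV M0 H f mf f0.
pose X z := tnth (V z) ord0.
pose V' z := [tuple of behead (V z)].
have VE z : V z = cons_tuple (X z) (V' z) by rewrite {1}(tuple_eta (V z)); apply/val_inj.
have mX : measurable_fun setT X by apply: (measurableT_comp (measurable_tnth ord0)).
have mV' : measurable_fun setT V' by apply: (measurableT_comp (@measurable_behead _ R m)).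
pose l := regr r B'.
pose U z := X z - dotv l (rowt (V' z)).
have mU : measurable_fun setT U.
  by apply: measurable_funB => //; exact: (measurableT_comp (measurable_dotv l)).
pose s := Num.sqrt (schur b r B' 0 0).
have s0 : 0 < s by rewrite sqrtr_gt0; exact: schur_gt0.
pose c := mu0 - dotv l mu'.
have HU (t : 'rV[R]_m) (y a : R) :
    (\int[Q]_z (1 + cos (dotv t (rowt (V' z)) + y * U z + a))%:E =
     (M * (1 + expR (- (qmx B' t / 2) - (y * s) ^+ 2 / 2) *
       cos (dotv t mu' + y * c + a)))%:E)%E.
  have dE (x : R) v : dotv t v + y * (x - dotv l v) =
      dotv (row_mx y%:M (t - y *: l) : 'rV[R]_(1 + m)) (row_mx x%:M v).
    by rewrite dotv_row dotvDl dotvNl dotvZl; ring.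
  under eq_integral do rewrite /U dE -rowt_cons -VE.
  rewrite H qmx_row// /c dE; congr (M * (1 + expR _ * _))%:E.
  by rewrite exprMn /s sqr_sqrtr ?ltW ?schur_gt0//; field.
pose F (yu : m.-tuple R * R) := f (cons_tuple (yu.2 + dotv l (rowt yu.1)) yu.1).
have mF : measurable_fun setT F.
  apply: (measurableT_comp mf); apply: measurable_fun_cons => //.
  by apply: measurable_funD => //; exact: (measurableT_comp (measurable_dotv l)).
have := regression_law IH mV' mU s0 M0 HU mF (fun=> f0 _).
rewrite (_ : (\int[Q]_z F (V' z, U z))%E = (\int[Q]_z f (V z))%E); last first.
  by apply: eq_integral => z _; rewrite /F /U/= subrK -VE.
move=> ->; congr (_ * _)%E.
rewrite lintS.
pose G (xy : R * m.-tuple R) := (f (cons_tuple xy.1 xy.2) *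
  (normal_pdf c s (xy.1 - dotv l (rowt xy.2)) * gdens mu' B' (rowt xy.2))%:E)%E.
have G0 xy : (0 <= G xy)%E.
  by rewrite /G mule_ge0// lee_fin mulr_ge0 ?normal_pdf_ge0 ?gdens_ge0.
have mG : measurable_fun setT G.
  apply: emeasurable_funM.
    by apply: (measurableT_comp mf); exact: measurable_fun_cons.
  apply/measurable_EFinP; apply: measurable_funM; last first.
    exact: (measurableT_comp (measurable_gdens mu' B')).
  apply: (measurableT_comp (measurable_normal_pdf c s)).
  by apply: measurable_funB => //; exact: (measurableT_comp (measurable_dotv l)).
transitivity (\int[leb]_x lint (fun y => G (x, y)))%E; last first.
  apply: eq_integral => x _; apply: eq_lint => y; rewrite /G/= rowt_cons.
  by rewrite gdens_cons.
have exch := @lint_exchange R m _ (measurableTypeR R) leb G mG G0.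
apply: etrans; last exact: esym exch.
apply: eq_lint => y.
pose h x := (f (cons_tuple x y) * (normal_pdf c s (x - dotv l (rowt y)))%:E)%E.
have h0 x : (0 <= h x)%E by rewrite mule_ge0// lee_fin normal_pdf_ge0.
have mh : measurable_fun setT h.
  apply: emeasurable_funM.
    by apply: (measurableT_comp mf); exact: measurable_fun_cons.
  apply/measurable_EFinP; apply: (measurableT_comp (measurable_normal_pdf c s)).
  exact: measurable_funB.
have EG : (\int[leb]_x G (x, y) = \int[leb]_x (h x * (gdens mu' B' (rowt y))%:E))%E.
  by apply: eq_integral => x _; rewrite /G /h/= EFinM muleA.
apply: etrans; last exact: esym EG.
have EZ : (\int[leb]_x (h x * (gdens mu' B' (rowt y))%:E) =
    \int[leb]_x h x * (gdens mu' B' (rowt y))%:E)%E.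
  apply: (@ge0_integralZr _ (measurableTypeR R) R leb setT measurableT h mh) => //.
  by rewrite lee_fin gdens_ge0.
apply: etrans; last exact: esym EZ.
congr (_ * _)%E.
apply: etrans (ge0_integral_shift (dotv l (rowt y)) mh h0).
by apply: eq_integral => u _; rewrite /h /F/= addrK.
Qed.

Theorem gauss_integralP m (mu : 'rV[R]_m) (B : 'M[R]_m) :
  posdefmx B -> gauss_integral mu B.
Proof.
elim: m mu B => [|m IH] mu B pB; first exact: gauss_integral0.
have e := @sym_blockE R m B pB.1.
have emu : mu = row_mx (lsubmx (mu : 'rV[R]_(1 + m)) 0 0)%:M (rsubmx (mu : 'rV[R]_(1 + m))).
  by rewrite -mx11_scalar hsubmxK.
rewrite emu; rewrite e in pB *.
by apply: gauss_integralS => //; apply: IH; exact: (schur_sub pB).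
Qed.

End gauss_integral.

(** * Elementary inequalities for the exponential *)

Section exp_inequalities.
Context {R : realType}.
Implicit Types x y h t : R.

(** By the mean value theorem, a function whose derivative has the sign of its argument grows away
    from 0 on both sides. Only points with |x| <= |h| are tested, so [f] may contain constants that
    depend on [h]. *)
Lemma ge0_of_derive (f f' : R -> R) h :
  (forall x : R, is_derive x 1 f (f' x)) -> f 0 = 0 ->
  (forall x, 0 < x * h -> `|x| <= `|h| -> 0 <= x * f' x) -> 0 <= f h.
Proof.
move=> df f0 s.
have cf : continuous f.
  by move=> x; apply: differentiable_continuous; apply/derivable1_diffP/ex_derive.
have [h0|h0|->] := ltgtP h 0; last by rewrite f0.
- have [c] := @MVT R f f' h 0 h0 (fun x _ => df x) (continuous_subspaceT cf).
  rewrite in_itv/= f0 !sub0r => /andP[hc c0] e.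
  have : 0 <= c * f' c by apply: s; [rewrite nmulr_lgt0|rewrite !ltr0_norm// lerN2 ltW].
  by rewrite nmulr_rge0// => fc; rewrite -oppr_le0 e mulr_le0_ge0// oppr_ge0 ltW.
- have [c] := @MVT R f f' 0 h h0 (fun x _ => df x) (continuous_subspaceT cf).
  rewrite in_itv/= f0 !subr0 => /andP[c0 ch] e.
  have : 0 <= c * f' c by apply: s; [rewrite mulr_gt0|rewrite !gtr0_norm// ltW].
  by rewrite pmulr_rge0// => fc; rewrite e mulr_ge0// ltW.
Qed.

(** The rate function of Euler's integral about its maximum: at v = ln a + h the exponent a v - e^v
    equals a ln a - a - a * psi h. *)
Definition psi h := expR h - 1 - h.

Lemma psi_ge0 h : 0 <= psi h.
Proof. by rewrite /psi; have := expR_ge1Dx h; lra. Qed.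

Lemma is_derive_sqr_half (k h : R) : is_derive h 1 (fun x => k * x ^+ 2 / 2) (k * h).
Proof.
have -> : (fun x : R => k * x ^+ 2 / 2) = (fun x => (k / 2) * x ^+ 2).
  by apply/funext => t; rewrite mulrAC.
by apply: is_derive_eq; rewrite /GRing.scale/=; field.
Qed.

Lemma is_derive_psi (h : R) : is_derive h 1 psi (expR h - 1).
Proof.
have -> : psi = (fun x => expR x + - (1 + x)) by apply/funext => t; rewrite /psi opprD addrA.
by apply: is_derive_eq; rewrite add0r.
Qed.

Lemma expRB1_le h : expR h - 1 <= h * expR h.
Proof.
have := expR_ge1Dx (- h); rewrite -(ler_pM2r (expR_gt0 h)) -expRD addNr expR0.
lra.
Qed.

Lemma psi_le h : psi h <= expR `|h| * h ^+ 2 / 2.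
Proof.
rewrite -subr_ge0.
pose k := expR `|h|; pose f x := k * x ^+ 2 / 2 - psi x.
apply: (@ge0_of_derive f (fun x => k * x - (expR x - 1)) h).
- move=> x; rewrite /f; have d1 := is_derive_sqr_half k x; have d2 := is_derive_psi x.
  exact: is_deriveB.
- by rewrite /f /psi expr0n mulr0 mul0r expR0; ring.
- move=> x _ xh; have k1 : 1 <= k by rewrite -expR0 ler_expR.
  have [x0|x0] := leP 0 x.
    rewrite mulr_ge0// subr_ge0; apply: le_trans (expRB1_le x) _.
    by rewrite mulrC ler_wpM2r// ler_expR (le_trans (ler_norm _) xh).
  rewrite nmulr_rge0// subr_le0; have := expR_ge1Dx x.
  have : k * x <= x by rewrite ger_nMl.
  lra.
Qed.

Lemma psi_ge h : expR (- `|h|) * h ^+ 2 / 2 <= psi h.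
Proof.
rewrite -subr_ge0.
pose k := expR (- `|h|); pose f x := psi x - k * x ^+ 2 / 2.
apply: (@ge0_of_derive f (fun x => (expR x - 1) - k * x) h).
- move=> x; rewrite /f; have d1 := is_derive_sqr_half k x; have d2 := is_derive_psi x.
  exact: is_deriveB.
- by rewrite /f /psi expr0n mulr0 mul0r expR0; ring.
- move=> x _ xh; have k1 : k <= 1 by rewrite -expR0 ler_expR oppr_le0.
  have [x0|x0] := leP 0 x.
    rewrite mulr_ge0// subr_ge0; have := expR_ge1Dx x.
    have : k * x <= x by rewrite ler_piMl.
    lra.
  rewrite nmulr_rge0// subr_le0; apply: le_trans (expRB1_le x) _.
  rewrite [leRHS]mulrC; apply: ler_wnM2l; first exact: ltW.
  rewrite /k ler_expR.
  by rewrite lerNl; move: xh; rewrite ltr0_norm.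
Qed.

(** A bound linear in |s| and uniform in [r], to dominate exp (- r^2 psi (s / r)). For h = s / r >=
    -2 it follows from e^h >= (1 + h / 2)^2, which gives psi h >= h^2 / 4; below -2 the linear part
    alone gives psi h >= - h / 2. *)
Lemma psi_dom (r s : R) : 1 <= r -> `|s| / 2 - 1 / 4 <= r ^+ 2 * psi (s / r).
Proof.
move=> r1; have r0 : 0 < r by exact: lt_le_trans r1.
have [h2|h2] := leP (- 2) (s / r).
  have : (1 + (s / r) / 2) ^+ 2 <= expR (s / r).
    have -> : expR (s / r) = expR (s / r / 2) ^+ 2.
      by rewrite expr2 -expRD; congr expR; field; rewrite gt_eqF.
    rewrite ler_sqr ?nnegrE ?expR_ge0//; last lra.
    exact: expR_ge1Dx.
  move=> h; have : s ^+ 2 / 4 <= r ^+ 2 * psi (s / r).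
    have -> : s ^+ 2 / 4 = r ^+ 2 * ((s / r) ^+ 2 / 4) by field; rewrite gt_eqF.
    rewrite ler_wpM2l ?sqr_ge0// /psi; nra.
  apply: le_trans; have := sqr_ge0 (`|s| / 2 - 1 / 2); rewrite -(real_normK (num_real s)).
  set z := `|s|; nra.
have s0 : s < 0 by move: h2; rewrite ltr_pdivrMr//; lra.
rewrite ltr0_norm//; have : - (s / r) / 2 <= psi (s / r).
  by have := expR_gt0 (s / r); rewrite /psi; lra.
move=> h; have : r ^+ 2 * (- (s / r) / 2) <= r ^+ 2 * psi (s / r) by rewrite ler_wpM2l ?sqr_ge0.
have -> : r ^+ 2 * (- (s / r) / 2) = r * (- s) / 2 by field; rewrite gt_eqF.
nra.
Qed.

Lemma sinh_ge t : 0 <= t -> 2 * t <= expR t - expR (- t).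
Proof.
move=> t0; rewrite -subr_ge0.
apply: (@ge0_of_derive (fun t => expR t - expR (- t) - 2 * t)
  (fun t => expR t + expR (- t) - 2)).
- move=> x; have d1 := is_derive1_comp (is_derive_expR (- x)) (is_deriveN (is_derive_id x (1 : R))).
  have d2 := is_deriveZ (2 : R) (is_derive_id x (1 : R)).
  have d3 := is_deriveB (is_deriveB (is_derive_expR x) d1) d2.
  by apply: (is_derive_eq d3); rewrite /GRing.scale/=; ring.
- by rewrite oppr0 expR0; ring.
- move=> x xt _; have [x0|x0] := leP 0 x; last first.
    by move: xt; rewrite nmulr_rgt0// ltNge t0.
  rewrite mulr_ge0//; have h := expR_gt0 x.
    have := sqr_ge0 (expR x - 1); rewrite expRN.
    have : expR x * (expR x)^-1 = 1 by rewrite mulfV// gt_eqF.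
    have : 0 < (expR x)^-1 by rewrite invr_gt0.
    set e := expR x in h *; set f := e^-1; nra.
Qed.

Lemma log_mean_ge t : 0 <= t -> 2 * (expR t - 1) <= t * (expR t + 1).
Proof.
move=> t0; rewrite -subr_ge0.
apply: (@ge0_of_derive (fun t => t * (expR t + 1) - 2 * (expR t - 1))
  (fun t => 1 + (t - 1) * expR t)).
- move=> x; have d1 := is_deriveD (is_derive_expR x) (is_derive_cst (1 : R) x 1).
  have d2 := is_deriveM (is_derive_id x (1 : R)) d1.
  have d3 := is_deriveZ (2 : R) (is_deriveB (is_derive_expR x) (is_derive_cst (1 : R) x 1)).
  by apply: (is_derive_eq (is_deriveB d2 d3)); rewrite /GRing.scale/= ?fctE; ring.
- by rewrite expR0; ring.
- move=> x xt _; have [x0|x0] := leP 0 x; last first.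
    by move: xt; rewrite nmulr_rgt0// ltNge t0.
  by rewrite mulr_ge0//; have := expRB1_le x; lra.
Qed.

End exp_inequalities.

(** * The Gamma function in the logarithmic variable *)

Section gamma_function.
Context {R : realType}.
Notation leb := (@lebesgue_measure R).
Implicit Types a c v : R.

Lemma integrable_exp_abs c : 0 < c ->
  leb.-integrable setT (EFin \o (fun x : R => expR (- (c * `|x|)))).
Proof.
move=> c0.
have mexp : measurable_fun setT (fun x : R => expR (- (c * `|x|))).
  apply: measurableT_comp => //; apply: measurable_funN.
  by apply: measurable_funM => //; exact: measurableT_comp.
have ip := integrable_exponential_pdf c0.
have iN : leb.-integrable setT (fun x => (exponential_pdf c (- x))%:E).
  apply/integrableP; split.
    apply/measurable_EFinP; apply: measurableT_comp => //.
    exact: measurable_exponential_pdf.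
  under eq_integral do rewrite gee0_abs ?lee_fin ?exponential_pdf_ge0 ?ltW//.
  rewrite (@ge0_integral_oppr _ (EFin \o exponential_pdf c)).
  - by rewrite integral_exponential_pdf// ltry.
  - by apply/measurable_EFinP; exact: measurable_exponential_pdf.
  - by move=> x; rewrite lee_fin exponential_pdf_ge0// ltW.
have iS : leb.-integrable setT (fun x => (c^-1)%:E *
    ((exponential_pdf c x)%:E + (exponential_pdf c (- x))%:E))%E.
  by apply: integrableZl => //; exact: integrableD.
apply: (le_integrable _ _ _ iS) => //; first exact/measurable_EFinP.
have e0 x : 0 <= exponential_pdf c x by rewrite exponential_pdf_ge0// ltW.
move=> x _ /=; rewrite lee_fin ger0_norm ?expR_ge0//.
rewrite [leRHS]ger0_norm; last first.
  by apply: mulr_ge0; [rewrite invr_ge0 ltW|exact: addr_ge0].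
rewrite [leRHS]mulrC ler_pdivlMr//.
have pdfE y : 0 <= y -> exponential_pdf c y = expR (- (c * y)) * c.
  by move=> y0; rewrite exponential_pdfE// mulrC mulNr.
have [x0|x0] := leP 0 x.
  by rewrite ger0_norm// (pdfE x)// lerDl.
have xn : 0 <= - x by rewrite oppr_ge0 ltW.
by rewrite ltr0_norm// (pdfE (- x))// lerDr.
Qed.

(* Euler's integral for Gamma in the variable [v = log u]. *)
Definition gamfun a v : R := expR (a * v - expR v).

Lemma measurable_gamfun a : measurable_fun setT (gamfun a).
Proof.
by apply: measurableT_comp => //; apply: measurable_funB => //; apply: measurable_funM.
Qed.

Definition gam_dom a v : R := expR (- (a * `|v|)) + expR (a ^+ 2 - 1) * expR (- (1 * `|v|)).

(** For v < 0 the factor e^{a v} decays by itself. For v >= 0, e^v = e^a e^{v-a} >= (1 + a)(1 + v -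
    a), which leaves the exponent a^2 - 1 - v. *)
Lemma gamfun_le a v : 0 < a -> gamfun a v <= gam_dom a v.
Proof.
move=> a0; rewrite /gamfun /gam_dom; have [v0|v0] := leP 0 v; last first.
  apply: (@le_trans _ _ (expR (a * v))).
    by rewrite ler_expR gerBl expR_ge0.
  by rewrite ltr0_norm// mulrN opprK lerDl mulr_ge0// expR_ge0.
apply: (@le_trans _ _ (expR (a ^+ 2 - 1) * expR (- (1 * v)))); last first.
  by rewrite ger0_norm// lerDr expR_ge0.
rewrite -expRD ler_expR mul1r.
have h : (1 + a) * (1 + (v - a)) <= expR v.
  have [h|h] := leP 0 (1 + (v - a)); last first.
    apply: (@le_trans _ _ 0); last exact: expR_ge0.
    by rewrite pmulr_rle0 ?ltW// addr_gt0.
  rewrite -[in leRHS](subrK a v) expRD mulrC ler_pM// ?expR_ge1Dx//.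
  by rewrite addr_ge0// ltW.
nra.
Qed.

Lemma integrable_gam_dom a : 0 < a -> leb.-integrable setT (EFin \o gam_dom a).
Proof.
move=> a0; rewrite (_ : _ \o _ = (EFin \o (fun x : R => expR (- (a * `|x|)))) \+
  (fun x => (expR (a ^+ 2 - 1))%:E * (expR (- (1 * `|x|)))%:E)%E); last first.
  by apply/funext => x; rewrite /gam_dom/= EFinD EFinM.
apply: integrableD => //; first exact: integrable_exp_abs.
by apply: integrableZl => //; exact: integrable_exp_abs.
Qed.

Lemma integrable_gamfun a : 0 < a -> leb.-integrable setT (EFin \o gamfun a).
Proof.
move=> a0; apply: (le_integrable _ _ _ (integrable_gam_dom a0)) => //.
  by apply/measurable_EFinP; exact: measurable_gamfun.
move=> x _; rewrite /= lee_fin ger0_norm ?expR_ge0//.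
by apply: le_trans (gamfun_le x a0) (ler_norm _).
Qed.

Definition Gam a : R := (\int[leb]_v gamfun a v)%R.

Lemma GamE a : 0 < a -> (\int[leb]_v (gamfun a v)%:E = (Gam a)%:E)%E.
Proof.
move=> a0; rewrite /Gam /Rintegral fineK//.
exact: integrable_fin_num (integrable_gamfun a0).
Qed.

Lemma expR_lin_harmonic c (n : nat) : 0 < c ->
  expR (- (c * n%:R)) <= (1 + c^-1) * harmonic n.
Proof.
move=> c0; rewrite expRN /harmonic -[leRHS]invrK lef_pV2 ?posrE ?expR_gt0//; last first.
  by rewrite invr_gt0 mulr_gt0 ?invr_gt0// addr_gt0 ?invr_gt0.
apply: le_trans (expR_ge1Dx _).
rewrite invf_div ler_pdivrMr ?addr_gt0 ?invr_gt0//.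
have -> : (1 + c * n%:R) * (1 + c^-1) = 1 + c^-1 + c * n%:R + n%:R.
  by field; rewrite gt_eqF.
rewrite -natr1; have : 0 <= c * n%:R by rewrite mulr_ge0// ltW.
have : 0 < c^-1 by rewrite invr_gt0.
lra.
Qed.

Lemma cvg_gamfun a (s : nat -> R) : 0 < a -> (forall n, `|s n| = n%:R) ->
  gamfun a (s n) @[n --> \oo] --> 0.
Proof.
move=> a0 sn; pose C := (1 + a^-1) + expR (a ^+ 2 - 1) * (1 + 1^-1).
apply: (@squeeze_cvgr _ _ _ _ (cst 0) (fun n => C * harmonic n)).
- apply: nearW => n; rewrite expR_ge0/=.
  apply: le_trans (gamfun_le _ a0) _; rewrite /gam_dom sn /C mulrDl lerD//.
    exact: expR_lin_harmonic.
  by rewrite -mulrA ler_wpM2l ?expR_ge0// expR_lin_harmonic.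
- exact: cvg_cst.
- rewrite -[0](mulr0 C); apply: cvgM; [exact: cvg_cst|exact: cvg_harmonic].
Qed.

Lemma continuous_gamfun a : continuous (gamfun a).
Proof.
move=> v; apply: continuous_comp; last exact: continuous_expR.
apply: (@cvgB _ R^o); last exact: continuous_expR.
exact: mulrl_continuous.
Qed.

(** The derivative of [gamfun a] is a * gamfun a - gamfun (a + 1), and it integrates to 0 over the
    line. *)
Lemma GamS a : 0 < a -> Gam (a + 1) = a * Gam a.
Proof.
move=> a0; have a1 : 0 < a + 1 by rewrite addr_gt0.
pose f v := a * gamfun a v - gamfun (a + 1) v.
have df (v : R) : is_derive v 1 (gamfun a) (f v).
  have d1 := is_deriveB (is_deriveZ a (is_derive_id v (1 : R))) (is_derive_expR v).
  have d2 := is_derive1_comp (is_derive_expR _) d1.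
  apply: (is_derive_eq d2); rewrite /f /gamfun /GRing.scale/= mulr1.
  rewrite [X in _ = _ - expR X](_ : _ = (a * v - expR v) + v); last by ring.
  rewrite [expR (_ + v)]expRD; ring.
have i1 := integrable_gamfun a0; have i2 := integrable_gamfun a1.
have fE : EFin \o f = ((fun v => a%:E * (gamfun a v)%:E) \- (EFin \o gamfun (a + 1)))%E.
  by apply/funext => v; rewrite /f/= EFinB EFinM.
have i3 : leb.-integrable setT (fun v => a%:E * (gamfun a v)%:E)%E.
  exact: integrableZl.
have fi : leb.-integrable setT (EFin \o f) by rewrite fE; exact: integrableB.
have cf : continuous f.
  move=> v; apply: (@cvgB _ R^o); last exact: continuous_gamfun.
  by apply: cvgM; [exact: cvg_cst|exact: continuous_gamfun].
have nN (n : nat) : `|- n%:R| = n%:R :> R by rewrite normrN normr_nat.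
have nn (n : nat) : `|n%:R| = n%:R :> R by rewrite normr_nat.
have := integral_derive_line df cf fi (cvg_gamfun a0 nN) (cvg_gamfun a0 nn).
rewrite subr0 -[X in (\int[_]_x X x)%E]/(EFin \o f) fE.
rewrite integralB//= integralZl// !GamE// -EFinM -EFinB => -[] /eqP.
by rewrite subr_eq0 => /eqP ->.
Qed.

End gamma_function.

(** * Stirling's formula with explicit error *)

Section stirling.
Context {R : realType}.
Notation leb := (@lebesgue_measure R).
Implicit Types a s : R.

(* Gamma divided by Stirling's main term. *)
Definition rho a : R := Gam a * expR (a - (a - 2^-1) * ln a) / Num.sqrt (pi *+ 2).

(** The substitution v = ln a + s / sqrt a centres Euler's integral at its maximum and puts it on
    the Gaussian scale. *)
Lemma rho_integral a : 0 < a ->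
  (\int[leb]_s (expR (- (Num.sqrt a ^+ 2 * psi (s / Num.sqrt a))))%:E =
   (rho a * Num.sqrt (pi *+ 2))%:E)%E.
Proof.
move=> a0; set r := Num.sqrt a.
have r0 : 0 < r by rewrite sqrtr_gt0.
have r2 : r ^+ 2 = a by rewrite sqr_sqrtr// ltW.
pose c := expR (a - a * ln a).
pose h v := (c * gamfun a v)%:E.
have h0 v : (0 <= h v)%E by rewrite lee_fin mulr_ge0// expR_ge0.
have mh : measurable_fun setT h.
  apply/measurable_EFinP; apply: measurable_funM => //; exact: measurable_gamfun.
have -> : (\int[leb]_s (expR (- (r ^+ 2 * psi (s / r))))%:E =
    \int[leb]_s h (r^-1 * s + ln a)%R)%E.
  apply: eq_integral => s _; rewrite /h /c /gamfun -expRD; congr (expR _)%:E.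
  rewrite /psi r2 expRD lnK ?posrE// (mulrC r^-1).
  move: (expR (s / r)) (ln a) => u w; rewrite -r2; by field; rewrite gt_eqF.
have ri0 : 0 < r^-1 by rewrite invr_gt0.
rewrite (ge0_integral_affine (ln a) ri0 mh h0) invrK /h.
under eq_integral do rewrite EFinM.
rewrite integralZl//; last exact: integrable_gamfun.
rewrite GamE// -!EFinM; congr EFin; rewrite /rho divfK; last first.
  by rewrite gt_eqF// sqrtr_gt0 mulrn_wgt0// pi_gt0.
have -> : a - (a - 2^-1) * ln a = (a - a * ln a) + 2^-1 * ln a by ring.
rewrite expRD -/c.
have -> : expR (2^-1 * ln a) = r.
  apply/eqP; rewrite -(eqrXn2 (n := 2))// ?expR_ge0 ?ltW//.
  rewrite r2 expr2 -expRD (_ : _ + _ = ln a) ?lnK ?posrE//.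
  by field.
ring.
Qed.

(** For t = ln ((a + 1) / a) the lower bound is 2 (e^t - 1) <= t (e^t + 1) and the upper one is 2 t
    <= e^t - e^{-t}. The excess is put as a difference of reciprocals so that it telescopes under a
    -> a + 1. *)
Lemma log_ratio_bounds a : 0 < a ->
  1 <= (a + 2^-1) * (ln (a + 1) - ln a) <= 1 + 4^-1 * (a^-1 - (a + 1)^-1).
Proof.
move=> a0; set t := ln (a + 1) - ln a.
have a1 : 0 < a + 1 by rewrite addr_gt0.
have et : expR t = (a + 1) / a by rewrite /t -ln_div ?posrE// lnK ?posrE ?divr_gt0.
have t0 : 0 <= t by rewrite subr_ge0 ler_ln ?posrE// lerDl.
apply/andP; split.
  have := log_mean_ge t0; rewrite et.
  have -> : 2 * ((a + 1) / a - 1) = 2 / a by field; rewrite gt_eqF.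
  have -> : t * ((a + 1) / a + 1) = (t * (2 * a + 1)) / a by field; rewrite gt_eqF.
  rewrite ler_pM2r ?invr_gt0//; lra.
have := sinh_ge t0; rewrite expRN et invf_div.
have -> : (a + 1) / a - a / (a + 1) = (2 * a + 1) / (a * (a + 1)).
  by field; rewrite !gt_eqF.
have -> : 1 + 4^-1 * (a^-1 - (a + 1)^-1) =
    (2 * a + 1) / (a * (a + 1)) * ((a + 2^-1) / 2).
  by field; rewrite !gt_eqF.
have a2 : 0 < (a + 2^-1) / 2 by lra.
move=> h; have : 2 * t * ((a + 2^-1) / 2) <= (2 * a + 1) / (a * (a + 1)) * ((a + 2^-1) / 2).
  by rewrite ler_pM2r.
by apply: le_trans; lra.
Qed.

Lemma rho_ge0 a : 0 < a -> 0 <= rho a.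
Proof.
move=> a0; rewrite /rho divr_ge0 ?sqrtr_ge0// mulr_ge0 ?expR_ge0//.
by rewrite -lee_fin -GamE//; apply: integral_ge0 => v _; rewrite lee_fin expR_ge0.
Qed.

Lemma rhoS a : 0 < a ->
  rho a = rho (a + 1) * expR ((a + 2^-1) * (ln (a + 1) - ln a) - 1).
Proof.
move=> a0; rewrite /rho GamS//.
set X1 := expR _; set X2 := expR _; set X3 := expR _.
have -> : X1 = expR (ln a) * (X2 * X3) by rewrite -!expRD; congr expR; field.
by rewrite lnK//; ring.
Qed.

Lemma rho_shift a (n : nat) : 0 < a ->
  rho (a + n%:R) <= rho a <= rho (a + n%:R) * expR (4^-1 * (a^-1 - (a + n%:R)^-1)).
Proof.
move=> a0; elim: n => [|n /andP[IH1 IH2]].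
  by rewrite addr0 subrr mulr0 expR0 mulr1 lexx.
have b0 : 0 < a + n%:R by rewrite ltr_pwDl.
rewrite -natr1 addrA; set b := a + n%:R in b0 IH1 IH2 *.
have b1 : 0 < b + 1 by rewrite addr_gt0.
have /andP[l1 l2] := log_ratio_bounds b0.
have r1 := rho_ge0 b1.
apply/andP; split.
  apply: le_trans IH1; rewrite (rhoS b0) ler_peMr//.
  by rewrite -[leLHS]expR0 ler_expR subr_ge0.
apply: (le_trans IH2); rewrite (rhoS b0) -mulrA ler_wpM2l// -expRD ler_expR.
lra.
Qed.

Lemma integral_gauss : (\int[leb]_s (expR (- s ^+ 2 / 2))%:E = (Num.sqrt (pi *+ 2))%:E)%E.
Proof.
have s2pi : Num.sqrt (pi *+ 2) != 0 :> R by rewrite gt_eqF// sqrtr_gt0 mulrn_wgt0// pi_gt0.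
have := integrable_normal_pdf (0 : R) 1.
have := integral_normal_pdf (0 : R) 1 => + ip.
move=> /(congr1 (fun u => (Num.sqrt (pi *+ 2))%:E * u)%E); rewrite mule1 => <-.
rewrite -integralZl//; apply: eq_integral => s _.
by rewrite -EFinM std_normalE mulrA mulfV// mul1r.
Qed.

Lemma cvg_sqr_psi (r : nat -> R) s : (forall n, 0 < r n) -> (r n)^-1 @[n --> \oo] --> (0 : R) ->
  r n ^+ 2 * psi (s / r n) @[n --> \oo] --> s ^+ 2 / 2.
Proof.
move=> r0 roo.
have E n : r n ^+ 2 * (s / r n) ^+ 2 = s ^+ 2 by field; rewrite gt_eqF.
have sr : `|s / r n| @[n --> \oo] --> (0 : R).
  rewrite -(normr0 R); apply: cvg_norm; rewrite -(mulr0 s).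
  by apply: cvgM => //; exact: cvg_cst.
apply: (@squeeze_cvgr _ _ _ _ (fun n => expR (- `|s / r n|) * (s ^+ 2 / 2))
  (fun n => expR `|s / r n| * (s ^+ 2 / 2))).
- apply: nearW => n; apply/andP; split.
    rewrite -(E n) -mulrA mulrCA ler_wpM2l ?sqr_ge0// mulrA.
    exact: psi_ge.
  rewrite -(E n) -mulrA mulrCA ler_wpM2l ?sqr_ge0// mulrA.
  exact: psi_le.
- rewrite -[X in _ --> X]mul1r -expR0 -oppr0; apply: cvgM; last exact: cvg_cst.
  apply: continuous_cvg; first exact: continuous_expR.
  exact: (@cvgN _ R^o).
- rewrite -[X in _ --> X]mul1r -expR0; apply: cvgM; last exact: cvg_cst.
  by apply: continuous_cvg; first exact: continuous_expR.
Qed.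

(* In [s = sqrt a * h] the integrand [expR (- a * psi h)] tends to the Gaussian one. *)
Lemma cvg_rho a : 0 < a -> rho (a + n.+1%:R) @[n --> \oo] --> (1 : R).
Proof.
move=> a0.
pose r (n : nat) := Num.sqrt (a + n.+1%:R).
have an0 (n : nat) : 0 < a + n.+1%:R by rewrite addr_gt0.
have r1 n : 1 <= r n.
  rewrite -[leLHS]sqrtr1 ler_sqrt ?ltW// -natr1.
  by have := ler0n R n; lra.
have r0 n : 0 < r n by exact: lt_le_trans (r1 n).
have roo : (r n)^-1 @[n --> \oo] --> (0 : R).
  apply: (@squeeze_cvgr _ _ _ _ (cst 0) (fun n => Num.sqrt (harmonic n))).
  - apply: nearW => n; apply/andP; split; first by rewrite invr_ge0 sqrtr_ge0.
    have an := ltW (an0 n); rewrite /r -sqrtrV//.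
    by apply: ler_wsqrtr; rewrite lef_pV2 ?posrE// lerDr ltW.
  - exact: cvg_cst.
  - rewrite -(sqrtr0 R); apply: continuous_cvg; first exact: sqrt_continuous.
    exact: cvg_harmonic.
have s2pi : 0 < Num.sqrt (pi *+ 2) :> R by rewrite sqrtr_gt0 mulrn_wgt0// pi_gt0.
pose f n s := expR (- (r n ^+ 2 * psi (s / r n))).
have mf n : measurable_fun setT (f n).
  apply: measurableT_comp => //; apply: measurable_funN; apply: measurable_funM => //.
  rewrite /psi; apply: measurable_funB; last exact: measurable_funM.
  apply: measurable_funB => //; apply: measurableT_comp => //.
  exact: measurable_funM.
have H : (fun n => \int[leb]_s (f n s)%:E)%E @ \oo --> (\int[leb]_s (expR (- s ^+ 2 / 2))%:E)%E.
  apply: (@dominated_cvg _ _ _ leb setT _ (fun n => EFin \o f n) _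
    (fun s => (expR (1 / 4))%:E * (expR (- (2^-1 * `|s|)))%:E)%E) => //.
  - by move=> n; apply/measurable_EFinP; exact: mf.
  - move=> s _; apply: cvg_EFin; first exact: nearW.
    apply: continuous_cvg; first exact: continuous_expR.
    by rewrite mulNr; apply: (@cvgN _ R^o); exact: cvg_sqr_psi.
  - by apply: integrableZl => //; apply: integrable_exp_abs.
  - move=> n s _; rewrite -EFinM /= lee_fin ger0_norm ?expR_ge0//.
    by rewrite -expRD ler_expR; have := psi_dom s (r1 n); lra.
have fE : (fun n => \int[leb]_s (f n s)%:E)%E =
    (fun n => (rho (a + n.+1%:R) * Num.sqrt (pi *+ 2))%:E).
  by apply/funext => n; rewrite -rho_integral.
rewrite integral_gauss fE in H.
have {}H : rho (a + n.+1%:R) * Num.sqrt (pi *+ 2) @[n --> \oo] --> Num.sqrt (pi *+ 2).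
  by move/fine_cvgP : H => [].
have -> : (fun n => rho (a + n.+1%:R)) =
    (fun n => rho (a + n.+1%:R) * Num.sqrt (pi *+ 2) / Num.sqrt (pi *+ 2)).
  by apply/funext => n; rewrite mulfK// gt_eqF.
have e : Num.sqrt (pi *+ 2) / Num.sqrt (pi *+ 2) = 1 :> R by rewrite mulfV// gt_eqF.
rewrite -[X in _ --> X]e.
by apply: cvgM => //; exact: cvg_cst.
Qed.

(* [rho (a + n) -> 1], and the corrections along the way telescope in [1 / a - 1 / (a + n)]. *)
Lemma stirling a : 0 < a -> 1 <= rho a <= expR (4^-1 * a^-1).
Proof.
move=> a0; have rc := cvg_rho a0.
apply/andP; split.
  apply: (ler_cvg_to rc (cvg_cst _)); apply: nearW => n.
  by have /andP[] := rho_shift n.+1 a0.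
have up : rho (a + n.+1%:R) * expR (4^-1 * a^-1) @[n --> \oo] --> 1 * expR (4^-1 * a^-1).
  by apply: cvgM => //; exact: cvg_cst.
rewrite -[leRHS]mul1r; apply: (ler_cvg_to (cvg_cst _) up).
apply: nearW => n; have /andP[_ /le_trans] := rho_shift n.+1 a0; apply.
have an0 : 0 < a + n.+1%:R by rewrite addr_gt0.
rewrite ler_wpM2l ?rho_ge0// ler_expR ler_wpM2l//.
by rewrite gerBl invr_ge0 ltW.
Qed.

End stirling.

(** * Dirichlet integrals *)

Section dirichlet.
Context {R : realType}.
Notation leb := (@lebesgue_measure R).

Lemma Gam_gt0 (a : R) : 0 < a -> 0 < Gam a.
Proof.
move=> a0; have /andP[r1 _] := stirling a0.
have : 0 < rho a by exact: lt_le_trans r1.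
rewrite /rho -mulrA pmulr_lgt0// divr_gt0 ?expR_gt0//.
by rewrite sqrtr_gt0 mulrn_wgt0// pi_gt0.
Qed.

(** [gamfun 1] is the standard exponential density in the variable s = log u. The formula presents
    e^{-w} as an average of indicators of w <= e^s. *)
Lemma exp_tail (w : R) : 0 < w ->
  (\int[leb]_s ((w <= expR s)%R%:R * gamfun 1 s)%:E = (expR (- w))%:E)%E.
Proof.
move=> w0.
have -> : (\int[leb]_s ((w <= expR s)%R%:R * gamfun 1 s)%:E =
    \int[leb]_(s in `[ln w, +oo[) (gamfun 1 s)%:E)%E.
  rewrite [RHS]integral_mkcond; apply: eq_integral => s _.
  have e : (w <= expR s) = (ln w <= s) by rewrite -{1}[w]lnK ?posrE// ler_expR.
  rewrite e patchE; case: ifPn => [/set_mem|/negP].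
    by rewrite /= in_itv/= andbT => ->; rewrite mul1r.
  move=> h; case: (ln w <= s) / idP => h2; last by rewrite mul0r.
  by case: h; apply/mem_set; rewrite /= in_itv/= andbT.
have dF (x : R) : is_derive x 1 (fun x => - expR (- expR x)) (gamfun 1 x).
  have d1 := @is_derive1_comp _ expR (fun x : R => - expR x) x _ _ (is_derive_expR _) (is_deriveN (is_derive_expR x)).
  apply: (is_derive_eq (is_deriveN d1)); rewrite /gamfun mul1r expRD /=; ring.
have cF : continuous (fun x : R => - expR (- expR x)).
  by move=> x; apply: differentiable_continuous; apply/derivable1_diffP/ex_derive.
rewrite (@ge0_continuous_FTC2y _ _ (fun x => - expR (- expR x)) _ 0).
- by rewrite lnK ?posrE// EFinN oppeK add0e.
- by move=> x _; exact: expR_ge0.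
- exact/continuous_subspaceT/continuous_gamfun.
- rewrite -[0]oppr0; apply: (@cvgN _ R^o).
  apply: (@squeeze_cvgr _ _ _ _ (cst 0) (fun x : R => x^-1)).
  + near=> x; rewrite expR_ge0/= expRN lef_pV2 ?posrE ?expR_gt0//.
    apply: le_trans (expR_ge1Dx _); apply: le_trans (_ : x <= expR x) _.
      by apply: le_trans (expR_ge1Dx _); lra.
    by rewrite lerDr.
  + exact: cvg_cst.
  + by apply/gtr0_cvgV0; [near=> x|exact: cvg_id].
- by move=> x _; exact: ex_derive.
- by apply: cvg_at_right_filter; exact: cF.
- by move=> x _; rewrite derive1E derive_val.
Unshelve. all: end_near. Qed.

Definition sumexp m (t : m.-tuple R) : R := \sum_(i < m) expR (tnth t i).

Definition expdot m (a : 'I_m -> R) (t : m.-tuple R) : R :=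
  expR (\sum_(i < m) a i * tnth t i).

Definition shift_tuple m (s : R) (t : m.-tuple R) : m.-tuple R :=
  [tuple of map (fun x => x + s) t].

Lemma sumexp_shift m s (t : m.-tuple R) : sumexp (shift_tuple s t) = expR s * sumexp t.
Proof.
rewrite /sumexp mulr_sumr; apply: eq_bigr => i _.
by rewrite tnth_map expRD mulrC.
Qed.

Lemma expdot_shift m (a : 'I_m -> R) s (t : m.-tuple R) :
  expdot a (shift_tuple s t) = expR ((\sum_i a i) * s) * expdot a t.
Proof.
rewrite /expdot -expRD; congr expR; rewrite mulr_suml -big_split/=.
by apply: eq_bigr => i _; rewrite tnth_map; ring.
Qed.

Lemma sumexp_gt0 m (t : m.+1.-tuple R) : 0 < sumexp t.
Proof.
by rewrite /sumexp big_ord_recl ltr_pwDl ?expR_gt0// sumr_ge0// => i _; exact: expR_ge0.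
Qed.

Lemma measurable_sumexp m : measurable_fun setT (@sumexp m).
Proof.
by apply: measurable_sum => i; apply: measurableT_comp => //; exact: measurable_tnth.
Qed.

Lemma measurable_expdot m (a : 'I_m -> R) : measurable_fun setT (expdot a).
Proof.
apply: measurableT_comp => //; apply: measurable_sum => i.
by apply: measurable_funM => //; exact: measurable_tnth.
Qed.

Lemma measurable_ler d (T : measurableType d) (f g : T -> R) :
  measurable_fun setT f -> measurable_fun setT g ->
  measurable_fun setT (fun z => (f z <= g z)%R%:R : R).
Proof.
move=> mf mg; rewrite (_ : (fun z => _) = (\1_[set z | f z <= g z] : T -> R)).
  apply: measurable_indic.
  have := (measurable_funB mg mf) measurableT _ (measurable_itv `[0, +oo[).
  rewrite setTI; congr measurable; apply/seteqP; split => z /=;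
    by rewrite in_itv/= andbT subr_ge0.
by apply/funext => z; rewrite indicE; congr (nat_of_bool _)%:R;
  apply/idP/idP => [h|/set_mem]; rewrite ?inE.
Qed.

(** In the variables u_k = e^{v_k}: the integral of [f] over the solid simplex against the weight
    prod u_k^(a_k - 1). *)
Definition dirint m (a : 'I_m -> R) (f : m.-tuple R -> R) : \bar R :=
  lint (fun t => (expdot a t * (sumexp t <= 1)%R%:R * f t)%:E).

Lemma measurable_dirint m (a : 'I_m -> R) (f : m.-tuple R -> R) :
  measurable_fun setT f ->
  measurable_fun setT (fun t => (expdot a t * (sumexp t <= 1)%R%:R * f t)%:E).
Proof.
move=> mf; apply/measurable_EFinP; apply: measurable_funM => //.
apply: measurable_funM; first exact: measurable_expdot.
by apply: measurable_ler => //; exact: measurable_sumexp.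
Qed.

Definition Dir m (a : 'I_m -> R) : R := (\prod_i Gam (a i)) / Gam (\sum_i a i + 1).

(** In the product of Euler integrals, [exp_tail] replaces e^{- sum} by an average over s of
    indicators of sum <= e^s. Exchanging the integrals and shifting all coordinates by s turns the
    product into [dirint a 1] times Gam (S + 1). That factor is positive, so an infinite [dirint]
    would contradict the finite product. *)
Lemma dirint1 m (a : 'I_m.+1 -> R) : (forall i, 0 < a i) ->
  dirint a (fun=> 1) = (Dir a)%:E.
Proof.
move=> a0.
have S0 : 0 < \sum_i a i.
  by rewrite big_ord_recl ltr_pwDl// sumr_ge0// => i _; exact: ltW.
have P : lint (fun t : m.+1.-tuple R => (expdot a t * expR (- sumexp t))%:E) =
    (\prod_i Gam (a i))%:E.
  rewrite -(@lint_prod _ _ (fun i => gamfun (a i))).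
  - apply: eq_lint => t; congr EFin; rewrite /expdot /sumexp -expRD -sumrN -big_split/=.
    by rewrite expR_sum; apply: eq_bigr => i _; rewrite /gamfun mulrC.
  - by move=> i; exact: measurable_gamfun.
  - by move=> i x; exact: expR_ge0.
  - by move=> i; rewrite GamE.
pose f (st : R * m.+1.-tuple R) : \bar R :=
  ((sumexp st.2 <= expR st.1)%R%:R * gamfun 1 st.1 * expdot a st.2)%:E.
have f0 st : (0 <= f st)%E.
  by rewrite lee_fin mulr_ge0 ?expR_ge0// mulr_ge0 ?expR_ge0// ler0n.
have mf : measurable_fun setT f.
  apply/measurable_EFinP; apply: measurable_funM; last first.
    exact: (measurableT_comp (measurable_expdot a)).
  apply: measurable_funM; last exact: (measurableT_comp (measurable_gamfun 1)).
  apply: measurable_ler; first exact: (measurableT_comp (@measurable_sumexp m.+1)).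
  exact: measurableT_comp.
have exch := @lint_exchange R m.+1 _ (measurableTypeR R) leb f mf f0.
have E1 : lint (fun t => (\int[leb]_s f (s, t))%E) = (\prod_i Gam (a i))%:E.
  rewrite -P; apply: eq_lint => t; rewrite /f/=.
  have me : measurable_fun setT (fun s : R => ((sumexp t <= expR s)%R%:R * gamfun 1 s)%:E).
    apply/measurable_EFinP; apply: measurable_funM; last exact: measurable_gamfun.
    exact: measurable_ler.
  under eq_integral do rewrite EFinM.
  transitivity ((\int[leb]_s ((sumexp t <= expR s)%R%:R * gamfun 1 s)%:E) * (expdot a t)%:E)%E.
    apply: (@ge0_integralZr _ (measurableTypeR R) R leb setT measurableT _ me) => //.
    by move=> s _; rewrite lee_fin mulr_ge0 ?expR_ge0// ler0n.
    by rewrite lee_fin expR_ge0.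
  by rewrite exp_tail ?sumexp_gt0// -EFinM mulrC.
have E2 : (\int[leb]_s lint (fun t => f (s, t)) = (Gam (\sum_i a i + 1))%:E * dirint a (fun=> 1%R))%E.
  rewrite -GamE; last by rewrite addr_gt0.
  have mg : measurable_fun setT (fun s => (gamfun (\sum_i a i + 1) s)%:E).
    by apply/measurable_EFinP; exact: measurable_gamfun.
  transitivity (\int[leb]_s ((gamfun (\sum_i a i + 1) s)%:E * dirint a (fun=> 1%R)))%E.
    apply: eq_integral => s _.
    have mfs : measurable_fun setT (fun t => f (s, t)).
      by apply: (measurableT_comp mf); exact: pair1_measurable.
    rewrite -(lint_shift s mfs)//.
    rewrite /dirint -ge0_lintZl ?expR_ge0//.
    - apply: eq_lint => t; rewrite /f/= -EFinM; congr EFin.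
      rewrite -/(shift_tuple s t) sumexp_shift expdot_shift ger_pMr ?expR_gt0//.
      rewrite /gamfun; set S := \sum_i a i.
      have -> : (S + 1) * s - expR s = S * s + (1 * s - expR s) by ring.
      by rewrite [expR (_ + (1 * s - _))]expRD; ring.
    - by apply: measurable_dirint; exact: measurable_cst.
    - by move=> t; rewrite lee_fin mulr1 mulr_ge0 ?expR_ge0// ler0n.
  apply: (@ge0_integralZr _ (measurableTypeR R) R leb setT measurableT _ mg) => //.
    by move=> s _; rewrite lee_fin expR_ge0.
  apply: lint_ge0 => t; by rewrite lee_fin mulr1 mulr_ge0 ?expR_ge0// ler0n.
move: exch; rewrite E1 E2.
have g0 : 0 < Gam (\sum_i a i + 1) by apply: Gam_gt0; rewrite addr_gt0.
case: (dirint _ _) => [r| |].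
- rewrite -EFinM => -[] e; congr EFin; rewrite /Dir -e mulrAC mulfV ?mul1r// gt_eqF//.
- by rewrite gt0_muley ?lte_fin.
- by rewrite gt0_muleNy ?lte_fin.
Qed.

End dirichlet.

(** * Exponential moments of the Dirichlet weight *)

Section dirichlet_moments.
Context {R : realType}.

Lemma sum_gt0 m (a : 'I_m.+1 -> R) : (forall i, 0 < a i) -> 0 < \sum_i a i.
Proof.
by move=> a0; rewrite big_ord_recl ltr_pwDl// sumr_ge0// => i _; exact: ltW.
Qed.

Lemma Dir_gt0 m (a : 'I_m.+1 -> R) : (forall i, 0 < a i) -> 0 < Dir a.
Proof.
move=> a0; rewrite /Dir divr_gt0//; first by apply: prodr_gt0 => i _; exact: Gam_gt0.
by apply: Gam_gt0; rewrite addr_gt0// sum_gt0.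
Qed.

Definition addk m (a : 'I_m -> R) (k : 'I_m) (e : R) : 'I_m -> R :=
  fun i => if i == k then a i + e else a i.

Lemma sum_addk m (a : 'I_m -> R) k e : \sum_i addk a k e i = \sum_i a i + e.
Proof.
rewrite (bigD1 k)//= [in RHS](bigD1 k)//= {1}/addk eqxx addrAC; congr (_ + _ + _).
by apply: eq_bigr => i /negPf ik; rewrite /addk ik.
Qed.

Lemma addk_gt0 m (a : 'I_m -> R) k e : (forall i, 0 < a i) -> 0 < a k + e ->
  forall i, 0 < addk a k e i.
Proof. by move=> a0 ak i; rewrite /addk; case: eqP => // ->. Qed.

Lemma addkK m (a : 'I_m -> R) k e : addk (addk a k (- e)) k e = a.
Proof. by apply/funext => i; rewrite /addk; case: eqP => // _; rewrite subrK. Qed.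

Lemma Dir_addk m (a : 'I_m.+1 -> R) k : (forall i, 0 < a i) ->
  Dir (addk a k 1) = Dir a * (a k / (\sum_i a i + 1)).
Proof.
move=> a0; have S0 := sum_gt0 a0.
have S1 : 0 < \sum_i a i + 1 by rewrite addr_gt0.
rewrite /Dir sum_addk (GamS S1) (bigD1 k)//= [in RHS](bigD1 k)//= {1}/addk eqxx GamS//.
rewrite (eq_bigr (fun i => Gam (a i))); last by move=> i /negPf ik; rewrite /addk ik.
by field; rewrite !gt_eqF// Gam_gt0.
Qed.

Lemma expdot_addk m (a : 'I_m -> R) k e (t : m.-tuple R) :
  expdot a t * expR (e * tnth t k) = expdot (addk a k e) t.
Proof.
rewrite /expdot -expRD; congr expR.
rewrite (bigD1 k)//= [in RHS](bigD1 k)//= {1}/addk eqxx mulrDl addrAC; congr (_ + _ + _).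
by apply: eq_bigr => i /negPf ik; rewrite /addk ik.
Qed.

(** The factor e^{e v_k} just moves the k-th parameter by [e]; for e = 1 and e = -1 the functional
    equation of Gamma makes the moment rational in the parameters. *)
Lemma dirint_expk m (a : 'I_m.+1 -> R) k e : (forall i, 0 < a i) -> 0 < a k + e ->
  dirint a (fun t => expR (e * tnth t k)) = (Dir (addk a k e))%:E.
Proof.
move=> a0 ak; rewrite -dirint1; last exact: addk_gt0.
by apply: eq_lint => t; rewrite mulr1 -expdot_addk; congr EFin; ring.
Qed.

Lemma dirint_ge0 m (a : 'I_m -> R) (f : m.-tuple R -> R) :
  (forall t, 0 <= f t) -> (0 <= dirint a f)%E.
Proof.
by move=> f0; apply: lint_ge0 => t; rewrite lee_fin !mulr_ge0 ?expR_ge0.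
Qed.

Lemma dirintD m (a : 'I_m -> R) (f g : m.-tuple R -> R) :
  measurable_fun setT f -> measurable_fun setT g ->
  (forall t, 0 <= f t) -> (forall t, 0 <= g t) ->
  dirint a (fun t => f t + g t) = (dirint a f + dirint a g)%E.
Proof.
move=> mf mg f0 g0; rewrite /dirint -ge0_lintD.
- by apply: eq_lint => t; rewrite -EFinD mulrDr.
- exact: measurable_dirint.
- exact: measurable_dirint.
- by move=> t; rewrite lee_fin !mulr_ge0 ?expR_ge0.
- by move=> t; rewrite lee_fin !mulr_ge0 ?expR_ge0.
Qed.

Lemma dirintZ m (a : 'I_m -> R) (f : m.-tuple R -> R) k :
  measurable_fun setT f -> (forall t, 0 <= f t) -> 0 <= k ->
  dirint a (fun t => k * f t) = (k%:E * dirint a f)%E.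
Proof.
move=> mf f0 k0; rewrite /dirint -ge0_lintZl//.
- by apply: eq_lint => t; rewrite -EFinM; congr EFin; ring.
- exact: measurable_dirint.
- by move=> t; rewrite lee_fin !mulr_ge0 ?expR_ge0.
Qed.

Lemma le_dirint m (a : 'I_m -> R) (f g : m.-tuple R -> R) :
  measurable_fun setT f -> measurable_fun setT g ->
  (forall t, 0 <= f t) -> (forall t, f t <= g t) ->
  (dirint a f <= dirint a g)%E.
Proof.
move=> mf mg f0 fg; apply: ge0_le_lint.
- exact: measurable_dirint.
- exact: measurable_dirint.
- by move=> t; rewrite lee_fin !mulr_ge0 ?expR_ge0.
- by move=> t; rewrite lee_fin ler_wpM2l// mulr_ge0 ?expR_ge0.
Qed.

Lemma dirint_sum m (a : 'I_m.+1 -> R) n (f : 'I_n -> m.+1.-tuple R -> R) (c : 'I_n -> R) :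
  (forall k, measurable_fun setT (f k)) -> (forall k t, 0 <= f k t) ->
  (forall k, dirint a (f k) = (c k)%:E) ->
  dirint a (fun t => \sum_k f k t) = (\sum_k c k)%:E.
Proof.
elim: n f c => [|n IH] f c mf f0 fc.
  rewrite big_ord0.
  transitivity (dirint a (fun t => 0 * 1)).
    by apply: eq_lint => t; rewrite big_ord0 mul0r.
  by rewrite dirintZ ?mul0e.
rewrite big_ord_recl EFinD -(fc ord0) -(IH (fun k => f (lift ord0 k)) _)//.
rewrite -dirintD//.
- by apply: eq_lint => t; rewrite big_ord_recl.
- by apply: measurable_sum => k; exact: mf.
- by move=> t; exact: sumr_ge0.
Qed.

Lemma measurable_expk m (e : R) (k : 'I_m) :
  measurable_fun setT (fun t : m.-tuple R => expR (e * tnth t k)).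
Proof.
apply: measurableT_comp => //; apply: measurable_funM => //; exact: measurable_tnth.
Qed.

(** The condition 1 < a i makes the moments of e^{- v_i} finite. *)
Lemma dirint_lin m (a : 'I_m.+1 -> R) (c : R) (b b' : 'I_m.+1 -> R) :
  (forall i, 1 < a i) -> 0 <= c -> (forall i, 0 <= b i) -> (forall i, 0 <= b' i) ->
  dirint a (fun t => c + \sum_k b k * expR (1 * tnth t k) + \sum_k b' k * expR (- 1 * tnth t k)) =
  (Dir a * (c + \sum_k b k * (a k / (\sum_i a i + 1)) +
           \sum_k b' k * ((\sum_i a i) / (a k - 1))))%:E.
Proof.
move=> a1 c0 b0 b'0.
have a0 i : 0 < a i by exact: lt_trans (a1 i).
have mk e (bb : 'I_m.+1 -> R) k :
    measurable_fun setT (fun t : m.+1.-tuple R => bb k * expR (e * tnth t k)).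
  by apply: measurable_funM => //; exact: measurable_expk.
have mc : measurable_fun setT (fun t : m.+1.-tuple R => c * 1) by exact: measurable_cst.
have S1 : dirint a (fun t => \sum_k b k * expR (1 * tnth t k)) =
    (\sum_k b k * (Dir a * (a k / (\sum_i a i + 1))))%:E.
  apply: dirint_sum; [exact: mk|by move=> k t; rewrite mulr_ge0 ?expR_ge0|move=> k].
  rewrite dirintZ//; last exact: measurable_expk.
  by rewrite dirint_expk ?addr_gt0// Dir_addk.
have S2 : dirint a (fun t => \sum_k b' k * expR (- 1 * tnth t k)) =
    (\sum_k b' k * (Dir a * ((\sum_i a i) / (a k - 1))))%:E.
  apply: dirint_sum; [exact: mk|by move=> k t; rewrite mulr_ge0 ?expR_ge0|move=> k].
  rewrite dirintZ//; last exact: measurable_expk.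
  have ak : 0 < a k - 1 by rewrite subr_gt0.
  rewrite dirint_expk//; congr (_ * _)%:E.
  (* The moment of order -1 is the first moment read backwards from the lowered parameter. *)
  have := @Dir_addk _ (addk a k (-1)) k (addk_gt0 a0 ak).
  rewrite addkK sum_addk subrK {2}/addk eqxx => ->.
  have S0 := sum_gt0 a0.
  by field; rewrite !gt_eqF.
rewrite dirintD; first rewrite dirintD; first rewrite S1 S2.
- rewrite (_ : (fun=> c) = (fun t => c * 1)); last by apply/funext => t; rewrite mulr1.
  rewrite dirintZ// dirint1// -EFinM -!EFinD; congr EFin.
  by rewrite !mulrDr !mulr_sumr; congr (_ + _ + _); [ring|..];
    apply: eq_bigr => k _; ring.
- exact: measurable_cst.
- by apply: measurable_sum => k; exact: mk.
- by [].
- by move=> t; apply: sumr_ge0 => k _; rewrite mulr_ge0 ?expR_ge0.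
- by apply: measurable_funD; [exact: measurable_cst|apply: measurable_sum => k; exact: mk].
- by apply: measurable_sum => k; exact: mk.
- by move=> t; rewrite addr_ge0//; apply: sumr_ge0 => k _; rewrite mulr_ge0 ?expR_ge0.
- by move=> t; apply: sumr_ge0 => k _; rewrite mulr_ge0 ?expR_ge0.
Qed.

End dirichlet_moments.

(** * The Laplace step: integrating a first-order expansion *)

Section laplace_bound.
Context {R : realType}.

(* Both halves of the absolute value are rearranged into inequalities between nonnegative functions
   before they are integrated, since [dirint] is an extended-real integral. *)
Lemma laplace_bound m (a p d : 'I_m.+1 -> R) (g : m.+1.-tuple R -> R) (g0 K : R) :
  (forall i, 1 < a i) -> (forall i, 0 < p i) -> 0 <= g0 -> 0 <= K ->
  measurable_fun setT g -> (forall t, 0 <= g t <= 1) ->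
  (forall t, `|g t - (g0 - \sum_k d k * (expR (tnth t k) / p k - 1))| <=
    K * \sum_k (expR (tnth t k) / p k + p k * expR (- tnth t k) - 2)) ->
  exists G, dirint a g = G%:E /\
    `|G - Dir a * (g0 - \sum_k d k * (a k / (\sum_i a i + 1) / p k - 1))| <=
    Dir a * (K * \sum_k (a k / (\sum_i a i + 1) / p k + p k * ((\sum_i a i) / (a k - 1)) - 2)).
Proof.
move=> a1 p0 g00 K0 mg g01 H.
have a0 i : 0 < a i by exact: lt_trans (a1 i).
have gg0 t : 0 <= g t by have /andP[] := g01 t.
pose D k := `|d k|.
pose lin c (b b' x y : 'I_m.+1 -> R) := c + \sum_k b k * x k + \sum_k b' k * y k.
pose tx (t : m.+1.-tuple R) k := expR (1 * tnth t k).
pose ty (t : m.+1.-tuple R) k := expR (- 1 * tnth t k).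
pose ex k := a k / (\sum_i a i + 1).
pose ey k := (\sum_i a i) / (a k - 1).
(* Coefficients for the inequalities g + U1 <= U2 and L2 <= g + L1. Adding |d k| to both sides makes
   the coefficients of either sign nonnegative, and the constant -2 of the error term is carried
   across. *)
pose cU1 := \sum_k (D k + 2 * K).
pose bU1 k := D k / p k.
pose cU2 := g0 + \sum_k (D k + d k).
pose bU2 k := (D k - d k + K) / p k.
pose bK k := K * p k.
pose cL1 := \sum_k D k.
pose bL1 k := (D k + K) / p k.
pose cL2 := g0 + \sum_k (D k + d k + 2 * K).
pose bL2 k := (D k - d k) / p k.
have D0 k : 0 <= D k by exact: normr_ge0.
have Dd k : 0 <= D k - d k by rewrite subr_ge0 ler_norm.
have Dd' k : 0 <= D k + d k by rewrite -lerBlDr sub0r /D -normrN ler_norm.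
have cU10 : 0 <= cU1 by apply: sumr_ge0 => k _; rewrite addr_ge0// mulr_ge0.
have cU20 : 0 <= cU2 by apply: addr_ge0 => //; apply: sumr_ge0.
have cL10 : 0 <= cL1 by apply: sumr_ge0.
have cL20 : 0 <= cL2.
  by apply: addr_ge0 => //; apply: sumr_ge0 => k _; rewrite addr_ge0// mulr_ge0.
have pi0 k : 0 <= (p k)^-1 by rewrite invr_ge0 ltW.
have bU10 k : 0 <= bU1 k by exact: mulr_ge0.
have bU20 k : 0 <= bU2 k by apply: mulr_ge0 => //; exact: addr_ge0.
have bL10 k : 0 <= bL1 k by apply: mulr_ge0 => //; exact: addr_ge0.
have bL20 k : 0 <= bL2 k by exact: mulr_ge0.
have bK0 k : 0 <= bK k by rewrite mulr_ge0// ltW.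
pose main x := g0 - \sum_k d k * (x k / p k - 1).
pose err (x y : 'I_m.+1 -> R) := K * \sum_k (x k / p k + p k * y k - 2).
have lin1 c b x y : lin c b (fun=> 0) x y = c + \sum_k b k * x k.
  by rewrite /lin [X in _ + X]big1 ?addr0// => k _; rewrite mul0r.
have EU x y : lin cU2 bU2 bK x y - lin cU1 bU1 (fun=> 0) x y = main x + err x y.
  rewrite lin1 /lin /cU2 /cU1 /main /err mulr_sumr.
  rewrite !opprD !addrA -!sumrN addrAC -!addrA; congr (_ + _).
  rewrite -!big_split/=; apply: eq_bigr => k _; rewrite /bU1 /bU2 /bK; ring.
have EL x y : lin cL2 bL2 (fun=> 0) x y - lin cL1 bL1 bK x y = main x - err x y.
  rewrite lin1 /lin /cL2 /cL1 /main /err mulr_sumr.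
  rewrite !opprD !addrA -!sumrN -!addrA; congr (_ + _).
  rewrite -!big_split/=; apply: eq_bigr => k _; rewrite /bL1 /bL2 /bK; ring.
have Hb t : g t + lin cU1 bU1 (fun=> 0) (tx t) (ty t) <= lin cU2 bU2 bK (tx t) (ty t) /\
    lin cL2 bL2 (fun=> 0) (tx t) (ty t) <= g t + lin cL1 bL1 bK (tx t) (ty t).
  have := H t; rewrite -/(main (fun k => expR (tnth t k))).
  rewrite -/(err (fun k => expR (tnth t k)) (fun k => expR (- tnth t k))).
  have -> : (fun k => expR (tnth t k)) = tx t by apply/funext => k; rewrite /tx mul1r.
  have -> : (fun k => expR (- tnth t k)) = ty t by apply/funext => k; rewrite /ty mulN1r.
  rewrite ler_distl => /andP[h1 h2]; split.
    by rewrite -lerBrDr EU.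
  by rewrite -lerBlDr EL.
have z0 (k : 'I_m.+1) : 0 <= (0 : R) by [].
have mlin c b b' : measurable_fun setT (fun t => lin c b b' (tx t) (ty t)).
  apply: measurable_funD; first apply: measurable_funD => //;
    by apply: measurable_sum => k; apply: measurable_funM => //; exact: measurable_expk.
have lin0 c b b' t : 0 <= c -> (forall k, 0 <= b k) -> (forall k, 0 <= b' k) ->
    0 <= lin c b b' (tx t) (ty t).
  by move=> c0 b0 b'0; rewrite !addr_ge0// sumr_ge0// => k _; rewrite mulr_ge0 ?expR_ge0.
have dlin c b b' : 0 <= c -> (forall k, 0 <= b k) -> (forall k, 0 <= b' k) ->
    dirint a (fun t => lin c b b' (tx t) (ty t)) = (Dir a * lin c b b' ex ey)%:E.
  by move=> c0 b0 b'0; exact: dirint_lin.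
have [G Ge] : exists G, dirint a g = G%:E.
  have : (0 <= dirint a g <= (Dir a)%:E)%E.
    rewrite dirint_ge0//= -dirint1//; apply: le_dirint => // t.
    by have /andP[] := g01 t.
  case: (dirint a g) => [G _| |]; first by exists G.
    by rewrite leye_eq andbF.
  by rewrite leeNy_eq.
exists G; split => //.
have U : G + Dir a * lin cU1 bU1 (fun=> 0) ex ey <= Dir a * lin cU2 bU2 bK ex ey.
  rewrite -lee_fin EFinD -Ge -!dlin// -dirintD//; last by move=> t; exact: lin0.
  apply: le_dirint => //.
  - exact: measurable_funD.
  - by move=> t; rewrite addr_ge0// lin0.
  - by move=> t; have [] := Hb t.
have L : Dir a * lin cL2 bL2 (fun=> 0) ex ey <= G + Dir a * lin cL1 bL1 bK ex ey.
  rewrite -lee_fin EFinD -Ge -!dlin// -dirintD//; last by move=> t; exact: lin0.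
  apply: le_dirint => //.
  - exact: measurable_funD.
  - by move=> t; exact: lin0.
  - by move=> t; have [] := Hb t.
rewrite -/(main ex) -/(err ex ey) ler_distl; apply/andP; split.
  by rewrite -mulrBr -EL mulrBr lerBlDr.
by rewrite -mulrDr -EU mulrBr lerBrDr.
Qed.

End laplace_bound.

(** * First-order expansion of a Gaussian in exponential coordinates *)

Section gauss_expansion.
Context {R : realType}.

Lemma dbl_sum_le m (M : 'I_m -> 'I_m -> R) (h : 'I_m -> R) :
  `|\sum_i \sum_j M i j * (h i * h j)| <=
  (\sum_i \sum_j `|M i j|) * \sum_k h k ^+ 2.
Proof.
apply: le_trans (ler_norm_sum _ _ _) _; rewrite mulr_suml; apply: ler_sum => i _.
apply: le_trans (ler_norm_sum _ _ _) _; rewrite mulr_suml; apply: ler_sum => j _.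
rewrite normrM ler_wpM2l// normrM.
have le k : h k ^+ 2 <= \sum_k h k ^+ 2.
  by rewrite (bigD1 k)//= lerDl sumr_ge0// => l _; exact: sqr_ge0.
have : 2 * (`|h i| * `|h j|) <= `|h i| ^+ 2 + `|h j| ^+ 2.
  by rewrite -subr_ge0 (_ : _ - _ = (`|h i| - `|h j|) ^+ 2) ?sqr_ge0//; ring.
rewrite !real_normK ?num_real//; have := le i; have := le j; lra.
Qed.

Lemma qmxE m (A : 'M[R]_m) (t : 'rV[R]_m) :
  qmx A t = \sum_i \sum_j A i j * (t 0 i * t 0 j).
Proof.
rewrite /qmx mxE exchange_big/=; apply: eq_bigr => j _.
by rewrite !mxE big_distrl/=; apply: eq_bigr => i _; ring.
Qed.

Lemma dotv_sqr m (b t : 'rV[R]_m) :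
  dotv b t ^+ 2 = \sum_i \sum_j (b 0 i * b 0 j) * (t 0 i * t 0 j).
Proof.
rewrite expr2 dotvE big_distrl/=; apply: eq_bigr => i _.
by rewrite big_distrr/=; apply: eq_bigr => j _; ring.
Qed.

Lemma qmxD m (A : 'M[R]_m) (s t : 'rV[R]_m) : A^T = A ->
  qmx A (s + t) = qmx A s + 2 * dotv (s *m A) t + qmx A t.
Proof.
move=> sA; rewrite /qmx /dotv linearD/= !(mulmxDl, mulmxDr) !mxE.
have -> : (\sum_j (t *m A) 0 j * s^T j 0) = \sum_j (s *m A) 0 j * t^T j 0.
  transitivity ((t *m A *m s^T) 0 0); first by rewrite mxE.
  transitivity ((s *m A *m t^T) 0 0); last by rewrite mxE.
  have -> : t *m A *m s^T = (s *m A *m t^T)^T by rewrite !trmx_mul sA trmxK mulmxA.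
  by rewrite mxE.
ring.
Qed.

(** Trades a square, whose Dirichlet integral is not a quotient of Gammas, for exponentials, whose
    integrals are. *)
Lemma sqr_le_cosh (h : R) : h ^+ 2 <= expR h + expR (- h) - 2.
Proof.
wlog h0 : h / 0 <= h.
  move=> W; case: (lerP 0 h) => [|/ltW] h0; first exact: W.
  by have := W (- h); rewrite oppr_ge0 sqrrN opprK (addrC (expR (- h))); exact.
rewrite -subr_ge0 (_ : h ^+ 2 = 2 * h ^+ 2 / 2); last by field.
apply: (@ge0_of_derive R (fun x => expR x + expR (- x) - 2 - 2 * x ^+ 2 / 2)
  (fun x => expR x - expR (- x) - 2 * x)).
- move=> x.
  have d1 := is_derive1_comp (is_derive_expR (- x)) (is_deriveN (is_derive_id x (1 : R))).
  have d3 := is_deriveB (is_deriveD (is_derive_expR x) d1) (is_derive_cst (2 : R) x 1).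
  have d4 := is_deriveB d3 (is_derive_sqr_half (2 : R) x).
  apply: (is_derive_eq d4); rewrite /GRing.scale/=; ring.
- by rewrite oppr0 expR0 expr0n/=; ring.
- move=> x xh _; have x0 : 0 <= x.
    case: (ltrP x 0) => // x0; have : x * h <= 0 by rewrite nmulr_rle0.
    by rewrite leNgt xh.
  by rewrite mulr_ge0// subr_ge0; exact: sinh_ge.
Qed.

Lemma psi_le_cosh (h : R) : psi h <= expR h + expR (- h) - 2.
Proof. by have := psi_ge0 (- h); rewrite /psi; lra. Qed.

(** With h = t - u, the ratio g t / g u is exp (- b.h - q(h) / 2). Replacing each h_k by e^{h_k} - 1
    costs psi(h_k). The quadratic error bound is global because positivity of the form bounds the
    ratio by e^{c0}. *)
Lemma gauss_expansion m (A : 'M[R]_m) (mu u : 'rV[R]_m) : A^T = A ->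
  (forall t, 0 <= qmx A t) ->
  exists K : R, 0 <= K /\ forall t : 'rV[R]_m,
  let g s := expR (- (qmx A (s - mu) / 2)) in
  `|g t - (g u - \sum_k (g u * ((u - mu) *m A) 0 k) * (expR (t 0 k - u 0 k) - 1))| <=
    K * \sum_k (expR (t 0 k - u 0 k) + expR (- (t 0 k - u 0 k)) - 2).
Proof.
move=> sA A0; set b := (u - mu) *m A.
pose g s := expR (- (qmx A (s - mu) / 2)).
pose C1 := \sum_i \sum_j `|A i j|.
pose C2 := \sum_i \sum_j `|b 0 i * b 0 j|.
pose C3 := \sum_i `|b 0 i|.
pose c0 := qmx A (u - mu) / 2.
have C10 : 0 <= C1 by do 2![apply: sumr_ge0 => ? _].
have C20 : 0 <= C2 by do 2![apply: sumr_ge0 => ? _].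
have C30 : 0 <= C3 by apply: sumr_ge0 => ? _.
have c00 : 0 <= c0 by rewrite divr_ge0.
(* For |b.h| <= 1 the summand [expR 1] comes from [psi_le]; for larger values [expR c0] bounds the
   ratio and 1 pays for the linear term. *)
pose E := expR c0 + expR 1 + 1.
have E0 : 0 <= E by rewrite !addr_ge0 ?expR_ge0.
have gu0 : 0 <= g u by exact: expR_ge0.
exists (g u * (C1 + E * C2 + C3)); split.
  by rewrite mulr_ge0// !addr_ge0// mulr_ge0.
move=> t /=; rewrite -/(g t) -/(g u).
set h : 'rV[R]_m := t - u.
have hE k : t 0 k - u 0 k = h 0 k by rewrite !mxE.
pose N := \sum_k (expR (h 0 k) + expR (- h 0 k) - 2).
under [in leLHS]eq_bigr do rewrite hE; under [in leRHS]eq_bigr do rewrite hE.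
rewrite -/N.
have N2 : \sum_k h 0 k ^+ 2 <= N by apply: ler_sum => k _; exact: sqr_le_cosh.
have qh : qmx A h <= C1 * N.
  apply: le_trans (ler_wpM2l C10 N2); rewrite qmxE.
  by apply: le_trans (dbl_sum_le _ _); exact: ler_norm.
have bh : dotv b h ^+ 2 <= C2 * N.
  apply: le_trans (ler_wpM2l C20 N2); rewrite dotv_sqr.
  by apply: le_trans (dbl_sum_le (fun i j => b 0 i * b 0 j) _); exact: ler_norm.
have bp : `|\sum_k b 0 k * psi (h 0 k)| <= C3 * N.
  apply: le_trans (ler_norm_sum _ _ _) _; rewrite mulr_suml; apply: ler_sum => k _.
  rewrite normrM ler_wpM2l// ger0_norm ?psi_ge0//.
  apply: le_trans (psi_le_cosh _) _; rewrite /N (bigD1 k)//= lerDl sumr_ge0// => l _.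
  by apply: le_trans (sqr_le_cosh _); exact: sqr_ge0.
have gt : g t = g u * expR (- dotv b h - qmx A h / 2).
  rewrite /g -expRD; congr expR.
  have -> : t - mu = (u - mu) + h by rewrite /h [RHS]addrC addrA subrK.
  rewrite qmxD// -/b; by field.
have -> : g t - (g u - \sum_k g u * b 0 k * (expR (h 0 k) - 1)) =
    g u * (expR (- dotv b h - qmx A h / 2) - 1 + dotv b h + \sum_k b 0 k * psi (h 0 k)).
  rewrite gt dotvE.
  have -> : \sum_k g u * b 0 k * (expR (h 0 k) - 1) =
      g u * (\sum_i b 0 i * h 0 i + \sum_k b 0 k * psi (h 0 k)).
    by rewrite -big_split mulr_sumr; apply: eq_bigr => k _; rewrite /psi/=; ring.
  ring.
rewrite normrM (ger0_norm gu0) -mulrA ler_wpM2l// mulrDl.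
apply: le_trans (ler_normD _ _) _; apply: lerD => //.
rewrite mulrDl; set q := qmx A h in qh *; set y := dotv b h in bh *.
have q0 : 0 <= q by exact: A0.
rewrite ler_norml; apply/andP; split.
  have := expR_ge1Dx (- y - q / 2).
  have : 0 <= E * (C2 * N) by rewrite mulr_ge0//; apply: le_trans bh; exact: sqr_ge0.
  by lra.
have up : expR (- y - q / 2) - 1 + y <= E * y ^+ 2.
  have y20 := sqr_ge0 y.
  case: (lerP `|y| 1) => y1.
    have e1 : expR (- y - q / 2) <= expR (- y) by rewrite ler_expR; lra.
    have := psi_le (- y); rewrite /psi normrN sqrrN opprK.
    have : expR `|y| * y ^+ 2 <= expR 1 * y ^+ 2 by rewrite ler_wpM2r// ler_expR.
    have : 0 <= expR c0 * y ^+ 2 by rewrite mulr_ge0 ?expR_ge0.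
    have : 0 <= expR 1 * y ^+ 2 by rewrite mulr_ge0 ?expR_ge0.
    rewrite /E; lra.
  have y2 : 1 <= y ^+ 2.
    by rewrite -real_normK ?num_real// exprn_ege1// ltW.
  have yy : y <= y ^+ 2.
    apply: le_trans (ler_norm y) _; rewrite -real_normK ?num_real// expr2.
    by rewrite ler_peMl// ltW.
  have e2 : expR (- y - q / 2) <= expR c0.
    rewrite ler_expR; have : 0 <= qmx A ((u - mu) + h) by exact: A0.
    rewrite qmxD// -/b -/y -/q /c0; lra.
  have : expR c0 <= expR c0 * y ^+ 2 by rewrite ler_peMr ?expR_ge0.
  have : 0 <= expR 1 * y ^+ 2 by rewrite mulr_ge0 ?expR_ge0.
  rewrite /E; lra.
have : E * y ^+ 2 <= E * (C2 * N) by rewrite ler_wpM2l.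
have : 0 <= C1 * N by exact: le_trans qh.
lra.
Qed.

End gauss_expansion.

(** * Stirling asymptotics of the Dirichlet normalisation *)

Section dirichlet_asymptotics.
Context {R : realType}.

(** Stirling's main term of [Dir] at the parameters L A_k. Of the m factors sqrt (2 pi) in the
    numerator one cancels against the denominator, hence the power [m.-1]. *)
Definition dirmain m (A : 'I_m -> R) (L : R) : R :=
  Num.sqrt (pi *+ 2) ^+ m.-1 *
  expR (- ((1 + m%:R) / 2 * ln L) - L * \sum_k A k * ln ((\sum_i A i) / A k)
        - 2^-1 * \sum_k ln (A k) - 2^-1 * ln (\sum_i A i)).

Lemma dirmain_gt0 m (A : 'I_m -> R) L : 0 < dirmain A L.
Proof.
by rewrite mulr_gt0 ?expR_gt0// exprn_gt0// sqrtr_gt0 mulrn_wgt0// pi_gt0.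
Qed.

Lemma Gam_rho (a : R) : 0 < a ->
  Gam a = rho a * Num.sqrt (pi *+ 2) * expR ((a - 2^-1) * ln a - a).
Proof.
move=> a0; have s0 : Num.sqrt (pi *+ 2) != 0 :> R.
  by rewrite gt_eqF// sqrtr_gt0 mulrn_wgt0// pi_gt0.
rewrite /rho divfK// -mulrA -expRD.
by rewrite (_ : _ + _ = 0) ?expR0 ?mulr1//; ring.
Qed.

(** An exact identity: the whole error of Stirling's formula sits in the quotient of the [rho]. *)
Lemma Dir_rho m (A : 'I_m.+1 -> R) (L : R) : (forall k, 0 < A k) -> 0 < L ->
  Dir (fun k => L * A k) =
  (\prod_k rho (L * A k)) / rho (L * \sum_k A k) * dirmain A L.
Proof.
move=> A0 L0; have S0 := sum_gt0 A0; set S := \sum_i A i in S0 *.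
have LS0 : 0 < L * S by rewrite mulr_gt0.
have s0 : Num.sqrt (pi *+ 2) != 0 :> R.
  by rewrite gt_eqF// sqrtr_gt0 mulrn_wgt0// pi_gt0.
have r0 : rho (L * S) != 0.
  have /andP[r1 _] := stirling LS0; rewrite gt_eqF//; exact: lt_le_trans r1.
rewrite /Dir -mulr_sumr -/S GamS// Gam_rho//.
rewrite (eq_bigr (fun k => rho (L * A k) * (Num.sqrt (pi *+ 2) *
    expR ((L * A k - 2^-1) * ln (L * A k) - L * A k)))); last first.
  by move=> k _; rewrite Gam_rho ?mulr_gt0// mulrA.
rewrite big_split/=; set p := \prod_k rho _.
rewrite big_split/= prodr_const card_ord -expR_sum; set E1 := expR _; set E2 := expR _.
rewrite /dirmain -/S succnK; set E3 := expR _.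
have e : E1 = L * S * E2 * E3.
  rewrite -[L in L * S * E2]lnK ?posrE// -[S in expR _ * S]lnK ?posrE//.
  rewrite -!expRD; congr expR.
  have l k : ln (L * A k) = ln L + ln (A k) by rewrite lnM ?posrE.
  have l2 k : ln (S / A k) = ln S - ln (A k) by rewrite ln_div ?posrE.
  rewrite (lnM L0 S0); under eq_bigr do rewrite l.
  have -> : \sum_k A k * ln (S / A k) = S * ln S - \sum_k A k * ln (A k).
    by rewrite mulr_suml -sumrB; apply: eq_bigr => k _; rewrite l2 mulrBr.
  transitivity (L * ln L * S + (- 2^-1 * ln L) * m.+1%:R + L * (\sum_i A i * ln (A i)) -
      2^-1 * (\sum_i ln (A i)) - L * S).
    have -> : L * ln L * S = \sum_k L * ln L * A k by rewrite -mulr_sumr.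
    have -> : L * S = \sum_k L * A k by rewrite -mulr_sumr.
    have -> : - 2^-1 * ln L * m.+1%:R = \sum_(i < m.+1) (- 2^-1 * ln L).
      by rewrite sumr_const card_ord mulr_natr.
    rewrite !mulr_sumr -!sumrN -!big_split/=.
    apply: eq_bigr => i _.  ring.
  by rewrite -natr1; field.
rewrite e exprS.
by field; rewrite r0 s0 !gt_eqF//= ?mulr_gt0 ?expR_gt0.
Qed.

Lemma norm_sub1_le (r x y : R) : 0 <= x -> 0 <= y -> expR (- x) <= r <= expR y ->
  `|r - 1| <= x + y * expR y.
Proof.
move=> x0 y0 /andP[r1 r2]; have e1 := expR_ge1Dx (- x).
have e2 := expRB1_le y.
have : 0 <= y * expR y by rewrite mulr_ge0 ?expR_ge0.
rewrite ler_norml; lra.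
Qed.

Lemma Dir_asymp m (A : 'I_m.+1 -> R) : (forall k, 0 < A k) ->
  exists K : R, 0 <= K /\ forall L, 1 <= L ->
  `|Dir (fun k => L * A k) - dirmain A L| <= K / L * dirmain A L.
Proof.
move=> A0; have S0 := sum_gt0 A0; set S := \sum_i A i in S0.
pose c1 := 4^-1 * S^-1.
pose c2 := \sum_k 4^-1 * (A k)^-1.
have c10 : 0 <= c1 by rewrite mulr_ge0// invr_ge0 ltW.
have c20 : 0 <= c2 by apply: sumr_ge0 => k _; rewrite mulr_ge0// invr_ge0 ltW.
exists (c1 + c2 * expR c2); split; first by rewrite addr_ge0// mulr_ge0 ?expR_ge0.
move=> L L1; have L0 : 0 < L by exact: lt_le_trans L1.
rewrite Dir_rho// -/S; set r := _ / _.
rewrite -[X in _ - X]mul1r -mulrBl normrM (gtr0_norm (dirmain_gt0 _ _)).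
rewrite ler_wpM2r ?(ltW (dirmain_gt0 _ _))//.
have LS0 : 0 < L * S by rewrite mulr_gt0.
have /andP[s1 s2] := stirling LS0.
have sL0 : 0 < rho (L * S) by exact: lt_le_trans s1.
have p1 : 1 <= \prod_k rho (L * A k).
  have -> : 1 <= \prod_k rho (L * A k) = (\prod_(k < m.+1) 1 <= \prod_k rho (L * A k)).
    by rewrite [X in _ = (X <= _)]big1.
  apply: ler_prod => k _; rewrite ler01/=.
  by have /andP[] := stirling (mulr_gt0 L0 (A0 k)).
have p2 : \prod_k rho (L * A k) <= expR (c2 / L).
  rewrite /c2 mulr_suml expR_sum; apply: ler_prod => k _.
  have /andP[k1 k2] := stirling (mulr_gt0 L0 (A0 k)).
  rewrite (le_trans ler01 k1)/=; apply: le_trans k2 _.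
  by rewrite invfM (mulrC L^-1) mulrA.
have r12 : expR (- (c1 / L)) <= r <= expR (c2 / L).
  apply/andP; split.
    rewrite /r expRN; apply: le_trans (_ : (rho (L * S))^-1 <= _).
      rewrite lef_pV2 ?posrE ?expR_gt0//; apply: le_trans s2 _.
      by rewrite /c1 invfM (mulrC L^-1) mulrA.
    by rewrite ler_peMl// invr_ge0 ltW.
  apply: le_trans p2; rewrite /r ler_pdivrMr// ler_peMr//.
  exact: le_trans p1.
have c1L : 0 <= c1 / L by rewrite divr_ge0// ltW.
have c2L : 0 <= c2 / L by rewrite divr_ge0// ltW.
apply: le_trans (norm_sub1_le c1L c2L r12) _.
rewrite mulrDl lerD2l [leRHS]mulrAC ler_wpM2l// ler_expR.
by rewrite ler_pdivrMr// ler_peMr.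
Qed.

End dirichlet_asymptotics.

(** * Asymptotics of the Gaussian integral over a small sum of exponentials *)

Section gauss_sum_asymp.
Context {R : realType}.

Definition rowsum m (A : 'M[R]_m) (k : 'I_m) : R := \sum_j A k j.

Definition logfrac m (A : 'M[R]_m) : 'rV[R]_m :=
  \row_k ln (rowsum A k / \sum_i rowsum A i).

(** Three factors: the Gaussian frozen at the concentration point, the exponential produced by the
    shift by [L], and Stirling's term. *)
Definition gmain m (mu : 'rV[R]_m) (B : 'M[R]_m) (L : R) : R :=
  let A := invmx B in
  gdens mu B (logfrac A) *
  expR (- (2^-1 * (\sum_k rowsum A k) * L ^+ 2) - L * \sum_k rowsum A k * mu 0 k) *
  dirmain (rowsum A) L.

Lemma posdef_inv_sym m (B : 'M[R]_m) : posdefmx B -> (invmx B)^T = invmx B.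
Proof. by move=> [sB _]; rewrite trmx_inv sB. Qed.

Lemma posdef_inv_ge0 m (B : 'M[R]_m) t : posdefmx B -> 0 <= qmx (invmx B) t.
Proof.
move=> pB; have uB := posdef_unit pB.
have -> : qmx (invmx B) t = qmx B (t *m invmx B).
  by rewrite /qmx trmx_mul (posdef_inv_sym pB) -[t *m _ *m B]mulmxA mulVmx// mulmx1 mulmxA.
by have [->|n0] := eqVneq (t *m invmx B) 0; [rewrite qmx0|rewrite ltW// pB.2].
Qed.

(** Expanding the square, the cross term with the constant vector - L is linear in [t]; its
    coefficients, L times the row sums of the inverse covariance, become the Dirichlet
    parameters. *)
Lemma gdens_shift m (mu : 'rV[R]_m) (B : 'M[R]_m) L (t : m.-tuple R) : posdefmx B ->
  gdens mu B (rowt (shift_tuple (- L) t)) =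
  gdens mu B (rowt t) *
  expR (- (2^-1 * (\sum_k rowsum (invmx B) k) * L ^+ 2) - L * \sum_k rowsum (invmx B) k * mu 0 k) *
  expdot (fun k => L * rowsum (invmx B) k) t.
Proof.
move=> pB; set A := invmx B; have sA : A^T = A := posdef_inv_sym pB.
rewrite /gdens /expdot -!mulrA -!expRD; congr (_ * expR _).
pose v : 'rV[R]_m := const_mx (- L).
have -> : rowt (shift_tuple (- L) t) - mu = v + (rowt t - mu).
  apply/rowP => i; rewrite !mxE tnth_map; ring.
have vA : v *m A = \row_k (- L * rowsum A k).
  apply/rowP => k; rewrite !mxE /rowsum mulr_sumr; apply: eq_bigr => j _.
  by rewrite mxE -{1}sA mxE.
rewrite qmxD// vA -/A {1}/qmx vA.
have -> : ((\row_k (- L * rowsum A k)) *m v^T) 0 0 = L ^+ 2 * \sum_k rowsum A k.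
  by rewrite mxE mulr_sumr; apply: eq_bigr => k _; rewrite !mxE; ring.
have -> : dotv (\row_k (- L * rowsum A k)) (rowt t - mu) =
    L * (\sum_k rowsum A k * mu 0 k) - \sum_k L * rowsum A k * tnth t k.
  rewrite dotvE mulr_sumr -sumrB; apply: eq_bigr => k _; rewrite !mxE; ring.
by field.
Qed.

Lemma lint_gauss_sum m (mu : 'rV[R]_m) (B : 'M[R]_m) L : posdefmx B ->
  lint (fun t => ((sumexp t <= expR (- L))%R%:R * gdens mu B (rowt t))%:E) =
  (((Num.sqrt (pi *+ 2) ^+ m * Num.sqrt (\det B))^-1 *
   expR (- (2^-1 * (\sum_k rowsum (invmx B) k) * L ^+ 2) - L * \sum_k rowsum (invmx B) k * mu 0 k))%:E *
  dirint (fun k => L * rowsum (invmx B) k)%R (fun t => expR (- (qmx (invmx B) (rowt t - mu) / 2)))%R)%E.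
Proof.
move=> pB.
pose f (t : m.-tuple R) := ((sumexp t <= expR (- L))%R%:R * gdens mu B (rowt t))%:E.
have f0 t : (0 <= f t)%E by rewrite lee_fin mulr_ge0// gdens_ge0.
have mf : measurable_fun setT f.
  apply/measurable_EFinP; apply: measurable_funM; last exact: measurable_gdens.
  by apply: measurable_ler => //; exact: measurable_sumexp.
rewrite -/f -(lint_shift (- L) mf f0) /dirint -ge0_lintZl.
- apply: eq_lint => t; rewrite /f -/(shift_tuple (- L) t) -EFinM; congr EFin.
  rewrite sumexp_shift gdens_shift// ger_pMr ?expR_gt0// /gdens; ring.
- apply: measurable_dirint; apply: measurableT_comp => //.
  by apply: measurable_funN; apply: measurable_funM => //; exact: measurable_qmx.
- by move=> t; rewrite lee_fin !mulr_ge0 ?expR_ge0.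
- by rewrite mulr_ge0 ?expR_ge0// invr_ge0 mulr_ge0 ?exprn_ge0 ?sqrtr_ge0.
Qed.

Theorem gauss_sum_asymp m (mu : 'rV[R]_m) (B : 'M[R]_m) : (0 < m)%N ->
  posdefmx B -> (forall k, 0 < rowsum (invmx B) k) ->
  exists K L0 : R, forall L, L0 <= L -> exists F,
    lint (fun t => ((sumexp t <= expR (- L))%R%:R * gdens mu B (rowt t))%:E) = F%:E /\
    `|F - gmain mu B L| <= K / L * gmain mu B L.
Proof.
case: m mu B => // m mu B _ pB.
set A := invmx B; move=> A0; have sA : A^T = A := posdef_inv_sym pB.
set S := \sum_k rowsum A k.
have S0 : 0 < S := sum_gt0 A0.
pose u := logfrac A.
pose p k := rowsum A k / S.
have p0 k : 0 < p k by rewrite divr_gt0.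
have eu k : expR (u 0 k) = p k by rewrite mxE lnK ?posrE -?/A -?/S; [|exact: p0].
have [K [K0 HK]] := @gauss_expansion R _ A mu u sA (fun t => posdef_inv_ge0 t pB).
have [K2 [K20 HD]] := Dir_asymp A0.
pose g (t : m.+1.-tuple R) := expR (- (qmx A (rowt t - mu) / 2)).
pose g0 := expR (- (qmx A (u - mu) / 2)).
have g00 : 0 < g0 by exact: expR_gt0.
have mg : measurable_fun setT g.
  apply: measurableT_comp => //.
  by apply: measurable_funN; apply: measurable_funM => //; exact: measurable_qmx.
have g01 t : 0 <= g t <= 1.
  by rewrite expR_ge0/= -expR0 ler_expR oppr_le0 divr_ge0// posdef_inv_ge0.
pose d k := g0 * ((u - mu) *m A) 0 k.
(* The normalised moments of order 1 and -1 miss the value 1 by - 1 / (L S + 1) and 1 / (L A_k - 1).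
   The latter is at most 2 / (L A_k) as soon as L A_k >= 2, which [L0] below guarantees. *)
pose K1 := \sum_k `|d k| * S^-1 + K * \sum_k 2 / rowsum A k.
have K10 : 0 <= K1.
  rewrite addr_ge0//; last rewrite mulr_ge0//; apply: sumr_ge0 => k _.
    by rewrite mulr_ge0// invr_ge0 ltW.
  by rewrite divr_ge0// ltW.
(* The Laplace error is taken relative to [Dir], which is at most 1 + K2 times its main term; g0 *
   K2 is the Stirling error of [Dir] itself. *)
pose K3 := ((1 + K2) * K1 + g0 * K2) / g0.
pose L0 := 1 + \sum_k 2 / rowsum A k.
exists K3, L0 => L L0L.
have s0 : 0 <= \sum_k 2 / rowsum A k.
  by apply: sumr_ge0 => k _; rewrite divr_ge0// ltW.
have L1 : 1 <= L by rewrite (le_trans _ L0L)// /L0 lerDl.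
have Lp : 0 < L by exact: lt_le_trans L1.
have LA k : 2 <= L * rowsum A k.
  rewrite -ler_pdivrMr//; apply: le_trans L0L; rewrite /L0 (bigD1 k)//= addrA.
  rewrite -[leLHS]add0r -[leLHS]addr0; apply: lerD; first by rewrite lerD2r.
  by apply: sumr_ge0 => i _; rewrite divr_ge0// ltW.
have a1 k : 1 < L * rowsum A k by apply: lt_le_trans (LA k); rewrite ltr1n.
have Hg t : `|g t - (g0 - \sum_k d k * (expR (tnth t k) / p k - 1))| <=
    K * \sum_k (expR (tnth t k) / p k + p k * expR (- tnth t k) - 2).
  have := HK (rowt t); rewrite /= -/(g t) -/g0.
  have e1 k : expR (rowt t 0 k - u 0 k) = expR (tnth t k) / p k.
    by rewrite expRB eu [rowt t 0 k]mxE.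
  have e2 k : expR (- (rowt t 0 k - u 0 k)) = p k * expR (- tnth t k).
    by rewrite opprB expRD eu [rowt t 0 k]mxE.
  by under eq_bigr do rewrite e1; under [in leRHS]eq_bigr do rewrite e1 e2.
have [G [Ge HG]] := laplace_bound a1 p0 (ltW g00) K0 mg g01 Hg.
rewrite lint_gauss_sum// Ge -EFinM; eexists; split; first by [].
rewrite /gmain -/A -/S /gdens -/u -/g0.
set cB := (_ * Num.sqrt _)^-1; set e := expR _; set dm := dirmain _ L.
have cB0 : 0 <= cB by rewrite invr_ge0 mulr_ge0 ?exprn_ge0 ?sqrtr_ge0.
have e0 : 0 <= e by exact: expR_ge0.
have dm0 : 0 < dm := dirmain_gt0 _ _.
have -> : cB * e * G - cB * g0 * e * dm = (cB * e) * (G - g0 * dm) by ring.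
have -> : K3 / L * (cB * g0 * e * dm) = (cB * e) * (K3 / L * (g0 * dm)) by ring.
rewrite normrM ger0_norm ?mulr_ge0// ler_wpM2l ?mulr_ge0//.
have {HD} := HD L L1; rewrite -/dm; set D := Dir _ in HG *; move=> HD.
have D0 : 0 <= D by rewrite ltW// Dir_gt0// => k; exact: lt_trans (a1 k).
have DK : D <= (1 + K2) * dm.
  have := le_trans (ler_norm _) HD; rewrite lerBlDl => /le_trans; apply.
  rewrite mulrDl mul1r lerD2l ler_wpM2r ?(ltW dm0)//.
  by rewrite ler_pdivrMr// ler_peMr.
have {}HG : `|G - D * g0| <= D * (K1 / L).
  have LS1 : 0 < L * S + 1 by rewrite addr_gt0// mulr_gt0.
  have tE k : L * rowsum A k / (\sum_i L * rowsum A i + 1) / p k - 1 = - (L * S + 1)^-1.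
    by rewrite -mulr_sumr -/S /p; field; rewrite !gt_eqF.
  have sE k : p k * ((\sum_i L * rowsum A i) / (L * rowsum A k - 1)) - 1 =
      (L * rowsum A k - 1)^-1.
    have := a1 k; rewrite -subr_gt0 => h.
    by rewrite -mulr_sumr -/S /p; field; rewrite !gt_eqF.
  have -> : G - D * g0 = (G - D * (g0 - \sum_k d k *
      (L * rowsum A k / (\sum_i L * rowsum A i + 1) / p k - 1))) +
      D * \sum_k d k * (L * S + 1)^-1.
    under eq_bigr do rewrite tE mulrN.
    by rewrite sumrN; ring.
  apply: le_trans (ler_normD _ _) _.
  rewrite /K1 mulrDl [leRHS]mulrDr [leRHS]addrC; apply: lerD.
    apply: (le_trans HG); rewrite ler_wpM2l// -mulrA ler_wpM2l// mulr_suml.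
    apply: ler_sum => k _.
    have -> (x y : R) : x + y - 2 = (x - 1) + (y - 1) by ring.
    rewrite tE sE.
    have h := a1 k; have h2 := LA k.
    have -> : 2 / rowsum A k / L = 2 / (L * rowsum A k) by rewrite -mulrA -invfM (mulrC L).
    apply: le_trans (_ : (L * rowsum A k - 1)^-1 <= _).
      by rewrite gerDr oppr_le0 invr_ge0 ltW.
    rewrite -[leLHS]mul1r ler_pdivrMr ?subr_gt0// mulrAC ler_pdivlMr; last by lra.
    by rewrite mul1r; lra.
  rewrite normrM ger0_norm// ler_wpM2l// mulr_suml.
  apply: le_trans (ler_norm_sum _ _ _) _; apply: ler_sum => k _.
  rewrite normrM -mulrA ler_wpM2l// gtr0_norm ?invr_gt0// -invfM.
  by rewrite lef_pV2 ?posrE ?mulr_gt0// mulrC lerDl.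
have -> : G - g0 * dm = (G - D * g0) + g0 * (D - dm) by ring.
apply: le_trans (ler_normD _ _) _.
have -> : K3 / L * (g0 * dm) = (1 + K2) * dm * (K1 / L) + g0 * (K2 / L * dm).
  by rewrite /K3; field; rewrite !gt_eqF.
apply: lerD.
  by apply: (le_trans HG); rewrite ler_wpM2r// divr_ge0// ltW.
by rewrite normrM gtr0_norm// ler_wpM2l// ltW.
Qed.

End gauss_sum_asymp.

(** * Densities of subvectors of a Gaussian vector *)

Section gaussian_vectors.
Context {R : realType} {n : nat} {d : measure_display} {T : measurableType d}.
Variables (P : probability T R) (Y : 'I_n -> {RV P >-> R}) (mu : 'I_n -> R) (B : 'M[R]_n).
Hypothesis gY : gaussian_vector P (fun i => (Y i : T -> R)) mu B.
Notation leb := (@lebesgue_measure R).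

Lemma normal_prob0E (m : R) (a b : R) : 0 <= a -> a <= b -> b <= 1 ->
  normal_prob m 0 `[a, b]%classic = (b - a)%:E.
Proof.
move=> a0 ab b1; rewrite /normal_prob /normal_pdf eqxx.
transitivity (\int[leb]_(x in `[a, b]%classic) (cst 1%E x))%E.
  apply: eq_integral => x /set_mem; rewrite /= in_itv/= => /andP[ax xb].
  by rewrite indicE mem_set//= in_itv/= (le_trans a0 ax) (le_trans xb b1).
rewrite integral_cst// mul1e/=.
rewrite lebesgue_measure_itv/= lte_fin.
by move: ab; rewrite le_eqVlt => /predU1P[->|->]; rewrite ?ltxx ?subrr// EFinB.
Qed.

(* The library reads a normal law with zero deviation as the uniform law on [0, 1], which is not stable under scaling by 2. *)
Lemma gaussian_qform_gt0 (t : 'I_n -> R) : (exists i, t i != 0) -> 0 < qform B t.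
Proof.
move=> [i ti]; rewrite ltNge; apply/negP => q0.
have t2 : exists i, 2 * t i != 0 by exists i; rewrite mulf_neq0.
have q2 : qform B (fun i => 2 * t i) <= 0.
  rewrite (_ : qform _ _ = 4 * qform B t); first by rewrite pmulr_rle0.
  rewrite /qform mulr_sumr; apply: eq_bigr => j _; rewrite mulr_sumr.
  by apply: eq_bigr => k _; ring.
have m01 : measurable (`[0, 1]%classic : set R) by exact: measurable_itv.
have m02 : measurable (`[0, 2^-1]%classic : set R) by exact: measurable_itv.
(* The events t.Y in [0, 1/2] and 2t.Y in [0, 1] coincide, but uniform laws would give them
   probabilities 1/2 and 1. *)
have := gY t2 m01; have := gY (ex_intro _ i ti) m02.
have h0 : 0 <= 2^-1 :> R by lra.
have h1 : 2^-1 <= 1 :> R by lra.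
rewrite !ler0_sqrtr// !normal_prob0E//.
have -> : (fun om => \sum_(i < n) 2 * t i * Y i om) @^-1` `[0, 1] =
    (fun om => \sum_(i < n) t i * Y i om) @^-1` `[0, 2^-1].
  have e om : \sum_(i < n) 2 * t i * Y i om = 2 * \sum_(i < n) t i * Y i om.
    by rewrite mulr_sumr; apply: eq_bigr => j _; rewrite mulrA.
  by apply/seteqP; split => om /=; rewrite !in_itv/= e; lra.
by move=> -> [] /eqP; rewrite !subr0; lra.
Qed.

Section subvector.
Variables (m : nat) (idx : 'I_m -> 'I_n).
Hypothesis idx_inj : injective idx.

Definition extend_row (t : 'rV[R]_m) (i : 'I_n) : R := \sum_k t 0 k * (i == idx k)%:R.

Lemma sum_extend_row (t : 'rV[R]_m) (c : 'I_n -> R) :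
  \sum_i extend_row t i * c i = \sum_k t 0 k * c (idx k).
Proof.
under eq_bigr do rewrite mulr_suml; rewrite exchange_big/=; apply: eq_bigr => k _.
rewrite (bigD1 (idx k))//= eqxx mulr1 big1 ?addr0// => i /negPf ->.
by rewrite mulr0 mul0r.
Qed.

Lemma extend_row_neq0 (t : 'rV[R]_m) : t != 0 -> exists i, extend_row t i != 0.
Proof.
move=> /rV0Pn[k tk]; exists (idx k); rewrite /extend_row (bigD1 k)//= eqxx mulr1.
by rewrite big1 ?addr0// => j jk; rewrite (inj_eq idx_inj) eq_sym (negPf jk) mulr0.
Qed.

Lemma qform_extend_row (t : 'rV[R]_m) : qform B (extend_row t) = qmx (mxsub idx idx B) t.
Proof.
rewrite qmxE /qform.
under eq_bigr do under eq_bigr do rewrite -mulrA.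
under eq_bigr do rewrite -mulr_sumr.
rewrite (sum_extend_row t (fun i => \sum_j B i j * extend_row t j)).
apply: eq_bigr => k _; under eq_bigr do rewrite mulrC.
rewrite sum_extend_row mulr_sumr; apply: eq_bigr => j _; rewrite !mxE; ring.
Qed.

Lemma subgaussian_posdef : B^T = B -> posdefmx (mxsub idx idx B).
Proof.
move=> sB; split; first by rewrite -[in RHS]sB trmx_mxsub.
move=> t t0; rewrite -qform_extend_row; apply: gaussian_qform_gt0.
exact: extend_row_neq0.
Qed.

Definition subtuple (om : T) : m.-tuple R := [tuple Y (idx k) om | k < m].

Lemma measurable_subtuple : measurable_fun setT subtuple.
Proof.
apply/measurable_fun_tnthP => k; rewrite (_ : _ \o _ = Y (idx k)) //.
by apply/funext => om /=; rewrite tnth_mktuple.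
Qed.

Lemma subtuple_gauss_char : B^T = B ->
  gauss_char P (fun om => rowt (subtuple om)) 1 (\row_k mu (idx k)) (mxsub idx idx B).
Proof.
(* The hypothesis on [Y] speaks of nonzero combinations only, so t = 0 is checked by hand. *)
move=> sB t s; rewrite mul1r; have [->|t0] := eqVneq t 0.
  under eq_integral do rewrite dotv0l add0r.
  rewrite integral_cst//= probability_setT mule1 dotv0l add0r qmx0.
  by rewrite mul0r oppr0 expR0 mul1r.
have q0 : 0 < qmx (mxsub idx idx B) t by exact: (subgaussian_posdef sB).2.
pose U om := \sum_(i < n) extend_row t i * Y i om.
have UE om : dotv t (rowt (subtuple om)) = U om.
  rewrite /U sum_extend_row dotvE; apply: eq_bigr => k _.
  by rewrite !mxE tnth_mktuple.
have mE : dotv t (\row_k mu (idx k)) = \sum_(i < n) extend_row t i * mu i.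
  by rewrite sum_extend_row dotvE; apply: eq_bigr => k _; rewrite !mxE.
under eq_integral do rewrite UE.
have mU : measurable_fun setT (U : T -> measurableTypeR R).
  by apply: measurable_sum => i; exact: measurable_funM.
pose f (x : measurableTypeR R) : \bar R := (1 + cos (1 * x + s))%:E.
have mf : measurable_fun setT f.
  apply/measurable_EFinP; apply: measurable_funD => //.
  apply: measurableT_comp; first exact: measurable_cos.
  exact: measurable_affine.
have f0 x : (0 <= f x)%E by rewrite lee_fin -lerBlDl sub0r cos_geN1.
transitivity (\int[image_measure P mU]_x f x)%E.
  rewrite ge0_integral_pushforward//=.
  by apply: eq_integral => om _; rewrite /f/= mul1r.
set sg := Num.sqrt (qmx (mxsub idx idx B) t).
have sg0 : 0 < sg by rewrite sqrtr_gt0.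
rewrite (eq_measure_integral (normal_prob (dotv t (\row_k mu (idx k))) sg)); last first.
  move=> A mA _; rewrite /image_measure/= /pushforward/=.
  by rewrite (gY (extend_row_neq0 t0) mA) qform_extend_row -mE.
rewrite ge0_integral_normal_prob// integral_1Dcos_normal// !mul1r.
by rewrite /sg sqr_sqrtr ?(ltW q0)// mulNr mulrC.
Qed.

Lemma subtuple_law (f : m.-tuple R -> \bar R) : B^T = B ->
  measurable_fun setT f -> (forall t, (0 <= f t)%E) ->
  (\int[P]_om f (subtuple om) =
   lint (fun y => f y * (gdens (\row_k mu (idx k)) (mxsub idx idx B) (rowt y))%:E))%E.
Proof.
move=> sB mf f0; rewrite -[RHS]mul1e.
have G := @gauss_integralP R m (\row_k mu (idx k)) _ (subgaussian_posdef sB).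
by apply: (G _ _ _ _ _ measurable_subtuple ler01 (subtuple_gauss_char sB)).
Qed.

Lemma measurable_sumexp_le (x : R) : measurable [set t : m.-tuple R | sumexp t <= x].
Proof.
have := @measurable_sumexp R m measurableT _ (measurable_itv `]-oo, x]).
by rewrite setTI; congr measurable; apply/seteqP; split => t /=; rewrite in_itv.
Qed.

Lemma subtuple_prob (x : R) : B^T = B ->
  P [set om | \sum_k expR (Y (idx k) om) <= x] =
  lint (fun y => ((sumexp y <= x)%R%:R *
    gdens (\row_k mu (idx k)) (mxsub idx idx B) (rowt y))%:E).
Proof.
move=> sB; pose D := [set t : m.-tuple R | sumexp t <= x].
have mD : measurable D := measurable_sumexp_le x.
have e : [set om | \sum_k expR (Y (idx k) om) <= x] = subtuple @^-1` D.
  have s om : sumexp (subtuple om) = \sum_k expR (Y (idx k) om).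
    by apply: eq_bigr => k _; rewrite tnth_mktuple.
  by apply/seteqP; split => om; rewrite /D/= s.
have mE : measurable (subtuple @^-1` D).
  by rewrite -[X in measurable X]setTI; exact: measurable_subtuple.
rewrite e -(setIT (subtuple @^-1` D)) -integral_indic//.
transitivity (\int[P]_om (\1_D (subtuple om))%:E)%E.
  by apply: eq_integral => om _; rewrite !indicE.
rewrite (@subtuple_law (fun t => (\1_D t)%:E))//.
- apply: eq_lint => t; rewrite -EFinM indicE; congr (_ * _)%:E.
  by congr (nat_of_bool _)%:R; apply/idP/idP => [/set_mem|h]; rewrite ?inE.
- by apply/measurable_EFinP; exact: measurable_indic.
Qed.

End subvector.
End gaussian_vectors.

(** * Kuhn-Tucker conditions for the quadratic minimiser on the simplex *)

Section kkt.
Context {R : realType} {n : nat}.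
Variables (B : 'M[R]_n) (w : 'I_n -> R).
Hypotheses (sB : B^T = B) (wmin : simplex_minimizer B w).

Lemma qform_add (a b : R) (v u : 'I_n -> R) :
  qform B (fun i => a * v i + b * u i) =
  a ^+ 2 * qform B v + 2 * a * b * (\sum_i u i * \sum_j B i j * v j) + b ^+ 2 * qform B u.
Proof.
have E : \sum_i u i * (\sum_j B i j * v j) = \sum_i \sum_j v i * B i j * u j.
  rewrite [RHS]exchange_big/=; apply: eq_bigr => i _; rewrite mulr_sumr.
  by apply: eq_bigr => j _; rewrite -{1}sB mxE; ring.
have E2 : \sum_i u i * (\sum_j B i j * v j) = \sum_i \sum_j u i * B i j * v j.
  by apply: eq_bigr => i _; rewrite mulr_sumr; apply: eq_bigr => j _; ring.
have -> : 2 * a * b * (\sum_i u i * \sum_j B i j * v j) =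
    a * b * (\sum_i \sum_j v i * B i j * u j) + a * b * (\sum_i \sum_j u i * B i j * v j).
  by rewrite -E -E2; ring.
rewrite /qform !mulr_sumr -!big_split/=; apply: eq_bigr => i _.
by rewrite !mulr_sumr -!big_split/=; apply: eq_bigr => j _; ring.
Qed.

Definition gradq (i : 'I_n) : R := \sum_j B i j * w j.

Lemma qform_gradq : qform B w = \sum_i w i * gradq i.
Proof.
by apply: eq_bigr => i _; rewrite mulr_sumr; apply: eq_bigr => j _; rewrite mulrA.
Qed.

Definition unitv (i : 'I_n) : 'I_n -> R := fun j => (j == i)%:R.

Lemma sum_unitv i (f : 'I_n -> R) : \sum_j unitv i j * f j = f i.
Proof.
rewrite (bigD1 i)//= /unitv eqxx mul1r big1 ?addr0// => j /negPf ->.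
by rewrite mul0r.
Qed.

(** Moving from [w] towards the vertex i by a fraction e changes the form by - 2 e (l - gradq i) +
    e^2 (l - 2 gradq i + B i i). If gradq i < l, this is negative for small e. *)
Lemma kkt_ge i : qform B w <= gradq i.
Proof.
have [[w0 w1] wle] := wmin.
rewrite leNgt; apply/negP => lt.
set l := qform B w in lt *.
pose c := B i i - l; pose s := 2 * (l - gradq i).
have s0 : 0 < s by rewrite mulr_gt0// subr_gt0.
(* The denominator exceeds the second-order coefficient, so e times that coefficient stays below
   [s], the first-order gain. *)
pose e := Num.min 1 (s / (1 + s + `|l - 2 * gradq i + B i i|)).
set D := 1 + s + _ in e.
have D0 : 0 < D by rewrite ltr_pwDl// addr_gt0.
have e0 : 0 < e by rewrite /e lt_min ltr01 divr_gt0.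
have e1 : e <= 1 by rewrite /e ge_min lexx.
have sv : simplex (fun j => (1 - e) * w j + e * unitv i j).
  split=> [j|].
    by rewrite addr_ge0// mulr_ge0// ?subr_ge0// ?ler0n// ltW.
  rewrite big_split/= -!mulr_sumr w1.
  have -> : \sum_j unitv i j = 1.
    by have := sum_unitv i (fun=> 1); under eq_bigr do rewrite mulr1.
  by ring.
have := wle _ sv; rewrite qform_add -/l (sum_unitv i) -/(gradq i).
have -> : qform B (unitv i) = B i i.
  rewrite /qform; under eq_bigr do under eq_bigr do rewrite -mulrA.
  under eq_bigr do rewrite -mulr_sumr; rewrite sum_unitv.
  by under eq_bigr do rewrite mulrC; rewrite sum_unitv.
have eD : e * D <= s.
  by rewrite -ler_pdivlMr// /e ge_min lexx orbT.
have h1 : e * (l - 2 * gradq i + B i i) < s.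
  apply: lt_le_trans eD; rewrite ltr_pM2l// /D.
  by apply: le_lt_trans (ler_norm _) _; rewrite ltrDr addr_gt0.
have h2 : e * (e * (l - 2 * gradq i + B i i)) < e * s by rewrite ltr_pM2l.
rewrite /s in h2.
nra.
Qed.

(** Complementary slackness: the terms w_j (gradq j - l) are nonnegative and sum to 0. *)
Lemma kkt_eq i : w i != 0 -> gradq i = qform B w.
Proof.
move=> wi; have [[w0 w1] _] := wmin.
have z : \sum_j w j * (gradq j - qform B w) = 0.
  under eq_bigr do rewrite mulrBr.
  by rewrite sumrB -mulr_suml w1 mul1r -qform_gradq subrr.
have p0 j : true -> 0 <= w j * (gradq j - qform B w).
  by move=> _; rewrite mulr_ge0// subr_ge0 kkt_ge.
have /eqP := psumr_eq0P p0 z (i := i) isT.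
by rewrite mulf_eq0 (negPf wi) subr_eq0 => /eqP.
Qed.

Lemma kkt_gt i : assumption_A B w -> w i = 0 -> qform B w < gradq i.
Proof. by move=> hA wi; rewrite lt_neqAle kkt_ge andbT eq_sym -subr_eq0; exact: hA. Qed.

Lemma bidx_inj : injective (@bidx R n w).
Proof. exact: enum_val_inj. Qed.

Lemma bidx_neq0 k : w (@bidx R n w k) != 0.
Proof. by have := enum_valP k; rewrite inE. Qed.

Lemma sum_bidx (f : 'I_n -> R) : (forall i, w i = 0 -> f i = 0) ->
  \sum_i f i = \sum_k f (@bidx R n w k).
Proof.
move=> f0; rewrite [LHS](bigID (mem (Ibar w)))/= [X in _ + X]big1 ?addr0; last first.
  by move=> i; rewrite inE negbK => /eqP; exact: f0.
exact: big_enum_val.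
Qed.

Lemma nbar_gt0 : (0 < nbar w)%N.
Proof.
have [[w0 w1] _] := wmin; rewrite lt0n; apply/negP => /eqP e.
have := @oner_neq0 R; rewrite -w1 (sum_bidx (f := w))//.
have -> : \sum_k w (bidx w k) = 0; last by rewrite eqxx.
by apply: big1 => k _; have: (k < 0)%N by rewrite -[X in (_ < X)%N]e.
Qed.

(** By [kkt_eq] the support part of [w] solves Bbar v = l 1, so v / l is the vector of row sums of
    the inverse. This gives the positivity of [Abar] and identifies [Sbar] with 1 / l, the link
    between the density and the minimisation. *)
Lemma AbarE k : Bbar B w \in unitmx -> 0 < qform B w -> Abar B w k = w (bidx w k) / qform B w.
Proof.
move=> uB l0; pose v : 'cV[R]_(nbar w) := \col_k w (bidx w k).
have Bv : Bbar B w *m v = const_mx (qform B w).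
  apply/colP => i; rewrite !mxE.
  rewrite -(kkt_eq (bidx_neq0 i)) /gradq sum_bidx; last by move=> j ->; rewrite mulr0.
  by apply: eq_bigr => j _; rewrite !mxE.
have : v = invmx (Bbar B w) *m const_mx (qform B w) by rewrite -Bv mulKmx.
move=> /colP/(_ k); rewrite !mxE => ->.
under eq_bigr do rewrite mxE; rewrite -mulr_suml mulfK ?gt_eqF//.
Qed.

Lemma Abar_gt0 k : Bbar B w \in unitmx -> 0 < qform B w -> 0 < Abar B w k.
Proof.
move=> uB l0; rewrite AbarE// divr_gt0// lt_neqAle eq_sym bidx_neq0/=.
by have [[w0 _] _] := wmin.
Qed.

Lemma SbarE : Bbar B w \in unitmx -> 0 < qform B w -> Sbar B w = (qform B w)^-1.
Proof.
move=> uB l0; rewrite /Sbar; under eq_bigr do rewrite AbarE//.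
rewrite -mulr_suml -(sum_bidx (f := w))//.
by have [[_ ->] _] := wmin; rewrite mul1r.
Qed.

End kkt.

(** * A Chernoff bound for the normal law *)

Section normal_tail.
Context {R : realType}.
Notation leb := (@lebesgue_measure R).

(** On the half-line the density with mean m is at most exp (- b^2 / (2 s^2)) times the density with
    mean m - b, and the latter has total mass 1. *)
Lemma normal_prob_tail (m s b : R) : 0 < s -> 0 <= b ->
  (normal_prob m s `]-oo, (m - b)%R]%classic <= (expR (- b ^+ 2 / (2 * s ^+ 2)))%:E)%E.
Proof.
move=> s0 b0; set e := expR _.
have mpdf (m' : R) : measurable_fun setT (fun x => (normal_pdf m' s x)%:E).
  by apply/measurable_EFinP; exact: measurable_normal_pdf.
have pdf0 (m' x : R) : (0 <= (normal_pdf m' s x)%:E)%E by rewrite lee_fin normal_pdf_ge0.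
have mA : measurable (`]-oo, (m - b)%R]%classic : set R) by exact: measurable_itv.
apply: le_trans (_ : \int[leb]_(x in `]-oo, (m - b)%R]) (e%:E * (normal_pdf (m - b) s x)%:E) <= _)%E.
  apply: ge0_le_integral => //.
  - by apply: measurable_funTS; exact: (mpdf m).
  - by apply: measurable_funTS; apply: measurable_funeM; exact: (mpdf (m - b)).
  move=> x; rewrite /= in_itv/= => xmb; rewrite -EFinM lee_fin.
  rewrite !normal_pdfE ?gt_eqF// /normal_peak /normal_fun mulrCA ler_wpM2l ?invr_ge0//.
  rewrite /e -expRD ler_expR -subr_ge0.
  have -> : - b ^+ 2 / (2 * s ^+ 2) + - (x - (m - b)) ^+ 2 / (s ^+ 2 *+ 2) -
      - (x - m) ^+ 2 / (s ^+ 2 *+ 2) = b * (m - b - x) / s ^+ 2.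
    by field; rewrite gt_eqF.
  by rewrite divr_ge0 ?sqr_ge0// mulr_ge0// subr_ge0.
rewrite ge0_integralZl//; last 2 first.
- by apply: measurable_funTS; exact: (mpdf (m - b)).
- by rewrite lee_fin expR_ge0.
rewrite -[leRHS]mule1; apply: lee_wpmul2l; first by rewrite lee_fin expR_ge0.
rewrite -(integral_normal_pdf (m - b) s).
apply: ge0_subset_integral => //; first exact: (mpdf (m - b)).
Qed.

End normal_tail.

(** * Identification of the closed formula with the computed main term *)

Section main_term.
Context {R : realType} {n : nat}.

Lemma BbarE (B : 'M[R]_n) w : Bbar B w = mxsub (@bidx R n w) (@bidx R n w) B.
Proof. by apply/matrixP => i j; rewrite !mxE. Qed.

Lemma main_termE (B : 'M[R]_n) (mu w : 'I_n -> R) (x : R) :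
  (0 < nbar w)%N -> 0 < \det (Bbar B w) -> (forall k, 0 < Abar B w k) -> 0 < x < 1 ->
  main_term B mu w x = gmain (\row_k mu (@bidx R n w k)) (Bbar B w) (ln x^-1).
Proof.
move=> m0 d0 A0 /andP[x0 x1]; set L := ln x^-1.
have xi1 : 1 < x^-1 by rewrite invf_gt1.
have L0 : 0 < L by rewrite ln_gt0.
have xL : ln x = - L by rewrite /L lnV ?opprK// posrE.
have S0 : 0 < Sbar B w.
  rewrite /Sbar (bigD1 (Ordinal m0))//= ltr_pwDl// sumr_ge0// => k _; exact: ltW.
have sqrt_expR (y : R) : Num.sqrt (expR y) = expR (2^-1 * y).
  apply/eqP; rewrite -(eqrXn2 (n := 2)) ?sqrtr_ge0 ?expR_ge0// sqr_sqrtr ?expR_ge0//.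
  by rewrite expr2 -expRD; apply/eqP; congr expR; field.
pose s2 : R := Num.sqrt (pi *+ 2).
have s20 : s2 != 0 by rewrite gt_eqF// sqrtr_gt0 mulrn_wgt0// pi_gt0.
rewrite /main_term /Cconst /gmain /gdens /dirmain -/s2.
have -> : (ln x^-1) = L by [].
rewrite /powR !gt_eqF// xL.
set lS := ln (Sbar B w); set lA := \sum_k ln (Abar B w k).
have -> : \prod_k Abar B w k = expR lA.
  by rewrite /lA expR_sum; apply: eq_bigr => k _; rewrite lnK ?posrE.
have SE : Sbar B w = expR lS by rewrite lnK ?posrE.
have -> : Num.sqrt (Sbar B w) = expR (2^-1 * lS) by rewrite SE sqrt_expR.
rewrite sqrt_expR.
(* [logfrac] holds ln (A_k / S) and [cbar] holds ln (S / A_k), so the two centred vectors are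
   opposite, which the quadratic form does not see. *)
have uE k : (- (logfrac (invmx (Bbar B w)) - \row_k mu (bidx w k))) 0 k = cbar B mu w k.
  rewrite /logfrac !mxE opprB addrC /cbar; congr (_ + _).
  by rewrite -[rowsum _ _]/(Abar B w k) -/(Sbar B w) !ln_div ?posrE// opprB.
have sE : s2 ^+ nbar w = s2 * s2 ^+ (nbar w).-1 by rewrite -exprS prednK.
have sd0 : Num.sqrt (\det (Bbar B w)) != 0 by rewrite gt_eqF// sqrtr_gt0.
rewrite sE; set sm := s2 ^+ _.
have sm0 : sm != 0 by rewrite expf_neq0.
rewrite -?[\sum_k rowsum (invmx (Bbar B w)) k]/(Sbar B w) -/lS.
rewrite -?[\sum_k ln (rowsum (invmx (Bbar B w)) k)]/lA.
have -> : \sum_k rowsum (invmx (Bbar B w)) k * (\row_k0 mu (bidx w k0)) 0 k =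
    \sum_k Abar B w k * mubar mu w k by apply: eq_bigr => k _; rewrite mxE.
rewrite -?[\sum_k rowsum (invmx (Bbar B w)) k * _]/(\sum_k Abar B w k * ln (Sbar B w / Abar B w k)).
have -> : \sum_k Abar B w k * cbar B mu w k =
    \sum_k Abar B w k * ln (Sbar B w / Abar B w k) + \sum_k Abar B w k * mubar mu w k.
  by rewrite -big_split/=; apply: eq_bigr => k _; rewrite mulrDr.
have -> : qmx (invmx (Bbar B w)) (logfrac (invmx (Bbar B w)) - \row_k mu (bidx w k)) =
    \sum_(i < nbar w) \sum_(j < nbar w) abar B w i j * cbar B mu w i * cbar B mu w j.
  rewrite -qmxN qmxE; apply: eq_bigr => i _; apply: eq_bigr => j _.
  by rewrite !uE mulrA.
set q := \sum_i _; set t1 := \sum_k _ * ln _; set t2 := \sum_k _ * mubar _ _ _.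
set sd := Num.sqrt (\det _) in sd0 *; set S := Sbar B w.
have -> : (s2 * sm * sd)^-1 = (s2 * sd)^-1 * sm^-1.
  by rewrite -invfM; congr (_^-1); ring.
have E : expR (2^-1 * lS) / expR (2^-1 * lA) * expR (- 2^-1 * q) / S *
    expR (- ((1 + (nbar w)%:R) / 2) * ln L) * expR ((t1 + t2) * - L) *
    expR (- 2^-1 * S * L ^+ 2) = expR (- (q / 2)) *
    expR (- (2^-1 * S * L ^+ 2) - L * t2) *
    expR (- ((1 + (nbar w)%:R) / 2 * ln L) - L * t1 - 2^-1 * lA - 2^-1 * lS).
  have -> : S^-1 = expR (- lS) by rewrite expRN -SE.
  by rewrite -expRN -!expRD; congr expR; field.
transitivity ((s2 * sd)^-1 * (expR (2^-1 * lS) / expR (2^-1 * lA) * expR (- 2^-1 * q) / S *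
    expR (- ((1 + (nbar w)%:R) / 2) * ln L) * expR ((t1 + t2) * - L) *
    expR (- 2^-1 * S * L ^+ 2))); first by rewrite !mulrA.
by rewrite E; field; rewrite s20 sm0 sd0.
Qed.

End main_term.

(** * Comparison of the main term with its shifts and with Gaussian tails *)

Section gaussian_profile.
Context {R : realType}.

(** The shape of the main term in L = log (1/x). Only the coefficient [S] of L^2 / 2 matters in the
    comparisons below, so the other constants are kept abstract. *)
Definition gprofile (c0 S c1 q L : R) : R :=
  expR (c0 - 2^-1 * S * L ^+ 2 - c1 * L - q * ln L).

Lemma gmain_profile m (mu : 'rV[R]_m) (B : 'M[R]_m) : 0 < \det B ->
  exists c0 c1 q, forall L,
  gmain mu B L = gprofile c0 (\sum_k rowsum (invmx B) k) c1 q L.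
Proof.
move=> d0; set A := invmx B.
have p0 : 0 < Num.sqrt (pi *+ 2) :> R by rewrite sqrtr_gt0 mulrn_wgt0// pi_gt0.
have g0 : 0 < gdens mu B (logfrac A).
  by rewrite mulr_gt0 ?expR_gt0// invr_gt0 mulr_gt0 ?exprn_gt0// sqrtr_gt0.
have s0 : 0 < Num.sqrt (pi *+ 2) ^+ m.-1 :> R by rewrite exprn_gt0.
set g := gdens _ _ _ in g0; set s := _ ^+ _ in s0.
pose S := \sum_k rowsum A k; pose t1 := \sum_k rowsum A k * mu 0 k.
pose t2 := \sum_k rowsum A k * ln (S / rowsum A k); pose t3 := \sum_k ln (rowsum A k).
exists (ln g + ln s - 2^-1 * t3 - 2^-1 * ln S), (t1 + t2), ((1 + m%:R) / 2) => L.
rewrite /gmain -/A -/g /dirmain -/s -/S -/t1 -/t2 -/t3 -[g in LHS]lnK ?posrE//.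
rewrite -[s in LHS]lnK ?posrE// -!expRD /gprofile; congr expR; ring.
Qed.

Lemma ln_le_lin (e L : R) : 0 < e -> 0 < L -> ln L <= e * L - ln e - 1.
Proof.
move=> e0 L0; have := @le_ln1Dx R (e * L - 1).
have eL : 0 < e * L by rewrite mulr_gt0.
rewrite addrCA subrr addr0 lnM ?posrE// => h.
have : ln e + ln L <= e * L - 1 by apply: h; lra.
lra.
Qed.

(** With y = 1 / L, the exponent changes by S (y + y^4 / 2), c1 y^2 and q ln (1 + y^3), all of them
    O(y). The constant 2 S comes from the crude bound y^4 <= 2 y. *)
Lemma gprofile_shift c0 S c1 q : 0 <= S ->
  exists K : R, 0 <= K /\ forall L, 1 <= L ->
  gprofile c0 S c1 q L * (1 - K / L) <= gprofile c0 S c1 q (L + L^-1 ^+ 2).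
Proof.
move=> S0; exists (2 * S + `|c1| + `|q|); split; first by rewrite !addr_ge0// mulr_ge0.
move=> L L1; have L0 : 0 < L by exact: lt_le_trans L1.
set y := L^-1; have y0 : 0 < y by rewrite invr_gt0.
have y1 : y <= 1 by rewrite invf_le1.
have Ly : L * y = 1 by rewrite mulfV// gt_eqF.
have y21 : y ^+ 2 <= y by rewrite expr2 ler_piMl// ltW.
have l01 : 0 <= ln (L + y ^+ 2) - ln L <= y.
  have L20 : 0 < L + y ^+ 2 by rewrite addr_gt0// exprn_gt0.
  rewrite -ln_div ?posrE//.
  have -> : (L + y ^+ 2) / L = 1 + y ^+ 3 by rewrite -/y mulrDl Ly; ring.
  have y3 : 0 <= y ^+ 3 by rewrite exprn_ge0// ltW.
  rewrite ln_ge0 ?lerDl//=; apply: le_trans (le_ln1Dx _) _; first by lra.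
  by rewrite exprSr (le_trans _ y21)// ler_piMr ?exprn_ge0// ltW.
have -> : gprofile c0 S c1 q (L + y ^+ 2) = gprofile c0 S c1 q L *
    expR (- (2^-1 * S * (2 * y + y ^+ 4)) - c1 * y ^+ 2 - q * (ln (L + y ^+ 2) - ln L)).
  rewrite /gprofile -expRD; congr expR.
  have -> : (L + y ^+ 2) ^+ 2 = L ^+ 2 + (2 * y + y ^+ 4).
    have -> : (L + y ^+ 2) ^+ 2 = L ^+ 2 + 2 * (L * y) * y + y ^+ 4 by ring.
    by rewrite Ly; ring.
  by ring.
rewrite ler_wpM2l ?expR_ge0//; apply: le_trans (expR_ge1Dx _); rewrite -/y.
set l := ln _ - ln _ in l01 *; have /andP[l0 l1] := l01.
have y42 : y ^+ 4 <= 2 * y.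
  have : y ^+ 4 <= y ^+ 2 by rewrite ler_wiXn2l// ltW.
  by move=> h; have := le_trans h y21; lra.
have h1 : S * (2 * y + y ^+ 4) <= S * (4 * y) by rewrite ler_wpM2l//; lra.
have h2 : c1 * y ^+ 2 <= `|c1| * y.
  apply: le_trans (ler_norm _) _; rewrite normrM ler_wpM2l// ger0_norm// sqr_ge0//.
have h3 : q * l <= `|q| * y.
  by apply: le_trans (ler_norm _) _; rewrite normrM ler_wpM2l// ger0_norm.
lra.
Qed.

Lemma gprofile_tail c0 S c1 q a V C : 0 < V -> S < a ^+ 2 / V ->
  exists L0 : R, forall L, L0 <= L ->
  expR (- (a * L - C) ^+ 2 / (2 * V)) <= gprofile c0 S c1 q L / L.
Proof.
move=> V0 aV.
(* [D] collects the terms that grow at most linearly in [L]: the constant, the linear and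
   logarithmic terms of the profile, the division by [L] (summand 1), and the cross term of the
   square. [G] is half the excess of the quadratic rate. *)
pose D := `|c0| + `|c1| + `|q| + 1 + `|a * C / V|.
pose G := (a ^+ 2 / V - S) / 2.
have G0 : 0 < G by rewrite divr_gt0// subr_gt0.
exists (1 + D / G) => L L0.
have D0 : 0 <= D by rewrite /D !addr_ge0.
have L1 : 1 <= L by apply: le_trans L0; rewrite lerDl divr_ge0// ltW.
have Lp : 0 < L by exact: lt_le_trans L1.
have LD : D * L <= G * L ^+ 2.
  rewrite expr2 mulrA ler_wpM2r// ?(ltW Lp)// mulrC -ler_pdivrMr//.
  by apply: le_trans L0; rewrite lerDr.
have LE : L^-1 = expR (- ln L) by rewrite expRN lnK ?posrE.
rewrite /gprofile LE -expRD ler_expR.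
have lL0 : 0 <= ln L by rewrite ln_ge0.
have lL1 : ln L <= L by have := ln_le_lin ltr01 Lp; rewrite ln1; lra.
have h0 : - c0 <= `|c0| * L.
  by apply: le_trans (ler_norm _) _; rewrite normrN ler_peMr.
have h1 : c1 * L <= `|c1| * L by rewrite ler_wpM2r ?ler_norm// ltW.
have h2 : q * ln L <= `|q| * L.
  apply: le_trans (ler_norm _) _; rewrite normrM ler_wpM2l// ger0_norm//.
have h3 : a * C / V * L <= `|a * C / V| * L by rewrite ler_wpM2r ?ler_norm// ltW.
have e : - (a * L - C) ^+ 2 / (2 * V) =
    - (a ^+ 2 / V) * 2^-1 * L ^+ 2 + a * C / V * L - C ^+ 2 / V / 2.
  by field; rewrite gt_eqF.
have C0 : 0 <= C ^+ 2 / V / 2 by rewrite !divr_ge0 ?sqr_ge0// ltW.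
rewrite e.
have : D * L = `|c0| * L + `|c1| * L + `|q| * L + L + `|a * C / V| * L by rewrite /D; ring.
have : G * L ^+ 2 = a ^+ 2 / V * 2^-1 * L ^+ 2 - 2^-1 * S * L ^+ 2 by rewrite /G; ring.
move: LD; lra.
Qed.

(** The left side is the variance of (w - s e^i).Y, the right side the variance for which a
    deviation of (1 - s) L would have the main rate. They agree at s = 0 with slopes - 2 b and - 2
    l, so l < b separates them for small s. *)
Lemma rate_gap (l b c : R) : 0 < l -> l < b ->
  exists s : R, 0 < s < 1 /\ l - 2 * s * b + s ^+ 2 * c < l * (1 - s) ^+ 2.
Proof.
move=> l0 lb; pose s := Num.min (2^-1) ((b - l) / (1 + `|c - l|)).
have D0 : 0 < 1 + `|c - l| by rewrite ltr_pwDl.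
have s0 : 0 < s by rewrite lt_min divr_gt0 ?subr_gt0// invr_gt0 ltr0n.
have s1 : s <= 2^-1 by rewrite ge_min lexx.
exists s; split; first by rewrite s0/=; lra.
have sD : s * (1 + `|c - l|) <= b - l by rewrite -ler_pdivlMr// ge_min lexx orbT.
have h : s * (c - l) <= s * `|c - l| by rewrite ler_wpM2l ?ler_norm// ltW.
have : s * (s * (c - l)) < s * (2 * (b - l)) by rewrite ltr_pM2l//; lra.
nra.
Qed.

End gaussian_profile.

(** * Negligibility of the coordinates outside the support of the minimiser *)

Section left_tail.
Context {R : realType} {n : nat} {d : measure_display} {T : measurableType d}.
Variables (P : probability T R) (Y : 'I_n -> {RV P >-> R}) (mu : 'I_n -> R) (B : 'M[R]_n).
Variable (w : 'I_n -> R).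
Hypotheses (sB : B^T = B) (gY : gaussian_vector P (fun i => (Y i : T -> R)) mu B).
Hypotheses (wmin : simplex_minimizer B w) (hA : assumption_A B w).

Definition sumI (om : T) : R := \sum_k expR (Y (bidx w k) om).

(** The threshold is x / (2 n L^2) for x = e^{-L}. Coordinates below it contribute at most x / (2
    L^2) in all, which fits in the room x (1 - exp (- 1 / L^2)) opened by the shift of [L]. *)
Definition big_coord (i : 'I_n) (L : R) : set T :=
  [set om | sumI om <= expR (- L) /\ expR (- L) * L^-1 ^+ 2 / (2 * n%:R) < expR (Y i om)].

Lemma measurable_sum_expY m (idx : 'I_m -> 'I_n) :
  measurable_fun setT (fun om => \sum_k expR (Y (idx k) om)).
Proof. by apply: measurable_sum => k; exact: measurableT_comp. Qed.

Lemma measurable_sum_le m (idx : 'I_m -> 'I_n) (x : R) :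
  measurable [set om | \sum_k expR (Y (idx k) om) <= x].
Proof.
have := @measurable_sum_expY m idx measurableT _ (measurable_itv `]-oo, x]).
by rewrite setTI; congr measurable; apply/seteqP; split => om /=; rewrite in_itv.
Qed.

Lemma measurable_big_coord i L : measurable (big_coord i L).
Proof.
apply: measurableI; first exact: measurable_sum_le.
have mY : measurable_fun setT (fun om => expR (Y i om)) by exact: measurableT_comp.
have := mY measurableT _ (measurable_itv `]expR (- L) * L^-1 ^+ 2 / (2 * n%:R), +oo[).
by rewrite setTI; congr measurable; apply/seteqP; split => om /=; rewrite in_itv andbT.
Qed.

Lemma qform_min_gt0 : 0 < qform B w.
Proof.
apply: (gaussian_qform_gt0 gY).
by exists (bidx w (Ordinal (nbar_gt0 wmin))); exact: bidx_neq0.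
Qed.

Lemma dim_gt0 : (0 < n)%N.
Proof. by have := ltn_ord (bidx w (Ordinal (nbar_gt0 wmin))); exact: leq_ltn_trans. Qed.

(** Every Y_k with k in the support is at most - L, and [w] averages these coordinates. *)
Lemma min_dot_le om L : sumI om <= expR (- L) -> \sum_i w i * Y i om <= - L.
Proof.
move=> h; have [[w0 w1] _] := wmin.
rewrite (sum_bidx (w := w)); last by move=> i ->; rewrite mul0r.
have -> : - L = \sum_k w (bidx w k) * - L.
  by rewrite -mulr_suml -(sum_bidx (f := w))// w1 mul1r.
apply: ler_sum => k _; rewrite ler_wpM2l// -ler_expR; apply: le_trans h.
by rewrite /sumI (bigD1 k)//= lerDl sumr_ge0// => j _; exact: expR_ge0.
Qed.

(* On [big_coord i L] the combination [w - s * e^i] of the coordinates is of order [- (1 - s) * L],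
   and for small [s > 0] this is less likely than the main event, by the strict KKT inequality at [i]. *)
Lemma big_coord_tail i c0 c1 q : w i = 0 -> exists L0 : R, forall L, L0 <= L ->
  (P (big_coord i L) <= (gprofile c0 (qform B w)^-1 c1 q L / L)%:E)%E.
Proof.
move=> wi; have l0 := qform_min_gt0; set l := qform B w in l0 *.
have lb : l < gradq B w i := kkt_gt sB wmin hA wi.
have [s [/andP[s0 s1] gap]] := rate_gap (B i i) l0 lb.
pose t j := 1 * w j + (- s) * unitv i j.
have ti : t i != 0 by rewrite /t wi /unitv eqxx mulr0 add0r mulr1 oppr_eq0 gt_eqF.
have t0 : exists j, t j != 0 by exists i.
pose V := qform B t.
have V0 : 0 < V := gaussian_qform_gt0 gY t0.
have VE : V = l - 2 * s * gradq B w i + s ^+ 2 * B i i.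
  rewrite /V /t qform_add// sum_unitv -/(gradq B w i) -/l.
  have -> : qform B (unitv i) = B i i.
    rewrite /qform; under eq_bigr do under eq_bigr do rewrite -mulrA.
    under eq_bigr do rewrite -mulr_sumr; rewrite sum_unitv.
    by under eq_bigr do rewrite mulrC; rewrite sum_unitv.
  by ring.
rewrite -VE in gap.
(* A deviation r L under variance V has exactly the main rate L^2 / (2 l). As [gap] gives r < 1 - s,
   the midpoint [a] satisfies a^2 / V > 1 / l and still leaves 1 - s - a for logarithmic losses. *)
pose r := Num.sqrt (V / l).
have r2 : r ^+ 2 = V / l by rewrite sqr_sqrtr// divr_ge0// ltW.
have r0 : 0 <= r by exact: sqrtr_ge0.
have r1 : r < 1 - s.
  rewrite -(@ltr_pXn2r _ 2)// ?nnegrE ?subr_ge0 ?(ltW s1)//.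
  by rewrite r2 ltr_pdivrMr// mulrC.
pose a := (1 - s + r) / 2.
have ra : r < a by rewrite /a; lra.
have a1 : a < 1 - s by rewrite /a; lra.
have a0 : 0 < a by exact: le_lt_trans ra.
have aV : l^-1 < a ^+ 2 / V.
  by rewrite ltr_pdivlMr// mulrC -r2 ltr_pXn2r ?nnegrE ?(ltW a0).
(* With this slope in [ln_le_lin], the loss 2 s ln L costs exactly (1 - s - a) L plus a constant,
   which goes into [C]. *)
pose e := (1 - s - a) / (2 * s).
have e0 : 0 < e by rewrite divr_gt0 ?subr_gt0// mulr_gt0.
pose m := \sum_j t j * mu j.
pose C := s * ln (2 * n%:R) - 2 * s * (ln e + 1) - m.
have [L1 HL1] := gprofile_tail c0 c1 q C V0 aV.
exists (1 + `|L1| + `|C| / a) => L LL.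
have Ca : 0 <= `|C| / a by rewrite divr_ge0// ltW.
have LL1 : L1 <= L by apply: le_trans LL; have := ler_norm L1; lra.
have Lge1 : 1 <= L by apply: le_trans LL; have := normr_ge0 L1; lra.
have Lp : 0 < L by exact: lt_le_trans Lge1.
have bL : 0 <= a * L - C.
  have : `|C| / a <= L by apply: le_trans LL; have := normr_ge0 L1; lra.
  by rewrite ler_pdivrMr// mulrC; have := ler_norm C; lra.
have n0 : 0 < n%:R :> R by rewrite ltr0n dim_gt0.
have n2 : 0 < 2 * n%:R :> R by rewrite mulr_gt0.
pose H : set T := (fun om => \sum_(j < n) t j * Y j om) @^-1` `]-oo, m - (a * L - C)].
apply: (@le_trans _ _ (P H)).
  apply: le_measure; rewrite ?inE; first exact: measurable_big_coord.
    have mU : measurable_fun setT (fun om => \sum_(j < n) t j * Y j om).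
      by apply: measurable_sum => j; exact: measurable_funM.
    by rewrite -[X in measurable X]setTI; exact: mU.
  move=> om [h1 h2]; rewrite /H/= in_itv/=.
  have -> : \sum_(j < n) t j * Y j om = \sum_j w j * Y j om - s * Y i om.
    rewrite -(sum_unitv i (fun j => Y j om)) mulr_sumr -sumrB.
    by apply: eq_bigr => j _; rewrite /t; ring.
  have hw := min_dot_le h1.
  have hY : - L - 2 * ln L - ln (2 * n%:R) < Y i om.
    rewrite -ltr_expR; apply: le_lt_trans h2.
    rewrite !expRD !expRN mulr_natl mulr2n expRD !lnK ?posrE//.
    by rewrite exprVn expr2.
  have hl := ln_le_lin e0 Lp.
  have h3 : s * (- L - 2 * ln L - ln (2 * n%:R)) <= s * Y i om by rewrite ler_wpM2l// ltW.
  have h4 : 2 * s * ln L <= 2 * s * (e * L - ln e - 1).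
    by rewrite ler_wpM2l// mulr_ge0// ltW.
  have h5 : 2 * s * (e * L - ln e - 1) = (1 - s - a) * L - 2 * s * (ln e + 1).
    by rewrite /e; field; rewrite gt_eqF.
  rewrite /C; lra.
have mI : measurable (`]-oo, m - (a * L - C)]%classic : set R) by exact: measurable_itv.
rewrite /H (gY t0 mI).
have sV : 0 < Num.sqrt V by rewrite sqrtr_gt0.
apply: le_trans (normal_prob_tail m sV bL) _.
by rewrite lee_fin sqr_sqrtr ?(ltW V0)// HL1.
Qed.

Lemma expRN_le_half (z : R) : 0 <= z <= 1 -> expR (- z) <= 1 - z / 2.
Proof.
move=> /andP[z0 z1]; have z10 : 0 < 1 + z by lra.
apply: le_trans (_ : (1 + z)^-1 <= _).
  by rewrite expRN lef_pV2 ?posrE ?expR_gt0// expR_ge1Dx.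
rewrite -[leLHS]mul1r ler_pdivrMr//; nra.
Qed.

Lemma sum_exp_cover L om : 1 <= L -> sumI om <= expR (- (L + L^-1 ^+ 2)) ->
  \sum_(i < n) expR (Y i om) <= expR (- L) \/ exists i, w i = 0 /\ big_coord i L om.
Proof.
move=> L1 h; have [hn|hn] := pselect (exists i, w i = 0 /\ big_coord i L om); first by right.
left; set y2 := L^-1 ^+ 2 in h *.
have Lp : 0 < L by exact: lt_le_trans L1.
have y20 : 0 <= y2 by exact: sqr_ge0.
have y21 : y2 <= 1 by rewrite expr_le1 ?invr_ge0 ?(ltW Lp)// invf_le1.
have n0 : 0 < n%:R :> R by rewrite ltr0n dim_gt0.
have hL : sumI om <= expR (- L).
  by apply: (le_trans h); rewrite ler_expR lerN2 lerDl.
pose f i := if w i == 0 then 0 else expR (Y i om).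
have fI : sumI om = \sum_i f i.
  rewrite (sum_bidx (w := w)); last by move=> i; rewrite /f => ->; rewrite eqxx.
  by apply: eq_bigr => k _; rewrite /f (negPf (bidx_neq0 k)).
apply: le_trans (_ : \sum_(i < n) (f i + expR (- L) * y2 / (2 * n%:R)) <= _).
  apply: ler_sum => i _; rewrite /f; case: eqP => wi.
    rewrite add0r leNgt; apply/negP => lt; apply: hn; exists i; split => //.
  by rewrite lerDl divr_ge0// mulr_ge0// expR_ge0.
rewrite big_split/= -fI sumr_const card_ord -[X in _ + X]mulr_natr.
have -> : expR (- L) * y2 / (2 * n%:R) * n%:R = expR (- L) * (y2 / 2).
  by field; rewrite gt_eqF.
have y2i : 0 <= y2 <= 1 by rewrite y20.
have := expRN_le_half y2i => h3; apply: le_trans (lerD h (lexx _)) _.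
rewrite opprD expRD -mulrDr ger_pMr ?expR_gt0//; lra.
Qed.

Lemma measure_le_cover (A : set T) (E : 'I_n -> set T) (r : seq 'I_n) (C : set T) :
  measurable A -> measurable C -> (forall i, measurable (E i)) ->
  (forall om, A om -> C om \/ exists2 i, i \in r & E i om) ->
  (P A <= P C + \sum_(i <- r) P (E i))%E.
Proof.
move=> mA + mE; elim: r C => [|i r IH] C mC h.
  rewrite big_nil adde0; apply: le_measure; rewrite ?inE// => om /h[//|[i]].
  by rewrite in_nil.
rewrite big_cons addeA; apply: le_trans (_ : P (C `|` E i) + \sum_(j <- r) P (E j) <= _)%E.
  apply: IH; first exact: measurableU.
  move=> om /h[hC|[j]]; first by left; left.
  by rewrite in_cons => /predU1P[->|jr] Ej; [left; right|right; exists j].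
by rewrite leeD2r// measureU2.
Qed.

End left_tail.

Theorem theorem1 (R : realType) (n : nat)
  (d : measure_display) (T : measurableType d) (P : probability T R)
  (Y : 'I_n -> {RV P >-> R}) (mu : 'I_n -> R) (B : 'M[R]_n) (wbar : 'I_n -> R) :
  B^T = B -> 0 < \det B ->
  gaussian_vector P (fun i => (Y i : T -> R)) mu B ->
  simplex_minimizer B wbar ->
  assumption_A B wbar ->
  exists K delta : R, 0 < delta /\
    forall x : R, 0 < x -> x < delta ->
      `| fine (P [set om | \sum_(i < n) expR (Y i om) <= x])
         - main_term B mu wbar x |
      <= K * main_term B mu wbar x / ln x^-1.
Proof.
move=> sB _ gY wmin hA; set w := wbar.
have l0 := qform_min_gt0 gY wmin.
have m0 := nbar_gt0 wmin.
have pB : posdefmx (Bbar B w).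
  by rewrite BbarE; apply: (subgaussian_posdef gY) => //; exact: bidx_inj.
have uB := posdef_unit pB; have dB := posdef_det_gt0 pB.
have A0 k : 0 < rowsum (invmx (Bbar B w)) k := Abar_gt0 sB wmin k uB l0.
pose mub : 'rV[R]_(nbar w) := \row_k mu (bidx w k).
have [K1 [L1 HF]] := gauss_sum_asymp mub m0 pB A0.
have [c0 [c1 [q HG]]] := gmain_profile mub dB.
have SE : \sum_k rowsum (invmx (Bbar B w)) k = (qform B w)^-1 := SbarE sB wmin uB l0.
rewrite SE in HG; set S := _^-1 in HG.
pose G := gprofile c0 S c1 q.
have S0 : 0 <= S by rewrite invr_ge0 ltW.
have G0 L : 0 < G L by exact: expR_gt0.
have [K2 [K20 HS]] := gprofile_shift c0 c1 q S0.
(* Support indices get the empty set, so that one threshold per index can be chosen uniformly. *)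
have tailP i : exists L0 : R, forall L, L0 <= L ->
    (P (if w i == 0%R then big_coord Y w i L else set0) <= (G L / L)%:E)%E.
  case: eqP => [wi|_]; first exact: (big_coord_tail sB gY wmin hA c0 c1 q wi).
  exists 0 => L L0; rewrite measure0 lee_fin; apply: divr_ge0 => //; exact: ltW.
have [f Hf] := choice tailP.
pose K1' := `|K1|; have K10 : 0 <= K1' := normr_ge0 K1.
(* Below expR (- M) all thresholds on [L] are met at once; K1' <= L also keeps the factor 1 - K1' /
   L nonnegative. *)
pose M := 1 + `|L1| + K1' + \sum_i `|f i|.
have f0 : 0 <= \sum_i `|f i| by apply: sumr_ge0.
exists (K1' + K2 + n%:R), (expR (- M)); split; first exact: expR_gt0.
move=> x x0 xd; set L := ln x^-1.
have xE : x = expR (- L) by rewrite /L lnV ?posrE// opprK lnK.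
have ML : M < L by rewrite -ltrN2 -ltr_expR -xE.
have L1L : L1 <= L by have := ler_norm L1; rewrite /M in ML; lra.
have Lge1 : 1 <= L by rewrite /M in ML; have := normr_ge0 L1; lra.
have KL : K1' <= L by rewrite /M in ML; have := normr_ge0 L1; lra.
have fL i : f i <= L.
  apply: le_trans (ler_norm _) _.
  have : `|f i| <= \sum_i `|f i| by rewrite (bigD1 i)//= lerDl sumr_ge0.
  by rewrite /M in ML; have := normr_ge0 L1; lra.
have Lp : 0 < L by exact: lt_le_trans Lge1.
have x1 : x < 1 by rewrite xE -expR0 ltr_expR oppr_lt0.
have mtE : main_term B mu w x = G L.
  by rewrite main_termE ?x0// -/L HG.
rewrite mtE; set X := [set om | _].
have mX : measurable X := measurable_sum_le Y id x.
pose XI (l : R) := [set om | \sum_k expR (Y (bidx w k) om) <= expR (- l)].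
have mXI l : measurable (XI l) := measurable_sum_le Y (bidx w) (expR (- l)).
have PXI l : L1 <= l -> exists F, P (XI l) = F%:E /\ `|F - G l| <= K1 / l * G l.
  move=> /HF[F [FE Fle]]; exists F; split; last by rewrite /G -HG.
  by rewrite -FE BbarE; apply: (subtuple_prob gY) => //; exact: bidx_inj.
have Pfin (A : set T) : measurable A -> P A = (fine (P A))%:E.
  by move=> mA; rewrite fineK// fin_num_measure.
set p := fine (P X).
(* Dropping the coordinates outside the support only enlarges the event. *)
have up : p <= G L * (1 + K1' / L).
  have [F [FE Fle]] := PXI L L1L.
  have : p <= F.
    rewrite -lee_fin -FE -Pfin//; apply: le_measure; rewrite ?inE//.
    move=> om; rewrite /X /XI/= -xE; apply: le_trans.
    have -> : \sum_k expR (Y (bidx w k) om) = \sum_(i in Ibar w) expR (Y i om).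
      by apply/esym; exact: big_enum_val.
    rewrite [leRHS](bigID (mem (Ibar w)))/=.
    by rewrite lerDl sumr_ge0// => i _; exact: expR_ge0.
  move=> /le_trans; apply; have := le_trans (ler_norm _) Fle.
  have : K1 / L * G L <= K1' / L * G L.
    by rewrite ler_pM2r// ler_pM2r ?invr_gt0// ler_norm.
  lra.
(* The support event at level L + 1 / L^2 is covered by the event itself and at most n events
   [big_coord], each of probability at most G L / L. *)
have low : G L * (1 - (K1' + K2 + n%:R) / L) <= p.
  pose l := L + L^-1 ^+ 2.
  have Ll : L <= l by rewrite lerDl sqr_ge0.
  have lp : 0 < l by exact: lt_le_trans Ll.
  have [F [FE Fle]] := PXI l (le_trans L1L Ll).
  have cov : (P (XI l) <= P X + \sum_(i < n) (G L / L)%:E)%E.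
    apply: le_trans (_ : P X + \sum_(i < n) P (if w i == 0%R then big_coord Y w i L else set0) <= _)%E.
      apply: measure_le_cover => //.
        by move=> i; case: ifP => // _; exact: measurable_big_coord.
      move=> om h; have [h1|[i [wi hi]]] := sum_exp_cover wmin Lge1 h.
        by left; rewrite /X/= xE.
      by right; exists i; [rewrite mem_index_enum|rewrite /w wi eqxx].
    by rewrite leeD2l//; apply: lee_sum => i _; exact: Hf.
  have {}cov : F <= p + n%:R * (G L / L).
    move: cov; rewrite FE Pfin// sumEFin -EFinD lee_fin sumr_const card_ord.
    by rewrite mulr_natl.
  have Fl : G l * (1 - K1' / L) <= F.
    have : `|F - G l| <= K1' / L * G l.
      apply: (le_trans Fle); rewrite ler_pM2r//.
      apply: le_trans (_ : K1' / l <= _); first by rewrite ler_pM2r ?invr_gt0// ler_norm.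
      by rewrite ler_wpM2l// lef_pV2.
    by rewrite ler_distl => /andP[+ _]; lra.
  have k1 : 0 <= 1 - K1' / L by rewrite subr_ge0 ler_pdivrMr// mul1r.
  have h := HS L Lge1; rewrite -/(G L) -/l -/(G l) in h.
  have h2 : G L * (1 - K2 / L) * (1 - K1' / L) <= G l * (1 - K1' / L) by rewrite ler_wpM2r.
  have h3 : 0 <= G L * (K2 / L * (K1' / L)).
    by rewrite !mulr_ge0 ?invr_ge0 ?(ltW Lp) ?(ltW (G0 L)).
  have -> : G L * (1 - (K1' + K2 + n%:R) / L) =
      G L * (1 - K2 / L) * (1 - K1' / L) - G L * (K2 / L * (K1' / L)) - n%:R * (G L / L).
    by field; rewrite gt_eqF.
  lra.
have -> : (K1' + K2 + n%:R) * G L / L = G L * ((K1' + K2 + n%:R) / L) by ring.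
have h4 : G L * (K1' / L) <= G L * ((K1' + K2 + n%:R) / L).
  by rewrite ler_pM2l// ler_pM2r ?invr_gt0// -addrA lerDl addr_ge0.
rewrite ler_distl; apply/andP; split.
  by apply: le_trans low; rewrite mulrBr mulr1.
by apply: (le_trans up); rewrite mulrDr mulr1 lerD2l.
Qed.
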